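(* Let $p,q\in(1,\infty)$, let $p'$ be the conjugate exponent of $p$ ($\frac1p+\frac1{p'}=1$), and let $\alpha>0$ be defined by $\alpha q=p$. Let $\vartheta\in(0,\frac{\pi}{2})$ and let $A$ be an injective diagonal operator on $X=\ell_q$ with eigenvalues $\lambda_n\in S(\vartheta)=\{z\in\mathbb{C}\setminus\{0\}:|\arg z|<\vartheta\}$, $n\in\mathbb{N}$. Let $b=(b_n)$ be a sequence of complex numbers and consider the discrete measure $\mu=\sum_n\left|\frac{b_n}{\lambda_n}\right|^q\delta_{\lambda_n^{-1}}$ on $\mathbb{C}_+\cong\mathbb{R}^2_+$. (a) If $\mu$ is embedding $\alpha$-Carleson, then $b\in X_{-\theta}$ for all $\theta>\frac1{p'}$ and $b$ is an infinite-time $L^p$-admissible input element for $A$. (b) If $b$ is an infinite-time $L^p$-admissible input element for $A$, then $b\in X_{-\theta}$ for all $\theta>\frac1{p'}$ and $\mu$ is geometric $\alpha$-Carleson. In particular, if $p\le q$ then the $\alpha$-Carleson property of $\mu$ characterises admissibility: the three conditions ''$\mu$ is embedding $\alpha$-Carleson'', ''$\mu$ is geometric $\alpha$-Carleson'' and ''$b$ is an infinite-time $L^p$-admissible input element for $A$'' are equivalent.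
   Context: Diagonal setting: $A$ acts on $\ell_q$ by $(Ax)_n=\lambda_nx_n$ with maximal domain, and $-A$ generates the semigroup $(S(t)x)_n=e^{-\lambda_nt}x_n$. For $\theta>0$, $X_{-\theta}$ is the space of complex sequences $(\xi_n)$ with $\sum_n |\xi_n|^q/|1+\lambda_n|^{\theta q}<\infty$; for $\theta=1$ this is the extrapolation space $X_{-1}=\{(\xi_n):(\xi_n/(1+\lambda_n))\in\ell_q\}$, to which $S(\cdot)$ extends by the same formula. Admissibility: an element $b\in X_{-1}$ is an infinite-time $L^p$-admissible input element for $A$ if there is a constant $K>0$ such that for every $\tau>0$, every scalar $u\in L^p(0,\tau)$ and every $t\in[0,\tau]$, the integral $\int_0^tS(t-s)b\,u(s)\,ds$ (a Bochner integral in $X_{-1}$) lies in $X$ and satisfies $\|\int_0^tS(t-s)b\,u(s)\,ds\|_X\le K\|u\|_{L^p(0,\tau)}$. Carleson measures: $\mathbb{R}^2_+=\mathbb{R}\times(0,\infty)$ is identified with the right half plane $\mathbb{C}_+=\{z:\mathrm{Re}\,z>0\}$ by $(x,t)\leftrightarrow t+ix$. Let $P_t(x)=\frac{1}{\pi}\frac{t}{t^2+x^2}$ be the Poisson kernel. For $r\in(1,\infty)$, $H^r(\mathbb{R}^2_+)$ is the space of Poisson extensions $(x,t)\mapsto (P_t*f)(x)$ of $f\in L^r(\mathbb{R})$, with norm $\|f\|_{L^r(\mathbb{R})}$. For $\alpha>0$, a non-negative Borel measure $\mu$ on $\mathbb{R}^2_+$ is embedding $\alpha$-Carleson if, for some $r\in[1,\infty)$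 with $\alpha r>1$, there is a constant $M$ with $\|F\|_{L^r(\mathbb{R}^2_+,\mu)}\le M\|F\|_{H^{\alpha r}(\mathbb{R}^2_+)}$ for all $F\in H^{\alpha r}(\mathbb{R}^2_+)$; this property does not depend on the choice of such $r$ (for instance $r=q$ when $\alpha q>1$). For an interval $Q\subseteq\mathbb{R}$ the tent over $Q$ is $T(Q)=\mathbb{R}^2_+\setminus\bigcup_{x\notin Q}\{(y,t)\in\mathbb{R}^2_+:|x-y|<t\}$. The measure $\mu$ is geometric $\alpha$-Carleson if there is a constant $c$ with $\mu(T(Q))^\alpha\le c\,|Q|$ for all bounded intervals $Q\subseteq\mathbb{R}$. *)

(* Defs.v *)
From Stdlib Require List.
From mathcomp Require Export all_boot all_order all_algebra.
From mathcomp Require Export all_classical all_reals all_analysis.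
From mathcomp Require Export complex.

Set Implicit Arguments.
Unset Strict Implicit.
Unset Printing Implicit Defensive.

Import Order.TTheory GRing.Theory Num.Def Num.Theory.
Import numFieldNormedType.Exports.
Import ComplexField.Normc.

Local Open Scope classical_set_scope.
Local Open Scope ring_scope.
Local Open Scope complex_scope.

Section complex_numbers.
Variable R : realType.
Implicit Types z w : R[i].

Definition cexp z : R[i] :=
  (expR (complex.Re z) * cos (complex.Im z))
    +i* (expR (complex.Re z) * sin (complex.Im z)).

(* Principal argument of a nonzero complex number, in ]-pi, pi]. *)
Definition carg z : R :=
  if 0 <= complex.Im z then acos (complex.Re z / normc z)
  else - acos (complex.Re z / normc z).

Definition sector (vtheta : R) : set R[i] :=
  [set z | z != 0 /\ `|carg z| < vtheta].

End complex_numbers.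

Section complex_valued_functions.
Context {d : measure_display} {T : measurableType d} {R : realType}.

Definition cmeasurable (D : set T) (f : T -> R[i]) : Prop :=
  measurable_fun D (fun x => complex.Re (f x)) /\
  measurable_fun D (fun x => complex.Im (f x)).

Definition cintegral (mu : {measure set T -> \bar R}) (D : set T)
    (f : T -> R[i]) : R[i] :=
  Rintegral mu D (fun x => complex.Re (f x))
    +i* Rintegral mu D (fun x => complex.Im (f x)).

Definition cLnorm (mu : {measure set T -> \bar R}) (D : set T) (r : R)
    (f : T -> R[i]) : \bar R :=
  'N[mu]_(r%:E)[(fun x => (normc (f x))%:E) \_ D]%E.

Definition cLfun (mu : {measure set T -> \bar R}) (D : set T) (r : R) :
    set (T -> R[i]) :=
  [set f | cmeasurable D f /\ (cLnorm mu D r f < +oo)%E].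

End complex_valued_functions.

Section bochner.
Context {R : realType}.

(* A simple function R -> C^nat is given by a representation
   sum_j 1_(A_j) c_j, as a list of pairs (A_j, c_j). *)
Definition simple_fct := seq (set R * (nat -> R[i])).

Definition simple_eval (s : simple_fct) (x : R) : nat -> R[i] :=
  fun n => \sum_(Ac <- s) (\1_(Ac.1) x)%:C * Ac.2 n.

Definition simple_integral (D : set R) (s : simple_fct) : nat -> R[i] :=
  fun n => \sum_(Ac <- s) (fine (lebesgue_measure (Ac.1 `&` D)))%:C * Ac.2 n.

Definition simple_wf (nrm : (nat -> R[i]) -> \bar R) (s : simple_fct) : Prop :=
  forall A c, List.In (A, c) s -> measurable A /\ (nrm c < +oo)%E.

(* v is the Bochner integral over D (a set of finite measure) of f, which takes
   values in the Banach space of those sequences for which the extended norm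
   nrm is finite. *)
Definition is_bochner_integral (nrm : (nat -> R[i]) -> \bar R) (D : set R)
    (f : R -> nat -> R[i]) (v : nat -> R[i]) : Prop :=
  exists s : nat -> simple_fct,
  [/\ forall k, simple_wf nrm (s k),
      {ae lebesgue_measure, forall x, D x ->
         nrm (f x - simple_eval (s k) x)%R @[k --> \oo] --> 0%E},
      (\int[lebesgue_measure]_(x in D)
         nrm (f x - simple_eval (s k) x)%R)%E @[k --> \oo] --> 0%E &
      nrm (simple_integral D (s k) - v)%R @[k --> \oo] --> 0%E].

End bochner.

Section diagonal.
Context {R : realType}.
Variables (q : R) (lambda : nat -> R[i]).
Implicit Types x xi b : nat -> R[i].

Definition lq_norm x : \bar R :=
  ((\sum_(0 <= n <oo) (normc (x n) `^ q)%:E) `^ q^-1)%E.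

Definition lq : set (nat -> R[i]) := [set x | (lq_norm x < +oo)%E].

Definition diag_op x : nat -> R[i] := fun n => lambda n * x n.

Definition diag_dom : set (nat -> R[i]) := [set x | lq x /\ lq (diag_op x)].

Definition diag_sg (t : R) x : nat -> R[i] :=
  fun n => cexp (- (lambda n * t%:C)) * x n.

Definition Xneg (theta : R) : set (nat -> R[i]) :=
  [set xi | (\sum_(0 <= n <oo)
     (normc (xi n) `^ q / normc (1 + lambda n) `^ (theta * q))%:E < +oo)%E].

Definition Xm1_norm xi : \bar R := lq_norm (fun n => xi n / (1 + lambda n)).

Definition Xm1 : set (nat -> R[i]) := [set xi | (Xm1_norm xi < +oo)%E].

Definition admissible (p : R) b : Prop :=
  Xm1 b /\
  exists2 K : R, 0 < K &
    forall (tau : R) (u : R -> R[i]), 0 < tau ->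
      cLfun lebesgue_measure `]0, tau[ p u ->
      forall t : R, 0 <= t <= tau ->
      exists v : nat -> R[i],
        [/\ is_bochner_integral Xm1_norm `]0, t[
              (fun s n => diag_sg (t - s) b n * u s) v,
            lq v &
            (lq_norm v <= K%:E * cLnorm lebesgue_measure `]0%R, tau[ p u)%E].

End diagonal.

Section carleson.
Context {R : realType}.

(* The pair (x, t) stands for the point t + i x of the right half plane. *)
Definition halfplane : set (R * R) := [set z | 0 < z.2].

Definition of_complex (z : R[i]) : R * R := (complex.Im z, complex.Re z).

Definition poisson_kernel (t x : R) : R := pi^-1 * (t / (t ^+ 2 + x ^+ 2)).

Definition poisson_ext (f : R -> R[i]) (z : R * R) : R[i] :=
  cintegral lebesgue_measure setT
    (fun y => (poisson_kernel z.2 (z.1 - y))%:C * f y).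

(* H^(alpha r) consists of the functions poisson_ext f, f in L^(alpha r)(R),
   with norm the L^(alpha r) norm of f. *)
Definition embedding_carleson (alpha : R)
    (mu : {measure set (R * R) -> \bar R}) : Prop :=
  exists r : R, [/\ 1 <= r, 1 < alpha * r &
    exists M : R, forall f : R -> R[i],
      cLfun lebesgue_measure setT (alpha * r) f ->
      (cLnorm mu halfplane r (poisson_ext f)
         <= M%:E * cLnorm lebesgue_measure setT (alpha * r) f)%E].

Definition cone (x : R) : set (R * R) :=
  [set z | halfplane z /\ `|x - z.1| < z.2].

Definition tent (Q : set R) : set (R * R) :=
  halfplane `\` \bigcup_(x in ~` Q) cone x.

Definition geometric_carleson (alpha : R)
    (mu : {measure set (R * R) -> \bar R}) : Prop :=
  exists c : R, forall Q : set R, is_interval Q -> bounded_set Q ->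
    (mu (tent Q) `^ alpha <= c%:E * lebesgue_measure Q)%E.

Definition carleson_weight (q : R) (lambda b : nat -> R[i]) (n : nat) :
    {nonneg R} :=
  NngNum (powR_ge0 (normc (b n / lambda n)) q).

Definition carleson_measure (q : R) (lambda b : nat -> R[i]) :
    {measure set (R * R) -> \bar R} :=
  mseries (fun n => mscale (carleson_weight q lambda b n)
                      \d_(of_complex (lambda n)^-1)) 0.

End carleson.

(* Main.v *)
(* Write rho_n = 1 / |lambda_n| and w_n = |b_n / lambda_n|^q, the weights of mu.
   Since 1 / lambda_n stays in a sector, the Poisson kernel at 1 / lambda_n is
   comparable to rho_n / (y^2 + rho_n^2), the kernel of a Hardy-type operator,
   and this kernel also dominates |lambda_n| e^(- Re lambda_n y) for y >= 0.
   The geometric condition becomes the growth condition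
   sum_(rho_n <= L) w_n <= C L^(q/p), and dyadic summation turns growth into
   b in X_(-theta), and for p <= q, by Hoelder's inequality with power weights
   and Tonelli's theorem, into
   (E)  sum_n w_n (Hardy v)(rho_n)^q <= C (int v^p)^(q/p)  for all v >= 0.
   An embedding with any exponent r gives (E): apply it to the power q/r of
   s |-> (Hardy v)(|s|), which is in L^(alpha r) because the Hardy operator is
   bounded on L^p, and whose Poisson extension dominates (Hardy v)^(q/r) by
   Harnack's inequality.  In turn (E) gives growth when v is the indicator
   function of [0, L], and admissibility when v(y) = |u(t - y)|.  Admissibility
   gives growth when u = 1, as |1 - e^(- lambda_n L)| is bounded below for
   rho_n <= L. *)

From HB Require Import structures.
From mathcomp Require Import interval_inference measurable_realfun ring lra.
Require Import Defs.
Import Order.TTheory GRing.Theory Num.Def Num.Theory.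
Import numFieldNormedType.Exports.
Import ComplexField.Normc.
Local Open Scope classical_set_scope.
Local Open Scope ring_scope.
Local Open Scope complex_scope.

Set Implicit Arguments.
Unset Strict Implicit.
Unset Printing Implicit Defensive.

(** * Power integrals under a growth condition *)

(** The obstacle is to pass from growth, which only sees the sets rho <= L, to (E) for all v. Every
    quantity is homogeneous in rho, so power weights lose nothing but constants. With t^(1/(p p'))
    as Schur weight, (Hardy v)^p is at most a multiple of rho^(-1/p') J, where J is linear in v^p
    and is itself at most rho^(-1/p) times the integral of v^p. In J^(q/p) = J J^(q/p - 1) the
    second factor is bounded pointwise and the first is left to Tonelli; the exponent q/p - 1 has to
    be nonnegative, which is where p <= q enters. Going through (E) also settles the exponent r: an
    embedding is given for some r only, while (E) no longer mentions it. On the semigroup side the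
    integrals are Bochner integrals in X_(-1), given by approximating simple functions. Coordinate
    functionals are bounded there, so such an integral is determined by scalar integrals; its
    existence is dominated convergence over the coordinates and then over time, with b in X_(-1)
    providing the summable majorant. *)

Lemma measurable_funV d (T : measurableType d) (R : realType) (f : T -> R) :
  measurable_fun setT f -> measurable_fun setT (fun x => (f x)^-1).
Proof.
(* [powR] with exponent -1 is the inverse only on nonnegative bases, hence the square. *)
move=> mf; rewrite (_ : (fun _ => _) = (fun x => f x * (f x ^+ 2) `^ (- 1))).
  apply: measurable_funM => //.
  by apply: (measurableT_comp (measurable_powR _)); exact: measurable_funX.
apply/funext => x; rewrite powR_inv1 ?sqr_ge0//.
have [->|x0] := eqVneq (f x) 0; first by rewrite invr0 mul0r.
by rewrite expr2 invfM mulrA mulfV// mul1r.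
Qed.

Lemma measurable_fun_powR d (T : measurableType d) (R : realType) (f : T -> R)
    (e : R) :
  measurable_fun setT f -> measurable_fun setT (fun x => f x `^ e).
Proof. by move=> mf; apply: (measurableT_comp (measurable_powR _)). Qed.

Section integral_facts.
Local Open Scope ereal_scope.
Context d (T : measurableType d) (R : realType).
Variable mu : {measure set T -> \bar R}.

(** The integral of a nonnegative function is a supremum over the simple functions below it, so it
    is monotone on arbitrary functions. *)
Lemma le_integral_nonneg (D : set T) (f g : T -> \bar R) :
  (forall x, D x -> 0 <= f x) -> (forall x, D x -> f x <= g x) ->
  \int[mu]_(x in D) f x <= \int[mu]_(x in D) g x.
Proof.
move=> f0 fg; rewrite ge0_integralE// ge0_integralE; last first.
  by move=> x Dx; exact: le_trans (f0 x Dx) (fg x Dx).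
apply: le_ereal_sup => _ [h hf <-]; exists h => // x.
by apply: (le_trans (hf x)); apply: lee_restrict.
Qed.

End integral_facts.

Section dyadic.
Local Open Scope ereal_scope.
Context d (T : measurableType d) (R : realType).
Variables (nu : {measure set T -> \bar R}) (rho : T -> R) (C a : R).
Hypothesis mrho : measurable_fun setT rho.

(** Two instances matter: Lebesgue measure with [rho] the absolute value and a = 1, and the weights
    of mu with rho_n = 1 / |lambda_n| and a = q / p. *)
Definition growth := (0 <= C)%R /\ forall L : R, (0 < L)%R ->
  nu [set x | (0 < rho x <= L)%R] <= (C * L `^ a)%:E.

Lemma measurable_between (x y : R) : measurable [set t | (x < rho t <= y)%R].
Proof.
rewrite (_ : [set _ | _] = rho @^-1` `]x, y]); last first.
  by apply/seteqP; split => t /=; rewrite in_itv.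
rewrite -[_ @^-1` _]setTI; exact: mrho.
Qed.

Hypothesis gr : growth.

(** The factor 2^|e| serves both signs of e: it is at least 1 when e >= 0, and it pays for r > t / 2
    when e < 0. *)
Lemma powR_le_dyadic (e r t : R) : (t / 2 < r <= t -> 0 < t ->
  r `^ e <= 2 `^ `|e| * t `^ e)%R.
Proof.
move=> /andP[tr rt] t0.
have r0 : (0 < r)%R by apply: lt_trans tr; rewrite divr_gt0.
case: (leP 0%R e) => e0.
  rewrite ger0_norm// -[leLHS]mul1r ler_pM// ?powR_ge0//.
  - by rewrite -[leLHS](powRr0 2) ler_powR// ler1n.
  - by rewrite ge0_ler_powR// ?nnegrE ltW.
rewrite ltr0_norm// -{1}(opprK e) powRN -{3}(opprK e) (powRN t).
rewrite ler_pdivlMr ?powR_gt0// ler_pdivrMl ?powR_gt0//.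
rewrite -powRM ?(ltW r0)//.
rewrite ge0_ler_powR ?nnegrE ?mulr_ge0 ?oppr_ge0 ?(ltW r0) ?(ltW t0) ?(ltW e0)//.
rewrite ltW//.
by rewrite -ltr_pdivrMr.
Qed.

(* [theta] runs over a dyadic scale, s / 2^k or 2 s 2^k. *)
Lemma integral_powR_dyadic (e : R) (theta : nat -> R) (B : set T) :
  (forall k, (0 < theta k)%R) -> measurable B ->
  (forall x, B x -> exists k, (theta k / 2 < rho x <= theta k)%R) ->
  \int[nu]_(x in B) (rho x `^ e)%:E <=
  \sum_(0 <= k <oo) (2 `^ `|e| * C * theta k `^ (a + e))%:E.
Proof.
move=> t0 mB cov; have [C0 grC] := gr.
pose A k := [set x | (theta k / 2 < rho x <= theta k)%R].
have mA k : measurable (A k) by exact: measurable_between.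
pose F k x : \bar R := (2 `^ `|e| * theta k `^ e)%:E * (\1_(A k) x)%:E.
have F0 k x : 0 <= F k x by rewrite mule_ge0 ?lee_fin ?mulr_ge0 ?powR_ge0.
have mF k : measurable_fun B (F k).
  by apply: measurable_funeM; apply/measurable_EFinP; exact: measurable_indic.
apply: (@le_trans _ _ (\int[nu]_(x in B) \sum_(0 <= k <oo) F k x)).
  apply: le_integral_nonneg => x Bx; first by rewrite lee_fin powR_ge0.
  have [k kx] := cov _ Bx.
  apply: le_trans (nneseries_lim_ge k.+1 _); last by move=> n _ _; exact: F0.
  rewrite big_mkord big_ord_recr /= -[leLHS]add0e leeD ?sume_ge0//.
  by rewrite /F indicE mem_set// mule1 lee_fin powR_le_dyadic.
rewrite integral_nneseries//; apply: lee_nneseries => [k _ _|k _].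
  by apply: integral_ge0 => x _; exact: F0.
rewrite ge0_integralZl//; last 2 first.
  - by apply/measurable_EFinP; exact: measurable_indic.
  - by rewrite lee_fin mulr_ge0// powR_ge0.
rewrite integral_indic// powRD; last by rewrite (gt_eqF (t0 k)) implybT.
rewrite (_ : _ * _ * _ = (2 `^ `|e| * theta k `^ e) * (C * theta k `^ a))%R;
  last by ring.
rewrite [leRHS]EFinM lee_wpmul2l ?lee_fin ?mulr_ge0 ?powR_ge0//.
apply: le_trans (grC _ (t0 k)); apply: le_measure; rewrite ?inE//.
- exact: measurableI.
- exact: measurable_between.
- move=> x [/andP[? ?] _]; apply/andP; split => //.
  by apply: lt_trans (divr_gt0 (t0 k) (ltr0n _ 2)) _.
Qed.

Lemma nneseries_geometric (c z : R) : (0 <= c -> 0 <= z < 1 ->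
  (\sum_(0 <= k <oo) (c * z ^+ k)%:E = (c / (1 - z))%:E)%E)%R.
Proof.
move=> c0 /andP[z0 z1].
have := @cvg_geometric_series R c z; rewrite ger0_norm// => /(_ z1) h.
apply/cvg_lim => //=.
rewrite (_ : (fun n => _) = EFin \o series (geometric c z)).
  by apply: cvg_EFin; [exact: nearW|exact: h].
by apply/funext => n /=; rewrite /series/= sumEFin.
Qed.

(** On the blocks of the scale s / 2^k the bounds form a geometric series of ratio (1/2)^(a + e),
    which is below 1 because a + e > 0. *)
Lemma integral_powR_small (e : R) : (0 < a + e)%R ->
  exists2 C' : R, (0 <= C')%R & forall s : R, (0 < s)%R ->
  \int[nu]_(x in [set x | (0 < rho x <= s)%R]) (rho x `^ e)%:E <=
  (C' * s `^ (a + e))%:E.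
Proof.
move=> ae; have C0 := gr.1.
have z01 : (0 <= (2^-1 : R) `^ (a + e) < 1)%R.
  rewrite powR_ge0/=; have : (2^-1 < 1 :> R)%R by rewrite invf_lt1// ltr1n.
  by move=> /(gt0_ltr_powR ae); rewrite powR1; apply; rewrite nnegrE.
exists (2 `^ `|e| * C / (1 - 2^-1 `^ (a + e)))%R.
  by rewrite divr_ge0 ?mulr_ge0 ?powR_ge0// subr_ge0 ltW//; case/andP: z01.
move=> s s0.
apply: (@le_trans _ _ (\sum_(0 <= k <oo)
    (2 `^ `|e| * C * (s * 2^-1 ^+ k) `^ (a + e))%:E)).
  apply: integral_powR_dyadic.
  - by move=> k; rewrite mulr_gt0// exprn_gt0.
  - exact: measurable_between.
  - move=> x /= /andP[x0 xs].
    have ex : exists k : nat, (s * 2^-1 ^+ k / 2 < rho x)%R.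
      have := @cvg_geometric R s 2^-1%R; rewrite ger0_norm// => h.
      have /h/cvgrPdist_lt/(_ _ x0)[k _ /(_ k (leqnn k))] : (2^-1 < 1 :> R)%R.
        by rewrite invf_lt1// ltr1n.
      rewrite /= sub0r normrN ger0_norm ?mulr_ge0 ?ltW// => skx.
      exists k; rewrite ltr_pdivrMr//; apply: (lt_le_trans skx).
      by rewrite ler_peMr// ?ler1n// ltW.
    (* The least such k names the block of x: its lower end holds by choice, and its upper end
       because k - 1 fails, or because rho x <= s when k = 0. *)
    exists (ex_minn ex); case: ex_minnP => -[|k] kx min.
      by rewrite kx expr0 mulr1.
    rewrite kx/= exprS mulrCA mulrC leNgt; apply/negP => h.
    by have := min k h; rewrite ltnn.
have E k : (2 `^ `|e| * C * (s * 2^-1 ^+ k) `^ (a + e) =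
    (2 `^ `|e| * C * s `^ (a + e)) * (2^-1 `^ (a + e)) ^+ k)%R.
  rewrite powRM ?exprn_ge0//; last exact: ltW.
  rewrite -powR_mulrn// powRAC powR_mulrn ?powR_ge0//; ring.
rewrite (eq_eseriesr (g := fun k => ((2 `^ `|e| * C * s `^ (a + e)) *
  (2^-1 `^ (a + e)) ^+ k)%:E)); last by move=> k _; rewrite E.
rewrite nneseries_geometric// ?mulr_ge0 ?powR_ge0//.
by rewrite lee_fin le_eqVlt; apply/orP; left; apply/eqP; ring.
Qed.

Lemma integral_powR_large (e : R) : (a + e < 0)%R ->
  exists2 C' : R, (0 <= C')%R & forall s : R, (0 < s)%R ->
  \int[nu]_(x in [set x | (s < rho x)%R]) (rho x `^ e)%:E <=
  (C' * s `^ (a + e))%:E.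
Proof.
move=> ae; have C0 := gr.1.
have z01 : (0 <= (2 : R) `^ (a + e) < 1)%R.
  rewrite powR_ge0/= -[X in (_ `^ X)%R]opprK powRN invf_lt1 ?powR_gt0//.
  have : (1 < 2 :> R)%R by rewrite ltr1n.
  rewrite -oppr_gt0 in ae.
  by move=> /(gt0_ltr_powR ae); rewrite powR1; apply; rewrite nnegrE.
(* The scale 2 s 2^k is shifted by one step so that its first block is ]s, 2 s]; this shift is the
   factor 2^(a + e) in the numerator. *)
exists (2 `^ `|e| * C * 2 `^ (a + e) / (1 - 2 `^ (a + e)))%R.
  by rewrite divr_ge0 ?mulr_ge0 ?powR_ge0// subr_ge0 ltW//; case/andP: z01.
move=> s s0.
apply: (@le_trans _ _ (\sum_(0 <= k <oo)
    (2 `^ `|e| * C * (2 * s * 2 ^+ k) `^ (a + e))%:E)).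
  apply: integral_powR_dyadic.
  - by move=> k; rewrite mulr_gt0 ?mulr_gt0// exprn_gt0.
  - rewrite (_ : [set _ | _] = rho @^-1` `]s, +oo[); last first.
      by apply/seteqP; split => t /=; rewrite in_itv/= andbT.
    by rewrite -[_ @^-1` _]setTI; exact: mrho.
  - move=> x /= xs.
    have ex : exists k : nat, (rho x <= 2 * s * 2 ^+ k)%R.
      have [k hk] : exists k : nat, (rho x / (2 * s) <= 2 ^+ k)%R.
        exists (Num.bound `|rho x / (2 * s)|%R).
        rewrite (le_trans (ler_norm _))// ltW// (lt_le_trans (archi_boundP _))//.
        by rewrite -natrX ler_nat; exact: ltnW (ltn_expl _ _).
      by exists k; rewrite mulrC -ler_pdivrMr// mulr_gt0.
    exists (ex_minn ex); case: ex_minnP => -[|k] kx min.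
      by rewrite kx andbT expr0 (_ : 2 * s * 1 / 2 = s)%R//; field.
    rewrite kx andbT exprS (_ : 2 * s * (2 * 2 ^+ k) / 2 = 2 * s * 2 ^+ k)%R.
      2: by field.
    by rewrite ltNge; apply/negP => h; have := min k h; rewrite ltnn.
have E k : (2 `^ `|e| * C * (2 * s * 2 ^+ k) `^ (a + e) =
    (2 `^ `|e| * C * 2 `^ (a + e) * s `^ (a + e)) * (2 `^ (a + e)) ^+ k)%R.
  rewrite powRM ?exprn_ge0 ?mulr_ge0//; last exact: ltW.
  rewrite powRM//; last exact: ltW.
  rewrite -powR_mulrn// powRAC powR_mulrn ?powR_ge0//; ring.
rewrite (eq_eseriesr (g := fun k => ((2 `^ `|e| * C * 2 `^ (a + e) *
  s `^ (a + e)) * (2 `^ (a + e)) ^+ k)%:E)); last by move=> k _; rewrite E.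
rewrite nneseries_geometric// ?mulr_ge0 ?powR_ge0//.
by rewrite lee_fin le_eqVlt; apply/orP; left; apply/eqP; ring.
Qed.

(** The denominator is at least s^2 where rho <= s and at least rho^2 where rho > s. The two bounds
    on a + e make rho^e integrable near 0 and rho^(e - 2) integrable at infinity, and both pieces
    scale like s^(a + e - 2). *)
Lemma integral_powR_kernel (e : R) : (0 < a + e < 2)%R ->
  exists2 C' : R, (0 <= C')%R & forall s : R, (0 < s)%R ->
  \int[nu]_(x in [set x | (0 < rho x)%R])
     (rho x `^ e / (rho x ^+ 2 + s ^+ 2))%:E <=
  (C' * s `^ (a + e - 2))%:E.
Proof.
move=> /andP[ae0 ae2].
have [C1 C10 h1] := integral_powR_small ae0.
have ae2' : (a + (e - 2) < 0)%R by lra.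
have [C2 C20 h2] := integral_powR_large ae2'.
exists (C1 + C2)%R; first exact: addr_ge0.
move=> s s0.
have mA : measurable [set x | (0 < rho x <= s)%R] by exact: measurable_between.
have mB : measurable [set x | (s < rho x)%R].
  rewrite (_ : [set _ | _] = rho @^-1` `]s, +oo[); last first.
    by apply/seteqP; split => t /=; rewrite in_itv/= andbT.
  by rewrite -[_ @^-1` _]setTI; exact: mrho.
have -> : [set x | (0 < rho x)%R] =
    [set x | (0 < rho x <= s)%R] `|` [set x | (s < rho x)%R].
  apply/seteqP; split => x /=; last by move=> [/andP[]//|]; exact: lt_trans.
  by move=> ->; case: (leP (rho x) s) => ?; [left|right].
have mpow e' : measurable_fun setT (fun x => rho x `^ e')%R.
  exact: measurable_fun_powR.
have mden : measurable_fun setT (fun x => (rho x ^+ 2 + s ^+ 2)^-1)%R.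
  by apply: measurable_funV; apply: measurable_funD => //; exact: measurable_funX.
rewrite ge0_integral_setU//; first last.
- by apply/disj_setPS => x [/= /andP[_ h]]; rewrite ltNge h.
- by move=> x _; rewrite lee_fin divr_ge0 ?powR_ge0 ?addr_ge0 ?sqr_ge0.
- apply/measurable_EFinP; apply: (@measurable_funS _ _ _ _ setT) => //.
  exact: measurable_funM.
have sX : (s `^ (- 2) = s ^- 2)%R by rewrite powR_invn// ltW.
rewrite mulrDl EFinD leeD//.
- rewrite (_ : _ * _ = s ^- 2 * (C1 * s `^ (a + e)))%R; last first.
    by rewrite powRD ?sX; [ring|rewrite (gt_eqF s0) implybT].
  rewrite [leRHS]EFinM.
  apply: le_trans (lee_wpmul2l _ (h1 s s0)); last first.
    by rewrite lee_fin invr_ge0 sqr_ge0.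
  rewrite -ge0_integralZl//; first last.
  + by rewrite lee_fin invr_ge0 sqr_ge0.
  + by move=> x _; rewrite lee_fin powR_ge0.
  + by apply/measurable_EFinP; exact: (@measurable_funS _ _ _ _ setT).
  apply: le_integral_nonneg => x _.
    by rewrite lee_fin divr_ge0 ?powR_ge0 ?addr_ge0 ?sqr_ge0.
  rewrite -EFinM lee_fin mulrC ler_wpM2r ?powR_ge0//.
  rewrite lef_pV2 ?posrE ?exprn_gt0// ?lerDr ?sqr_ge0//.
  by rewrite ltr_wpDl ?sqr_ge0 ?exprn_gt0.
- rewrite -addrA; apply: le_trans (h2 s s0).
  apply: le_integral_nonneg => x /= sx.
    by rewrite lee_fin divr_ge0 ?powR_ge0 ?addr_ge0 ?sqr_ge0.
  have x0 : (0 < rho x)%R by exact: lt_trans sx.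
  rewrite lee_fin powRD; last by rewrite (gt_eqF x0) implybT.
  rewrite powR_invn ?(ltW x0)// ler_wpM2l ?powR_ge0//.
  rewrite lef_pV2 ?posrE ?exprn_gt0// ?lerDl ?sqr_ge0//.
  by rewrite ltr_wpDl ?sqr_ge0 ?exprn_gt0.
Qed.

End dyadic.

(** * The Hardy-type operator *)

Lemma lee_poweR (R : realType) (r : R) (x y : \bar R) : 0 <= r ->
  (0 <= x -> x <= y -> x `^ r <= y `^ r)%E.
Proof.
move=> r0 x0 xy; apply: gt0_ler_poweR => //; rewrite in_itv/= leey andbT//.
exact: le_trans xy.
Qed.

Section hoelder_nonneg.
Local Open Scope ereal_scope.
Context d (T : measurableType d) (R : realType).
Variable mu : {measure set T -> \bar R}.

Lemma hoelder_ge0 (f g : T -> R) (p p' : R) :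
  measurable_fun setT f -> measurable_fun setT g ->
  (forall x, 0 <= f x)%R -> (forall x, 0 <= g x)%R ->
  (0 < p)%R -> (0 < p')%R -> (p^-1 + p'^-1 = 1)%R ->
  \int[mu]_x (f x * g x)%:E <=
  (\int[mu]_x (f x `^ p)%:E) `^ p^-1 * (\int[mu]_x (g x `^ p')%:E) `^ p'^-1.
Proof.
move=> mf mg f0 g0 p0 p'0 pp'.
have E (h : T -> R) r : (forall x, 0 <= h x)%R ->
    \int[mu]_x (`|(EFin \o h) x| `^ r) = \int[mu]_x (h x `^ r)%:E.
  by move=> h0; apply: eq_integral => x _ /=; rewrite ger0_norm.
have := hoelder mu mf mg p0 p'0 pp'.
rewrite Lnorm1 unlock (E f p f0) (E g p' g0); apply: le_trans.
apply: le_integral_nonneg => x _ /=; first by rewrite lee_fin mulr_ge0.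
by rewrite lee_fin ler_norm.
Qed.

Lemma integral_support_le (D : set T) (f : T -> \bar R) :
  (forall x, 0 <= f x) -> (forall x, ~ D x -> f x = 0) ->
  \int[mu]_x f x = \int[mu]_(x in D) f x.
Proof.
move=> f0 fD; rewrite [RHS]integral_mkcond; apply: eq_integral => x _.
by rewrite patchE; case: ifPn => // /negP; rewrite inE => /fD.
Qed.

End hoelder_nonneg.

Section hardy.
Context (R : realType).
Notation leb := (@lebesgue_measure R).

Lemma growth_lebesgue : growth leb (@normr R R) 2 1.
Proof.
split => // L L0; rewrite powRr1 ?(ltW L0)//.
apply: (@le_trans _ _ (leb `[- L, L]%classic)).
  apply: le_measure; rewrite ?inE//.
    exact: (@measurable_between _ _ _ (@normr R R)).
  by move=> x /= /andP[_]; rewrite in_itv/= ler_norml.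
rewrite lebesgue_measure_itv/= lte_fin gtrN// -EFinD opprK lee_fin; lra.
Qed.

(** This is pi times the Poisson kernel at height rho, so [hardy v rho] is pi times the Poisson
    extension of v at the point (0, rho). *)
Definition hkernel (rho y : R) : R := (rho / (y ^+ 2 + rho ^+ 2))%R.

Definition hardy (v : R -> R) (rho : R) : \bar R :=
  (\int[leb]_y (hkernel rho y * v y)%:E)%E.

(** What the Schur test leaves of the p-th power of [hardy]: an expression linear in v^p, to which
    Tonelli's theorem applies. *)
Definition hardy_weighted (p p' : R) (v : R -> R) (rho : R) : \bar R :=
  (\int[leb]_y (hkernel rho y * `|y| `^ p'^-1 * v y `^ p)%:E)%E.

Lemma hkernel_ge0 (rho y : R) : (0 <= rho -> 0 <= hkernel rho y)%R.
Proof. by move=> r0; rewrite divr_ge0// addr_ge0 ?sqr_ge0. Qed.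

Lemma measurable_hkernel d (T : measurableType d) (f g : T -> R) :
  measurable_fun setT f -> measurable_fun setT g ->
  measurable_fun setT (fun x => hkernel (f x) (g x)).
Proof.
move=> mf mg; apply: measurable_funM => //; apply: measurable_funV.
by apply: measurable_funD; exact: measurable_funX.
Qed.

Section exponents.
Variables p p' : R.
Hypotheses (p1 : (1 < p)%R) (pp' : (p^-1 + p'^-1 = 1)%R).

Lemma conj_exponent : [/\ (0 < p^-1)%R, (p^-1 < 1)%R, (0 < p'^-1)%R,
  (p'^-1 < 1)%R & (0 < p')%R].
Proof.
have := p1; have := pp' => e1 e2; have p0 : (0 < p)%R by lra.
have h : (0 < p^-1)%R by rewrite invr_gt0.
have h1 : (p^-1 < 1)%R by rewrite invf_lt1.
have h2 : (0 < p'^-1)%R by lra.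
have h3 : (p'^-1 < 1)%R by lra.
by split => //; rewrite -invr_gt0.
Qed.

(** With m the larger of rho and |y|, conjugacy gives |y|^(1/p') rho^(1/p) <= m, and rho m <= m^2 <=
    y^2 + rho^2. *)
Lemma hkernel_weight_le (rho y : R) : (0 < rho)%R ->
  (hkernel rho y * `|y| `^ p'^-1 <= rho `^ (- p^-1))%R.
Proof.
move=> r0; have [p0 _ p'0 _ _] := conj_exponent.
pose m := Num.max rho `|y|.
have m0 : (0 < m)%R by rewrite lt_max r0.
have -> : (rho `^ (- p^-1) = (rho `^ (p^-1))^-1)%R by rewrite powRN.
rewrite -[leRHS]mul1r ler_pdivlMr ?powR_gt0// /hkernel -!mulrA mulrCA mulrC.
have den : (0 < y ^+ 2 + rho ^+ 2)%R by rewrite ltr_wpDl ?sqr_ge0 ?exprn_gt0.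
rewrite ler_pdivrMr// mul1r.
have h : (`|y| `^ p'^-1 * rho `^ p^-1 <= m)%R.
  rewrite -[leRHS]powRr1 ?(ltW m0)// -pp' addrC powRD; last first.
    by rewrite (gt_eqF m0) implybT.
  rewrite ler_pM ?powR_ge0// ge0_ler_powR ?nnegrE ?(ltW m0) ?(ltW r0)//.
  - exact: ltW.
  - by rewrite le_max lexx orbT.
  - exact: ltW.
  - by rewrite le_max lexx.
apply: (@le_trans _ _ (rho * m)%R); first by rewrite ler_wpM2l ?(ltW r0).
apply: (@le_trans _ _ (m ^+ 2)%R).
  by rewrite expr2 ler_wpM2r ?(ltW m0)// le_max lexx.
rewrite -(real_normK (num_real y)) /m; case: (leP rho `|y|) => _.
  by rewrite lerDl sqr_ge0.
by rewrite lerDr sqr_ge0.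
Qed.

Lemma hardy_weighted_le (v : R -> R) (rho : R) : 0 < rho ->
  measurable_fun setT v ->
  (hardy_weighted p p' v rho <=
    (rho `^ (- p^-1))%:E * \int[leb]_y (v y `^ p)%:E)%E.
Proof.
move=> r0 mv; rewrite -ge0_integralZl//; first last.
- by rewrite lee_fin powR_ge0.
- by move=> x _; rewrite lee_fin powR_ge0.
- by apply/measurable_EFinP; exact: measurable_fun_powR.
apply: le_integral_nonneg => y _.
  rewrite lee_fin; apply: mulr_ge0 (powR_ge0 _ _).
  exact: mulr_ge0 (hkernel_ge0 y (ltW r0)) (powR_ge0 _ _).
by rewrite -EFinM lee_fin ler_wpM2r ?powR_ge0// hkernel_weight_le.
Qed.

(* The factors to which Hoelder's inequality is applied in the Schur test, with
   the power weight t^(1/(p p')). *)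
Lemma conj_factor (k t w : R) : 0 <= k -> 0 < t ->
  k * w = (k * t `^ (- p^-1)) `^ p'^-1 * ((k * t `^ p'^-1) `^ p^-1 * w).
Proof.
move=> k0 t0; have [p0 pl p'0 p'l p'g] := conj_exponent.
rewrite !powRM ?powR_ge0// -!powRrM mulrA; congr (_ * _).
rewrite mulrACA -powRD; last by rewrite addrC pp' oner_eq0.
rewrite -powRD; last by rewrite (gt_eqF t0) implybT.
rewrite [_ + p^-1]addrC pp' powRr1// (_ : _ + _ = 0) ?powRr0 ?mulr1//.
by rewrite mulNr mulrC addNr.
Qed.

(** Schur test. By [integral_powR_kernel] the factor free of v integrates to a multiple of
    rho^(-1/p), whose power p / p' is the prefactor. *)
Lemma hardy_le_weighted : exists2 c : R, 0 <= c &
  forall (v : R -> R) (rho : R), 0 < rho -> measurable_fun setT v ->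
  (forall y, 0 <= v y) ->
  (hardy v rho `^ p <=
    (c * rho `^ (- p'^-1))%:E * hardy_weighted p p' v rho)%E.
Proof.
have [p0 pl p'0 p'l p'g] := conj_exponent.
have ae : 0 < 1 + - p^-1 < 2 by apply/andP; split; lra.
have pg : 0 < p by rewrite -invr_gt0.
have [C C0 hC] := @integral_powR_kernel _ (measurableTypeR R) R leb (@normr R R)
  2 1 (@normr_measurable R setT) growth_lebesgue _ ae.
exists (C `^ (p / p')); first exact: powR_ge0.
move=> v rho r0 mv v0.
pose f y := (hkernel rho y * `|y| `^ (- p^-1)) `^ p'^-1.
pose g y := (hkernel rho y * `|y| `^ p'^-1) `^ p^-1 * v y.
have k0 y : 0 <= hkernel rho y by apply: hkernel_ge0; exact: ltW.
have mk : measurable_fun setT (hkernel rho).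
  by apply: measurable_hkernel; [exact: measurable_cst|exact: measurable_id].
have mpow e : measurable_fun setT (fun y : R => `|y| `^ e).
  by apply: measurable_fun_powR; exact: normr_measurable.
have mf : measurable_fun setT f.
  by apply: measurable_fun_powR; exact: measurable_funM.
have mg : measurable_fun setT g.
  apply: measurable_funM; last exact: mv.
  by apply: measurable_fun_powR; exact: measurable_funM.
have f0 y : 0 <= f y by exact: powR_ge0.
have g0 y : 0 <= g y by rewrite mulr_ge0 ?powR_ge0.
(* At y = 0 the weight |y|^(-1/p) takes the default value 0 and the factorisation of [conj_factor]
   fails; this null point is removed from both integrals. *)
have E : (hardy v rho <= \int[leb]_y (f y * g y)%:E)%E.
  have m0 : measurable ([set: R] `\ 0) by exact: measurableD.
  have mhv : measurable_fun [set: R] (fun y => (hkernel rho y * v y)%:E).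
    by apply/measurable_EFinP; exact: measurable_funM.
  have mfg : measurable_fun [set: R] (fun y => (f y * g y)%:E).
    by apply/measurable_EFinP; exact: measurable_funM.
  rewrite /hardy -[leLHS](@integral_setD1 _ _ 0)//; last first.
    exact: measurable_funS mhv.
  rewrite -[leRHS](@integral_setD1 _ _ 0)//; last exact: measurable_funS mfg.
  apply: le_integral_nonneg => y [_ /= /eqP y0].
    by rewrite lee_fin mulr_ge0.
  have y0' : 0 < `|y| by rewrite normr_gt0.
  by rewrite lee_fin /f /g -(conj_factor _ (k0 y) y0').
have A : (\int[leb]_y (f y `^ p')%:E <= (C * rho `^ (- p^-1))%:E)%E.
  rewrite (@integral_support_le _ (measurableTypeR R) R leb [set y : R | 0 < `|y|]).
  - have -> : (C * rho `^ (- p^-1)) = rho * (C * rho `^ (1 - p^-1 - 2)).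
      rewrite mulrCA; congr (_ * _); rewrite -{2}(powRr1 (ltW r0)) -powRD.
        by congr (_ `^ _); ring.
      by rewrite (gt_eqF r0) implybT.
    rewrite EFinM; apply: le_trans (lee_wpmul2l _ (hC rho r0)); last first.
      by rewrite lee_fin ltW.
    rewrite -ge0_integralZl//; first last.
    + by rewrite lee_fin ltW.
    + by move=> y _; rewrite lee_fin divr_ge0 ?powR_ge0 ?addr_ge0 ?sqr_ge0.
    + apply/measurable_EFinP; apply: (@measurable_funS _ _ _ _ setT) => //.
      apply: measurable_funM; first exact: mpow.
      apply: measurable_funV; apply: measurable_funD; last exact: measurable_cst.
      by apply: measurable_funX; exact: normr_measurable.
    + rewrite (_ : [set _ | _] = [set: R] `\ 0); first exact: measurableD.
      apply/seteqP; split => y /=; rewrite normr_gt0; first by move=> /eqP.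
      by move=> [_ /eqP].
    apply: le_integral_nonneg => y _; first by rewrite lee_fin powR_ge0.
    rewrite -EFinM lee_fin /f -powRrM mulVf ?gt_eqF// powRr1; last first.
      exact: mulr_ge0 (k0 y) (powR_ge0 _ _).
    by rewrite /hkernel (real_normK (num_real y)) mulrAC mulrA.
  - by move=> y; rewrite lee_fin powR_ge0.
  - move=> y /negP; rewrite normr_gt0 negbK => /eqP ->.
    rewrite /f normr0 (@powR0 _ (- p^-1)) ?oppr_eq0 ?gt_eqF// mulr0.
    by rewrite !powR0 ?gt_eqF.
have B : (\int[leb]_y (g y `^ p)%:E = hardy_weighted p p' v rho)%E.
  apply: eq_integral => y _; congr EFin.
  rewrite /g powRM ?powR_ge0// -powRrM mulVf ?gt_eqF// powRr1//.
  exact: mulr_ge0 (k0 y) (powR_ge0 _ _).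
have pp'C : p'^-1 + p^-1 = 1 by rewrite addrC.
have H := le_trans E (hoelder_ge0 leb mf mg f0 g0 p'g pg pp'C).
have {}H : (hardy v rho <= (C * rho `^ (- p^-1))%:E `^ p'^-1 *
    hardy_weighted p p' v rho `^ p^-1)%E.
  apply: (le_trans H); rewrite B lee_wpmul2r ?poweR_ge0//.
  apply: lee_poweR => //; first exact: ltW.
  by apply: integral_ge0 => y _; rewrite lee_fin powR_ge0.
have J0 : (0 <= hardy_weighted p p' v rho)%E.
  by rewrite -B; apply: integral_ge0 => y _; rewrite lee_fin powR_ge0.
have H0 : (0 <= hardy v rho)%E.
  by apply: integral_ge0 => y _; rewrite lee_fin; exact: mulr_ge0.
apply: (@le_trans _ _ (((C * rho `^ (- p^-1))%:E `^ p'^-1 *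
    hardy_weighted p p' v rho `^ p^-1) `^ p)%E).
  by apply: lee_poweR => //; exact: ltW.
rewrite poweRM ?poweR_ge0// -!poweRrM mulVf ?gt_eqF// poweRe1//.
rewrite poweR_EFin powRM ?powR_ge0// -powRrM [p'^-1 * p]mulrC.
rewrite (_ : - p^-1 * (p / p') = - p'^-1)//.
by rewrite mulNr mulrA mulVf ?mul1r// gt_eqF.
Qed.

End exponents.
End hardy.

(** * The Hardy-type operator against a measure of power growth *)

Section hardy_carleson.
Context d (T : measurableType d) (R : realType).
Notation leb := (@lebesgue_measure R).
Variables (nu : {sfinite_measure set T -> \bar R}) (rho : T -> R) (C a p p' : R).
Hypotheses (p1 : 1 < p) (pp' : p^-1 + p'^-1 = 1).
Hypotheses (mrho : measurable_fun setT rho) (gr : growth nu rho C a).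
Hypothesis a1 : 1 <= a.

Let D := [set x | 0 < rho x].

Let mD : measurable D.
Proof.
rewrite (_ : D = rho @^-1` `]0, +oo[); last first.
  by apply/seteqP; split => t /=; rewrite in_itv/= andbT.
by rewrite -[_ @^-1` _]setTI; exact: mrho.
Qed.

(** Raising the Schur bound to the power a gives J^a for the weighted integral J; all but one factor
    J is replaced by its pointwise bound, so that J still occurs linearly. The exponents of r add up
    to - a / p' - (a - 1) / p = 1 / p - a. *)
Lemma hardy_powR_le (c n : R) (v : R -> R) (r : R) : 0 <= c -> 0 <= n ->
  measurable_fun setT v -> (forall y, 0 <= v y) -> 0 < r ->
  (\int[leb]_y (v y `^ p)%:E = n%:E)%E ->
  (hardy v r `^ p <= (c * r `^ (- p'^-1))%:E * hardy_weighted p p' v r)%E ->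
  (hardy v r `^ (a * p) <= (c `^ a * n `^ (a - 1) * r `^ (p^-1 - a))%:E *
     hardy_weighted p p' v r)%E.
Proof.
move=> c0 n0 mv v0 r0 vn h.
have J0 : (0 <= hardy_weighted p p' v r)%E.
  apply: integral_ge0 => y _; rewrite lee_fin.
  exact: mulr_ge0 (mulr_ge0 (hkernel_ge0 y (ltW r0)) (powR_ge0 _ _)) (powR_ge0 _ _).
have Jn := hardy_weighted_le p1 pp' r0 mv.
rewrite vn in Jn; rewrite mulrC poweRrM.
have a0 : 0 <= a by exact: le_trans a1.
apply: (le_trans (lee_poweR a0 (poweR_ge0 _ _) h)).
case: (hardy_weighted p p' v r) J0 Jn => [j| |]//.
rewrite -!EFinM poweR_EFin !lee_fin => j0 jn.
rewrite powRM ?mulr_ge0 ?powR_ge0// powRM ?powR_ge0// -powRrM.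
have j1 : j `^ a <= j * (r `^ (- p^-1) * n) `^ (a - 1).
  rewrite -mulr_powRB1 ?(lt_le_trans ltr01 a1)// ler_wpM2l//.
  by rewrite ge0_ler_powR ?nnegrE ?subr_ge0 ?mulr_ge0 ?powR_ge0.
have k0 : 0 <= c `^ a * r `^ (- p'^-1 * a) by rewrite mulr_ge0 ?powR_ge0.
apply: (le_trans (ler_wpM2l k0 j1)).
rewrite powRM ?powR_ge0// -powRrM le_eqVlt; apply/orP; left; apply/eqP.
rewrite (_ : p^-1 - a = - p'^-1 * a + - p^-1 * (a - 1)).
  by rewrite (@powRD _ r) ?(gt_eqF r0) ?implybT//; ring.
have -> : p'^-1 = 1 - p^-1 by rewrite -pp'; ring.
ring.
Qed.

(** For Lebesgue measure and a = 1 this is Hardy's inequality on L^p; for the weights of mu and a =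
    q / p, where a p = q, it is (E). *)
Lemma hardy_carleson : exists2 c : R, 0 <= c &
  forall v : R -> R, measurable_fun setT v -> (forall y, 0 <= v y) ->
  (\int[leb]_y (v y `^ p)%:E < +oo)%E ->
  (\int[nu]_(x in D) (hardy v (rho x) `^ (a * p)) <=
     c%:E * (\int[leb]_y (v y `^ p)%:E) `^ a)%E.
Proof.
have [p0 pl p'0 p'l p'g] := conj_exponent p1 pp'.
have pg : 0 < p by rewrite -invr_gt0.
have [c1 c10 h1] := hardy_le_weighted p1 pp'.
(* The numerator of [hkernel] raises the exponent 1 / p - a of rho by 1; with the growth exponent a
   the total is 1 + 1 / p, strictly between 0 and 2. *)
have ae : 0 < a + (p^-1 - a + 1) < 2 by apply/andP; split; lra.
have [c2 c20 h2] := integral_powR_kernel mrho gr ae.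
exists (c1 `^ a * c2); first by rewrite mulr_ge0 ?powR_ge0.
move=> v mv v0 vfin.
have vp0 : (0 <= \int[leb]_y (v y `^ p)%:E)%E.
  by apply: integral_ge0 => y _; rewrite lee_fin powR_ge0.
have vpn : (\int[leb]_y (v y `^ p)%:E)%E \is a fin_num by rewrite ge0_fin_numE.
pose n := fine (\int[leb]_y (v y `^ p)%:E)%E.
have n0 : 0 <= n by exact: fine_ge0.
have vn : (\int[leb]_y (v y `^ p)%:E = n%:E)%E by rewrite fineK.
pose K := c1 `^ a * n `^ (a - 1).
have K0 : 0 <= K by rewrite mulr_ge0 ?powR_ge0.
(* The integrand is arranged as a function of x, times a function of y, times the inverse
   denominator; building in the indicator of D puts Tonelli's theorem on the whole product. *)
pose k x := \1_D x * (K * rho x `^ (p^-1 - a) * rho x).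
pose w y := `|y| `^ p'^-1 * v y `^ p.
pose F (z : T * measurableTypeR R) : \bar R :=
  (k z.1 * w z.2 * (z.2 ^+ 2 + rho z.1 ^+ 2)^-1)%:E.
have k0 x : 0 <= k x.
  rewrite /k indicE; case: (boolP (x \in D)) => [|_]; last by rewrite mul0r.
  by rewrite inE => xD; rewrite mul1r !mulr_ge0 ?powR_ge0// ltW.
have w0 y : 0 <= w y by rewrite mulr_ge0 ?powR_ge0.
have F0 z : (0 <= F z)%E.
  rewrite lee_fin; apply: mulr_ge0; first exact: mulr_ge0.
  by rewrite invr_ge0 addr_ge0 ?sqr_ge0.
have mw : measurable_fun setT w.
  apply: measurable_funM; last exact: measurable_fun_powR.
  by apply: measurable_fun_powR; exact: normr_measurable.
have mk : measurable_fun setT k.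
  apply: measurable_funM; first exact: measurable_indic.
  apply: measurable_funM => //; apply: measurable_funM => //.
  exact: measurable_fun_powR.
have mF : measurable_fun [set: T * measurableTypeR R] F.
  apply/measurable_EFinP; apply: measurable_funM.
    apply: measurable_funM.
      exact: (measurableT_comp mk measurable_fst).
    exact: (measurableT_comp mw measurable_snd).
  apply: measurable_funV; apply: measurable_funD; apply: measurable_funX.
    exact: measurable_snd.
  exact: (measurableT_comp mrho measurable_fst).
apply: (@le_trans _ _ (\int[nu]_x \int[leb]_y F (x, y))%E).
  rewrite integral_mkcond; apply: le_integral_nonneg => x _.
    by apply: erestrict_ge0 => t _; exact: poweR_ge0.
  rewrite patchE; case: ifPn => [|_]; last exact: integral_ge0.
  rewrite inE => xD.
  apply: (le_trans (hardy_powR_le c10 n0 mv v0 xD vn (h1 _ _ xD mv v0))).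
  rewrite -ge0_integralZl//; first last.
  - by rewrite lee_fin mulr_ge0 ?powR_ge0.
  - move=> y _; rewrite lee_fin.
    apply: mulr_ge0 (powR_ge0 _ _).
    exact: mulr_ge0 (hkernel_ge0 y (ltW xD)) (powR_ge0 _ _).
  - apply/measurable_EFinP; apply: measurable_funM.
      apply: measurable_funM.
        by apply: measurable_hkernel; [exact: measurable_cst|exact: measurable_id].
      by apply: measurable_fun_powR; exact: normr_measurable.
    exact: measurable_fun_powR.
  rewrite le_eqVlt; apply/orP; left; apply/eqP; apply: eq_integral => y _.
  rewrite /F /k /w /= indicE mem_set// mulr1n mul1r -EFinM /hkernel /K; congr EFin.
  ring.
rewrite sfinite_Fubini//.
apply: (@le_trans _ _ (\int[leb]_y ((K * c2)%:E * (v y `^ p)%:E))%E).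
  apply: le_integral_nonneg => y _; first exact: integral_ge0.
  have [->|y0] := eqVneq y 0.
    rewrite integral0_eq ?mule_ge0 ?lee_fin ?mulr_ge0 ?powR_ge0// => x _.
    by rewrite /F /w /= normr0 powR0 ?gt_eqF// mul0r mulr0 mul0r.
  rewrite (@integral_support_le _ _ _ nu D)//; last first.
    by move=> x xD; rewrite /F /k /= indicE memNset// !mul0r.
  have y0' : 0 < `|y| by rewrite normr_gt0.
  rewrite -EFinM (_ : K * c2 * _ =
    (w y * K) * (c2 * `|y| `^ (a + (p^-1 - a + 1) - 2))).
    rewrite EFinM; apply: le_trans (lee_wpmul2l _ (h2 _ y0')); last first.
      by rewrite lee_fin mulr_ge0.
    rewrite -ge0_integralZl//; first last.
    - by rewrite lee_fin mulr_ge0.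
    - by move=> x _; rewrite lee_fin divr_ge0 ?powR_ge0 ?addr_ge0 ?sqr_ge0.
    - apply/measurable_EFinP; apply: (@measurable_funS _ _ _ _ setT) => //.
      apply: measurable_funM; first exact: measurable_fun_powR.
      apply: measurable_funV; apply: measurable_funD; last exact: measurable_cst.
      exact: measurable_funX.
    apply: le_integral_nonneg => x xD; first exact: F0.
    rewrite /F /k/= indicE mem_set// mulr1n mul1r -EFinM lee_fin.
    rewrite (real_normK (num_real y)).
    rewrite (@powRD _ (rho x) (p^-1 - a) 1) ?(gt_eqF xD) ?implybT// powRr1 ?(ltW xD)//.
    rewrite [rho x ^+ 2 + _]addrC.
    by rewrite le_eqVlt; apply/orP; left; apply/eqP; ring.
  (* The inner integral leaves the power -1 / p' of |y|, which cancels the Schur weight exactly and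
     leaves v^p alone. *)
  rewrite /w (_ : a + (p^-1 - a + 1) - 2 = - p'^-1); last first.
    have -> : p'^-1 = 1 - p^-1 by rewrite -pp'; ring.
    ring.
  by rewrite powRN; field; rewrite gt_eqF// powR_gt0.
rewrite ge0_integralZl//; first last.
- by rewrite lee_fin mulr_ge0.
- by move=> x _; rewrite lee_fin powR_ge0.
- by apply/measurable_EFinP; exact: measurable_fun_powR.
rewrite vn -EFinM lee_fin /K -(@mulr_powRB1 _ n a) ?(lt_le_trans ltr01 a1)//.
by rewrite le_eqVlt; apply/orP; left; apply/eqP; ring.
Qed.

End hardy_carleson.

(** * Discrete measures *)

Section discrete_measure.
Local Open Scope ereal_scope.
Context d (T : measurableType d) (R : realType).
Variables (w : nat -> {nonneg R}) (z : nat -> T).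

(** The series of [carleson_measure] on a general type, to which the s-finite structure required by
    Tonelli's theorem can be attached. *)
Definition discrete_measure : set T -> \bar R :=
  mseries (fun n => mscale (w n) \d_(z n)) 0.

HB.instance Definition _ := Measure.on discrete_measure.

Let discrete_measure_sfinite : sfinite_measure discrete_measure.
Proof.
by exists (fun n => mscale (w n) \d_(z n)) => // n; exact: fin_num_measure.
Qed.

HB.instance Definition _ :=
  isSFinite.Build _ _ _ discrete_measure discrete_measure_sfinite.

Lemma discrete_measureE (A : set T) :
  discrete_measure A = \sum_(0 <= n <oo) ((w n)%:num * \1_A (z n))%:E.
Proof. by apply: eq_eseriesr => n _; rewrite EFinM. Qed.

Lemma discrete_measure_integral_measurable (f : T -> \bar R) :
  measurable_fun setT f -> (forall x, 0 <= f x) ->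
  \int[discrete_measure]_x f x = \sum_(0 <= n <oo) (w n)%:num%:E * f (z n).
Proof.
move=> mf f0; rewrite ge0_integral_measure_series//.
apply: eq_eseriesr => n _; rewrite ge0_integral_mscale// integral_dirac//.
by rewrite diracT mul1e.
Qed.

Import HBNNSimple.

Hypothesis measurable_singleton : forall x : T, measurable [set x].

(* The measure is carried by a countable set, outside which the integrand can be
   replaced by 0, and this makes it measurable. *)
Lemma discrete_measure_integral (D : set T) (f : T -> \bar R) :
  (forall x, D x -> 0 <= f x) ->
  \int[discrete_measure]_(x in D) f x =
  \sum_(0 <= n <oo) (w n)%:num%:E * (f \_ D) (z n).
Proof.
move=> f0; have g0 x : 0 <= (f \_ D) x by exact: erestrict_ge0.
rewrite integral_mkcond; set g := f \_ D in g0 *.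
apply/eqP; rewrite eq_le; apply/andP; split.
  rewrite ge0_integralTE//; apply: ge_ereal_sup => /= _ [h hg <-].
  rewrite -integralT_nnsfun discrete_measure_integral_measurable//; last 2 first.
  - by apply/measurable_EFinP; exact: measurable_funP.
  - by move=> x; rewrite lee_fin.
  by apply: lee_nneseries => [n _ _|n _]; rewrite ?lee_wpmul2l ?mule_ge0 ?lee_fin.
have cz : countable (range z).
  by apply: (sub_countable (card_image_le z setT)); exact: countableP.
have mg : measurable_fun setT (g \_ (range z)).
  move=> _ B mB; rewrite setTI.
  have [B0|B0] := pselect (B 0).
    rewrite -[X in measurable X]setCK; apply: measurableC.
    apply: countable_measurable => //; apply: sub_countable cz.
    apply: subset_card_le => x /=; rewrite patchE.
    by case: ifPn => [|_ /(_ B0)//]; rewrite inE.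
  apply: countable_measurable => //; apply: sub_countable cz.
  apply: subset_card_le => x /=; rewrite patchE.
  by case: ifPn => // ; rewrite inE.
have -> : \sum_(0 <= n <oo) (w n)%:num%:E * g (z n) =
    \int[discrete_measure]_x (g \_ (range z)) x.
  rewrite discrete_measure_integral_measurable//; last first.
    by move=> x; apply: erestrict_ge0.
  by apply: eq_eseriesr => n _; rewrite patchE mem_set//; exists n.
apply: le_integral_nonneg => x _; first exact: erestrict_ge0.
by rewrite patchE; case: ifPn.
Qed.

End discrete_measure.

(** * Sectors and kernels *)

Section complex_facts.
Context (R : realType).
Implicit Types z w : R[i].

Lemma sqr_normcE z : normc z ^+ 2 = complex.Re z ^+ 2 + complex.Im z ^+ 2.
Proof. by case: z => x y /=; rewrite sqr_sqrtr// addr_ge0 ?sqr_ge0. Qed.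

Lemma normc_ge0 z : 0 <= normc z.
Proof. by case: z => x y; exact: sqrtr_ge0. Qed.

Lemma normc_gt0 z : z != 0 -> 0 < normc z.
Proof.
move=> z0; rewrite lt_neqAle normc_ge0 andbT eq_sym.
by apply: contra z0 => /eqP/eq0_normc ->.
Qed.

Lemma Re_le_normc z : `|complex.Re z| <= normc z.
Proof.
rewrite -(@ler_pXn2r _ 2)// ?nnegrE ?normc_ge0//.
by rewrite sqr_normcE (real_normK (num_real _)) lerDl sqr_ge0.
Qed.

Lemma Im_le_normc z : `|complex.Im z| <= normc z.
Proof.
rewrite -(@ler_pXn2r _ 2)// ?nnegrE ?normc_ge0//.
by rewrite sqr_normcE (real_normK (num_real _)) lerDr sqr_ge0.
Qed.

Lemma normc_le_ReIm z : normc z <= `|complex.Re z| + `|complex.Im z|.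
Proof.
rewrite -(@ler_pXn2r _ 2)// ?nnegrE ?normc_ge0 ?addr_ge0//.
rewrite sqr_normcE sqrrD !(real_normK (num_real _)).
by rewrite addrAC lerDl mulrn_wge0// mulr_ge0.
Qed.

Lemma normc_real (x : R) : normc x%:C = `|x|.
Proof. by rewrite /= expr0n/= addr0 sqrtr_sqr. Qed.

Lemma normc_cexp z : normc (cexp z) = expR (complex.Re z).
Proof.
by rewrite /= !exprMn -mulrDr cos2Dsin2 mulr1 sqrtr_sqr ger0_norm.
Qed.

Lemma Re_invc z : complex.Re z^-1 = complex.Re z / normc z ^+ 2.
Proof. by case: z => x y; rewrite /= sqr_sqrtr// addr_ge0 ?sqr_ge0. Qed.

(** Cosine decreases on [0, pi] and |arg z| is the arc cosine of Re z / |z|. The angle enters the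
    estimates only through this inequality, with c = cos vtheta. *)
Lemma sector_Re (vtheta : R) z : 0 < vtheta < pi / 2 -> sector vtheta z ->
  cos vtheta * normc z <= complex.Re z.
Proof.
move=> /andP[v0 vpi] [z0 zv].
have n0 := normc_gt0 z0; have pi0 := pi_gt0 R.
pose x := complex.Re z / normc z.
have /andP[x1 x2] : -1 <= x <= 1.
  rewrite -ler_norml normrM normfV (ger0_norm (ltW n0)) ler_pdivrMr// mul1r.
  exact: Re_le_normc.
have a0 : 0 <= acos x by rewrite acos_ge0// x1.
have av : acos x < vtheta.
  by move: zv; rewrite /carg -/x; case: ifP => _; rewrite ?normrN ger0_norm.
rewrite -ler_pdivlMr// -/x -[leRHS]acosK; last by rewrite in_itv/= x1.
have ai : acos x \in `[0, pi] by rewrite in_itv/= a0 acos_lepi// x1.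
have vi : vtheta \in `[0, pi] by rewrite in_itv/= (ltW v0)/=; lra.
by rewrite ltW// ltr_cos.
Qed.

Lemma cos_sector (vtheta : R) : 0 < vtheta < pi / 2 -> 0 < cos vtheta.
Proof. by move=> /andP[v0 vpi]; rewrite cos_gt0_pihalf// vpi andbT; lra. Qed.

Lemma of_complex_inv (c : R) z : z != 0 -> 0 < c ->
  c * normc z <= complex.Re z ->
  (of_complex z^-1).1 ^+ 2 + (of_complex z^-1).2 ^+ 2 = (normc z)^-1 ^+ 2 /\
  c * (normc z)^-1 <= (of_complex z^-1).2.
Proof.
move=> z0 c0 cz; have n0 := normc_gt0 z0; split.
  by rewrite -normcV sqr_normcE addrC.
rewrite [leRHS]Re_invc ler_pdivlMr ?exprn_gt0// expr2 mulrA.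
by rewrite mulfVK// gt_eqF.
Qed.

Lemma normc1D_ge (z : R[i]) : 0 <= complex.Re z ->
  1 <= normc (1 + z) /\ normc z <= normc (1 + z).
Proof.
case: z => x y /= x0; split.
- rewrite -[leLHS]sqrtr1 ler_sqrt.
    by rewrite add0r; have := sqr_ge0 y; nra.
  by rewrite addr_ge0 ?sqr_ge0.
- rewrite ler_sqrt; last by rewrite addr_ge0 ?sqr_ge0.
  by rewrite add0r lerD2r ler_sqr ?nnegrE ?addr_ge0// lerDr.
Qed.

End complex_facts.

(** * Comparison of the Poisson, exponential and Hardy kernels *)

Section poisson_bounds.
Context (R : realType).
Variables (c rho x t : R).
Hypotheses (c0 : 0 < c) (rho0 : 0 < rho) (xt : x ^+ 2 + t ^+ 2 = rho ^+ 2)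
  (ct : c * rho <= t).

Lemma poisson_t_gt0 : 0 < t.
Proof. by apply: lt_le_trans ct; rewrite mulr_gt0. Qed.

Lemma poisson_t_le : t <= rho.
Proof.
rewrite -(@ler_pXn2r _ 2)// ?nnegrE ?(ltW poisson_t_gt0) ?(ltW rho0)//.
by rewrite -xt lerDr sqr_ge0.
Qed.

(** The numerator costs the factor c and the denominator the factor 2, since (x - y)^2 <= 2 x^2 + 2
    y^2 and x^2 + t^2 = rho^2. *)
Lemma hkernel_le_poisson (y : R) :
  c / (2 * pi) * hkernel rho y <= poisson_kernel t (x - y).
Proof.
have t0 := poisson_t_gt0; have pi0 := pi_gt0 R.
have d1 : 0 < t ^+ 2 + (x - y) ^+ 2 by rewrite ltr_pwDl ?sqr_ge0 ?exprn_gt0.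
have d2 : 0 < y ^+ 2 + rho ^+ 2 by rewrite ltr_wpDl ?sqr_ge0 ?exprn_gt0.
rewrite /hkernel /poisson_kernel.
move: pi0; move: (pi : R) => P P0.
have -> : c / (2 * P) * (rho / (y ^+ 2 + rho ^+ 2)) =
  P^-1 * ((c * rho) / (2 * (y ^+ 2 + rho ^+ 2))).
  by field; rewrite (gt_eqF P0) (gt_eqF d2).
rewrite ler_wpM2l ?invr_ge0 ?(ltW P0)//.
apply: ler_pM => //; first by rewrite mulr_ge0 // ltW.
  by rewrite invr_ge0 mulr_ge0 // ltW.
rewrite lef_pV2 ?posrE ?mulr_gt0// -xt.
have := sqr_ge0 (x + y); nra.
Qed.

(** The constant comes from y^2 <= 2 x^2 + 2 (x - y)^2 and x^2 <= rho^2, which give y^2 + rho^2 <= 3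
    rho^2 + 2 (x - y)^2, and from rho^2 <= t^2 / c^2. *)
Lemma poisson_le_hkernel (y : R) :
  poisson_kernel t (x - y) <= (pi^-1 * (2 + 3 / c ^+ 2)) * hkernel rho y.
Proof.
have t0 := poisson_t_gt0; have pi0 := pi_gt0 R; have tr := poisson_t_le.
have d1 : 0 < t ^+ 2 + (x - y) ^+ 2 by rewrite ltr_pwDl ?sqr_ge0 ?exprn_gt0.
have d2 : 0 < y ^+ 2 + rho ^+ 2 by rewrite ltr_wpDl ?sqr_ge0 ?exprn_gt0.
rewrite /hkernel /poisson_kernel -mulrA ler_wpM2l ?invr_ge0 ?(ltW pi0)//.
have K0 : 0 < 2 + 3 / c ^+ 2 by rewrite ltr_wpDr ?divr_ge0 ?sqr_ge0.
have -> : (2 + 3 / c ^+ 2) * (rho / (y ^+ 2 + rho ^+ 2)) =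
  rho * ((2 + 3 / c ^+ 2) / (y ^+ 2 + rho ^+ 2)) by ring.
apply: ler_pM => //; first exact: ltW.
  by rewrite invr_ge0 ltW.
rewrite -[leLHS]mul1r ler_pdivrMr// mulrAC ler_pdivlMr// mul1r mulrDl.
have ct2 : rho ^+ 2 <= t ^+ 2 / c ^+ 2.
  rewrite ler_pdivlMr ?exprn_gt0// -exprMn mulrC.
  by rewrite ler_sqr ?nnegrE ?(mulr_ge0 (ltW c0) (ltW rho0)) ?(ltW t0).
have h : y ^+ 2 <= 2 * x ^+ 2 + 2 * (x - y) ^+ 2.
  by have := sqr_ge0 (2 * x - y); nra.
have x2 : x ^+ 2 <= rho ^+ 2 by rewrite -xt lerDl sqr_ge0.
have u : 0 <= (x - y) ^+ 2 / c ^+ 2 by rewrite divr_ge0 ?sqr_ge0.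
have -> : 3 / c ^+ 2 * (t ^+ 2 + (x - y) ^+ 2) =
  3 * (t ^+ 2 / c ^+ 2) + 3 * ((x - y) ^+ 2 / c ^+ 2) by ring.
have := sqr_ge0 t; lra.
Qed.

End poisson_bounds.

(** Quadratic decay is enough: at y = c s / rho one has e^y = (e^(y/2))^2 >= (1 + y/2)^2 >= (1 +
    y^2) / 4. As c <= 1, the factor c^2 can then be taken out of rho^2 + (c s)^2. *)
Lemma expR_le_hkernel (R : realType) (c rho u s : R) : 0 < c <= 1 -> 0 < rho ->
  0 <= s -> c / rho <= u ->
  rho^-1 * expR (- (u * s)) <= (4 / c ^+ 2) * hkernel rho s.
Proof.
move=> /andP[c0 c1] r0 s0 cu.
have u0 : 0 <= u by apply: le_trans cu; rewrite divr_ge0 ?ltW.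
have e1 : c * s / rho <= u * s by rewrite mulrAC ler_wpM2r.
have d2 : 0 < s ^+ 2 + rho ^+ 2 by rewrite ltr_wpDl ?sqr_ge0 ?exprn_gt0.
have e0 : 0 <= c * s / rho by rewrite divr_ge0 ?mulr_ge0// ltW.
set y := c * s / rho in e1 e0.
have e2 : (1 + y ^+ 2) / 4 <= expR (u * s).
  apply: (@le_trans _ _ (expR y)); last by rewrite ler_expR.
  have -> : expR y = expR (y / 2) ^+ 2.
    by rewrite -expRM_natl; congr expR; field.
  apply: (@le_trans _ _ ((1 + y / 2) ^+ 2)).
    by rewrite (_ : (1 + y / 2) ^+ 2 = 1 + y + y ^+ 2 / 4); [lra|field].
  by rewrite ler_sqr ?nnegrE ?expR_ge0 ?expR_ge1Dx// addr_ge0// divr_ge0.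
rewrite expRN -invfM.
have y1 : 0 < 1 + y ^+ 2 by rewrite ltr_pwDl ?sqr_ge0.
have b1 : 0 < rho * ((1 + y ^+ 2) / 4) by rewrite mulr_gt0 ?divr_gt0.
apply: (@le_trans _ _ (rho * ((1 + y ^+ 2) / 4))^-1).
  by rewrite lef_pV2 ?posrE ?mulr_gt0 ?expR_gt0// ler_wpM2l ?(ltW r0).
have E : (rho * ((1 + y ^+ 2) / 4)) = (rho ^+ 2 + (c * s) ^+ 2) / (4 * rho).
  by rewrite /y; field; rewrite gt_eqF.
rewrite E invf_div /hkernel.
have -> : 4 / c ^+ 2 * (rho / (s ^+ 2 + rho ^+ 2)) =
  (4 * rho) / (c ^+ 2 * (s ^+ 2 + rho ^+ 2)).
  by field; rewrite (gt_eqF c0) (gt_eqF d2).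
rewrite ler_wpM2l ?mulr_ge0 ?(ltW r0)//.
have c2 : c ^+ 2 <= 1 by rewrite expr_le1 ?(ltW c0).
rewrite lef_pV2 ?posrE ?mulr_gt0 ?exprn_gt0//.
  by rewrite mulrDr exprMn addrC lerD2r ler_piMl ?sqr_ge0.
by rewrite ltr_pwDl ?sqr_ge0 ?exprn_gt0.
Qed.

(** * Growth, tents and the spaces X_(-theta) *)

Lemma measurable_set1_pair (R : realType) (x : R * R) : measurable [set x].
Proof.
rewrite (_ : [set x] = [set x.1] `*` [set x.2]); first exact: measurableX.
by apply/seteqP; split => [_ -> //|[u v] [/= -> ->]]; rewrite -surjective_pairing.
Qed.

Lemma powRVl (R : realType) (x e : R) : 0 <= x -> x^-1 `^ e = (x `^ e)^-1.
Proof. by move=> x0; rewrite -powR_inv1// powRAC powR_inv1// powR_ge0. Qed.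

Lemma lebesgue_measure_ball_itv (R : realType) (x t : R) : 0 < t ->
  lebesgue_measure `]x - t, x + t[%classic = (2 * t)%:E.
Proof.
move=> t0; rewrite lebesgue_measure_itv/= lte_fin ifT; last by lra.
by rewrite -EFinD; congr EFin; ring.
Qed.

Section sector_points.
Context (R : realType).
Variables (c : R) (lambda : nat -> R[i]).

Definition inv_point n := of_complex (lambda n)^-1.
Definition inv_radius n := (normc (lambda n))^-1.

Hypotheses (c0 : 0 < c) (lambda0 : forall n, lambda n != 0)
  (Re_lambda : forall n, c * normc (lambda n) <= complex.Re (lambda n)).

Lemma radius_gt0 n : 0 < inv_radius n.
Proof. by rewrite invr_gt0 normc_gt0. Qed.

Lemma point_radius n :
  (inv_point n).1 ^+ 2 + (inv_point n).2 ^+ 2 = inv_radius n ^+ 2.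
Proof. by have [] := of_complex_inv (lambda0 n) c0 (Re_lambda n). Qed.

Lemma radius_le_point2 n : c * inv_radius n <= (inv_point n).2.
Proof. by have [] := of_complex_inv (lambda0 n) c0 (Re_lambda n). Qed.

Lemma point2_gt0 n : 0 < (inv_point n).2.
Proof. exact: poisson_t_gt0 c0 (radius_gt0 n) (radius_le_point2 n). Qed.

Lemma point2_le n : (inv_point n).2 <= inv_radius n.
Proof.
exact: poisson_t_le c0 (radius_gt0 n) (point_radius n) (radius_le_point2 n).
Qed.

Lemma point1_le n : `|(inv_point n).1| <= inv_radius n.
Proof.
rewrite -(@ler_pXn2r _ 2)// ?nnegrE ?(ltW (radius_gt0 n))//.
by rewrite (real_normK (num_real _)) -point_radius lerDl sqr_ge0.
Qed.

End sector_points.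

(** The weights of mu are moved from the half plane to the indices, where every function, in
    particular n |-> rho_n, is measurable. *)
Definition carleson_nat_measure (R : realType) (q : R) (lambda b : nat -> R[i]) :
    {sfinite_measure set nat -> \bar R} :=
  discrete_measure (carleson_weight q lambda b) (@id nat).

Definition carleson_growth (R : realType) (p q : R) (lambda b : nat -> R[i]) :=
  exists C, growth (carleson_nat_measure q lambda b) (inv_radius lambda) C (q / p).

Section carleson_growth.
Context (R : realType).
Variables (p q p' alpha c : R) (lambda b : nat -> R[i]).
Hypotheses (p1 : 1 < p) (q1 : 1 < q) (pp' : p^-1 + p'^-1 = 1).
Hypotheses (alpha0 : 0 < alpha) (alphaq : alpha * q = p).
Hypotheses (c0 : 0 < c).
Hypotheses (lambda0 : forall n, lambda n != 0)
  (Re_lambda : forall n, c * normc (lambda n) <= complex.Re (lambda n)).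

Notation leb := (@lebesgue_measure R).
Notation w := (carleson_weight q lambda b).
Notation mu := (carleson_measure q lambda b).
Notation z := (inv_point lambda).
Notation rho := (inv_radius lambda).
Notation nu := (carleson_nat_measure q lambda b).
Let rho_gt0 := radius_gt0 lambda0.
Let z_rho := point_radius c0 lambda0 Re_lambda.
Let c_rho := radius_le_point2 c0 lambda0 Re_lambda.
Let z2_gt0 := point2_gt0 c0 lambda0 Re_lambda.
Let z2_le := point2_le c0 lambda0 Re_lambda.
Let z1_le := point1_le c0 lambda0 Re_lambda.

Let qp : q / p = alpha^-1.
Proof.
have p0 : 0 < p by exact: lt_trans p1.
have q0 : 0 < q by exact: lt_trans q1.
by rewrite -alphaq; field; rewrite !gt_eqF.
Qed.

Lemma carleson_measureE (A : set (R * R)) :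
  (mu A = \sum_(0 <= n <oo) ((w n)%:num * \1_A (z n))%:E)%E.
Proof. exact: (discrete_measureE w z A). Qed.

Lemma carleson_nat_measureE (A : set nat) :
  (nu A = \sum_(0 <= n <oo) ((w n)%:num * \1_A n)%:E)%E.
Proof. exact: (discrete_measureE w id A). Qed.

Lemma le_weighted_indic (A : set nat) (B : set (R * R)) :
  (forall n, A n -> B (z n)) -> (nu A <= mu B)%E.
Proof.
move=> AB; rewrite carleson_nat_measureE carleson_measureE.
apply: lee_nneseries => n _.
  by rewrite lee_fin mulr_ge0.
rewrite lee_fin ler_wpM2l// !indicE.
case: (boolP (n \in A)) => [|_]; last by [].
by rewrite inE => /AB Bn; rewrite mem_set.
Qed.

Lemma ge_weighted_indic (A : set nat) (B : set (R * R)) :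
  (forall n, B (z n) -> A n) -> (mu B <= nu A)%E.
Proof.
move=> AB; rewrite carleson_nat_measureE carleson_measureE.
apply: lee_nneseries => n _.
  by rewrite lee_fin mulr_ge0.
rewrite lee_fin ler_wpM2l// !indicE.
case: (boolP (z n \in B)) => [|_]; last by [].
by rewrite inE => /AB Bn; rewrite mem_set.
Qed.

Lemma geometric_carleson_growth : geometric_carleson alpha mu ->
  carleson_growth p q lambda b.
Proof.
move=> [k hk]; exists ((4 * `|k|) `^ alpha^-1); split; first exact: powR_ge0.
(* A point with rho <= L satisfies |z.1| + z.2 <= 2 L, so the cones with vertex outside ]-2 L, 2 L[
   miss it and it lies in the tent. *)
move=> L L0; pose Q := `](- (2 * L)), (2 * L)[%classic : set R.
have iQ : is_interval Q by exact: interval_is_interval.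
have bQ : bounded_set Q.
  exists (2 * L); split; first exact: num_real.
  move=> y hy x; rewrite /Q/= ?in_itv/= => /andP[h1 h2].
  by rewrite ler_norml; lra.
have h := hk Q iQ bQ.
have lQ : leb Q = (4 * L)%:E.
  rewrite lebesgue_measure_itv/= lte_fin ifT; last by lra.
  by rewrite -EFinD; congr EFin; ring.
apply: (@le_trans _ _ (mu (tent Q))).
  apply: le_weighted_indic => n /= /andP[_ nL]; split; first exact: z2_gt0.
  move=> [x /= Qx [_ hx]]; apply: Qx; rewrite /Q/= ?in_itv/=.
  have := z2_le n; have := z1_le n.
  rewrite ler_norml => /andP[? ?] ?; move: hx; rewrite ltr_norml => /andP[? ?].
  by apply/andP; split; lra.
have a0 : 0 <= alpha^-1 by rewrite invr_ge0 ltW.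
have mu0 : (0 <= mu (tent Q))%E.
  rewrite carleson_measureE; apply: nneseries_ge0 => n _ _.
  by rewrite lee_fin mulr_ge0.
have := lee_poweR a0 (poweR_ge0 _ _) (le_trans h _).
rewrite -poweRrM mulfV ?gt_eqF// poweRe1// qp -powRM ?mulr_ge0 ?(ltW L0)//.
rewrite -poweR_EFin; apply.
rewrite lQ -EFinM lee_fin mulrA [4 * _]mulrC ler_wpM2r ?(ltW L0)//.
by rewrite ler_wpM2r// ler_norm.
Qed.

(** A point z of the tent over Q has the interval ]z.1 - z.2, z.1 + z.2[ inside Q, so 2 c rho <= 2
    z.2 <= |Q|: the tent only holds atoms with rho <= |Q| / (2 c). *)
Lemma growth_geometric_carleson : carleson_growth p q lambda b ->
  geometric_carleson alpha mu.
Proof.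
move=> [C [C0 hC]]; exists (C `^ alpha * (2 * c)^-1) => Q iQ bQ.
have mQ : measurable Q by exact: is_interval_measurable.
have [M [_ /(_ (M + 1))]] := bQ; rewrite ltrDl => /(_ ltr01) hM.
have Qfin : (leb Q < +oo)%E.
  apply: (@le_lt_trans _ _ (leb `[- (M + 1), M + 1]%classic)).
    apply: le_measure; rewrite ?inE// => x /hM /=.
    by rewrite in_itv/= ler_norml.
  by rewrite lebesgue_measure_itv/=; case: ifPn => // _; rewrite -EFinD ltry.
pose l := fine (leb Q).
have lE : leb Q = l%:E by rewrite fineK// ge0_fin_numE.
have l0 : 0 <= l by exact: fine_ge0.
have key n : tent Q (z n) -> 2 * c * rho n <= l.
  move=> [_ hn]; have zn := z2_gt0 n.
  have sub : `](z n).1 - (z n).2, (z n).1 + (z n).2[%classic `<=` Q.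
    move=> x /=; rewrite in_itv/= => /andP[h1 h2].
    apply: contrapT => Qx; apply: hn; exists x => //; split => //=.
    by rewrite ltr_norml; apply/andP; split; lra.
  have : (leb [set` Interval (BRight ((z n).1 - (z n).2)%R)
      (BLeft ((z n).1 + (z n).2)%R)] <= l%:E)%E.
    by rewrite -lE; apply: le_measure; rewrite ?inE.
  rewrite lebesgue_measure_ball_itv// lee_fin => h; have := c_rho n; lra.
(* Growth speaks of L > 0 only; over an interval of length 0 the tent contains no atom. *)
have [l00|lp] := eqVneq l 0.
  suff -> : mu (tent Q) = 0%E by rewrite poweR0r ?gt_eqF// lE l00 mule0.
  rewrite carleson_measureE eseries0// => n _ _.
  rewrite indicE memNset ?mulr0// => /key; rewrite l00 leNgt.
  by rewrite !mulr_gt0.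
have lgt : 0 < l by rewrite lt_neqAle eq_sym lp.
have L0 : 0 < l / (2 * c) by rewrite divr_gt0// mulr_gt0.
have mu1 : (mu (tent Q) <= (C * (l / (2 * c)) `^ (q / p))%:E)%E.
  apply: le_trans (hC _ L0); apply: ge_weighted_indic => n /key h /=.
  by rewrite rho_gt0/= ler_pdivlMr ?mulr_gt0// mulrC.
have mu0 : (0 <= mu (tent Q))%E.
  rewrite carleson_measureE; apply: nneseries_ge0 => n _ _.
  by rewrite lee_fin mulr_ge0.
apply: (le_trans (lee_poweR (ltW alpha0) mu0 mu1)).
rewrite poweR_EFin powRM ?powR_ge0// -powRrM qp mulVf ?gt_eqF// powRr1 ?(ltW L0)//.
rewrite lE -EFinM lee_fin le_eqVlt; apply/orP; left; apply/eqP.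
by ring.
Qed.

(** Here |b|^q = w rho^(-q) and 1 / |1 + lambda| is at most 1 and at most rho. The terms with rho <=
    1 are summable because q/p + theta q - q = q (theta - 1/p') > 0, those with rho > 1 because q/p
    - q = - q/p' < 0. *)
Lemma growth_Xneg : carleson_growth p q lambda b ->
  forall theta, p'^-1 < theta -> Xneg q lambda theta b.
Proof.
move=> [C gr] theta th.
have p0 : 0 < p by exact: lt_trans p1.
have q0 : 0 < q by exact: lt_trans q1.
have [pi0 pi1 p'i0 _ _] := conj_exponent p1 pp'.
have th0 : 0 < theta by exact: lt_trans th.
have mrho : measurable_fun [set: nat] rho by [].
have e1 : 0 < q / p + (theta * q - q).
  have -> : q / p + (theta * q - q) = q * (theta - p'^-1).
    have -> : p'^-1 = 1 - p^-1 by rewrite -pp'; ring.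
    by ring.
  by rewrite mulr_gt0// subr_gt0.
have e2 : q / p + - q < 0.
  have -> : q / p + - q = - (q * p'^-1).
    have -> : p'^-1 = 1 - p^-1 by rewrite -pp'; ring.
    by ring.
  by rewrite oppr_lt0 mulr_gt0.
have [C1 C10 h1] := integral_powR_small mrho gr e1.
have [C2 C20 h2] := integral_powR_large mrho gr e2.
have {}h1 := h1 1 ltr01; have {}h2 := h2 1 ltr01.
have ms (x : nat) : measurable [set x] by [].
rewrite (discrete_measure_integral w id ms) in h1; last first.
  by move=> n _; rewrite lee_fin powR_ge0.
rewrite (discrete_measure_integral w id ms) in h2; last first.
  by move=> n _; rewrite lee_fin powR_ge0.
rewrite /Xneg /=; apply: (@le_lt_trans _ _
  ((C1 * 1 `^ (q / p + (theta * q - q)))%:E + (C2 * 1 `^ (q / p + - q))%:E)%E);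
  last by rewrite -EFinD ltry.
apply: le_trans (leeD h1 h2); rewrite -nneseriesD; last 2 first.
- move=> n _ _; rewrite mule_ge0 ?lee_fin//; apply: erestrict_ge0 => m _.
  by rewrite lee_fin powR_ge0.
- move=> n _ _; rewrite mule_ge0 ?lee_fin//; apply: erestrict_ge0 => m _.
  by rewrite lee_fin powR_ge0.
apply: lee_nneseries => n _.
  by rewrite lee_fin divr_ge0 ?powR_ge0.
have r0 := rho_gt0 n.
have Re0 : 0 <= complex.Re (lambda n).
  by apply: le_trans (Re_lambda n); rewrite mulr_ge0 ?normc_ge0// ltW.
have [n1 n2] := normc1D_ge Re0.
have nl : normc (lambda n) = (rho n)^-1 by rewrite invrK.
have bE : normc (b n) `^ q = (w n)%:num * rho n `^ (- q).
  rewrite /= normcM normcV -/(rho n) powRM ?normc_ge0 ?(ltW r0)//.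
  rewrite -mulrA -powRD; last by rewrite (gt_eqF r0) implybT.
  by rewrite subrr powRr0 mulr1.
have tq : 0 <= theta * q by rewrite mulr_ge0 ?ltW.
rewrite !patchE; case: ifPn => [|n3].
  rewrite inE /= => /andP[_ r1]; rewrite memNset; last by rewrite /= ltNge r1.
  rewrite mule0 adde0 -EFinM lee_fin bE.
  rewrite -mulrA ler_wpM2l// powRD; last by rewrite (gt_eqF r0) implybT.
  rewrite [leRHS]mulrC ler_wpM2l ?powR_ge0//.
  rewrite -[_ `^ (theta * q)]invrK lef_pV2 ?posrE ?invr_gt0 ?powR_gt0//; last first.
    exact: lt_le_trans n1.
  rewrite -powRVl ?(ltW r0)// -nl.
  by rewrite ge0_ler_powR ?nnegrE ?normc_ge0.
have r1 : 1 < rho n.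
  by move: n3; rewrite notin_setE /= r0 /= ltNge => /negP.
rewrite mem_set// mule0 add0e -EFinM lee_fin bE -mulrA ler_wpM2l//.
rewrite ler_piMr ?powR_ge0// invf_le1 ?powR_gt0//; last exact: lt_le_trans n1.
by rewrite -[leLHS](powRr0 (normc (1 + lambda n))) ler_powR.
Qed.

Lemma Xneg1_Xm1 : Xneg q lambda 1 b -> Xm1 q lambda b.
Proof.
rewrite /Xneg/= /Xm1/= /Xm1_norm /lq_norm mul1r => h; apply: poweR_lty.
apply: le_lt_trans h; apply: lee_nneseries => n _.
  by rewrite lee_fin powR_ge0.
rewrite lee_fin normcM normcV powRM ?invr_ge0 ?normc_ge0//.
by rewrite powRVl ?normc_ge0.
Qed.

End carleson_growth.

(** * Embeddings *)

Section hardy_more.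
Context (R : realType).
Notation leb := (@lebesgue_measure R).
Implicit Types (v : R -> R) (p : R).

Lemma hardy_ge0 v (r : R) : 0 <= r -> (forall y, 0 <= v y) ->
  (0 <= hardy v r)%E.
Proof.
move=> r0 v0; apply: integral_ge0 => y _; rewrite lee_fin.
exact: mulr_ge0 (hkernel_ge0 y r0) (v0 y).
Qed.

(** [hardy] is extended-real valued; finiteness is what allows [fine] to be applied to it without
    falling on its default value 0. *)
Lemma hardy_fin p v (r : R) : 1 < p -> 0 < r -> measurable_fun setT v ->
  (forall y, 0 <= v y) -> (\int[leb]_y (v y `^ p)%:E < +oo)%E ->
  (hardy v r)%E \is a fin_num.
Proof.
move=> p1 r0 mv v0 vfin.
have pp' : p^-1 + ((1 - p^-1)^-1)^-1 = 1 by rewrite invrK; ring.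
have [c c0 h] := hardy_le_weighted p1 pp'.
have p0 : p != 0 by rewrite gt_eqF// (lt_trans _ p1).
rewrite ge0_fin_numE ?hardy_ge0 ?(ltW r0)//.
apply: (lty_poweRy p0); apply: (le_lt_trans (h v r r0 mv v0)).
rewrite lte_mul_pinfty ?lee_fin ?mulr_ge0 ?powR_ge0//.
apply: (le_lt_trans (hardy_weighted_le p1 pp' r0 mv)).
by rewrite lte_mul_pinfty ?lee_fin ?powR_ge0.
Qed.

Lemma measurable_hardy v : measurable_fun setT v -> (forall y, 0 <= v y) ->
  measurable_fun [set: measurableTypeR R] (fun s : R => hardy v `|s|).
Proof.
move=> mv v0.
pose F (z : measurableTypeR R * measurableTypeR R) : \bar R :=
  (hkernel `|z.1| z.2 * v z.2)%:E.
apply: (measurable_fun_fubini_tonelli_F (m2 := leb) F) => [|z].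
  apply/measurable_EFinP; apply: measurable_funM.
    apply: measurable_hkernel; last exact: measurable_snd.
    exact: (measurableT_comp (@normr_measurable R setT) measurable_fst).
  exact: (measurableT_comp mv measurable_snd).
by rewrite lee_fin; exact: mulr_ge0 (hkernel_ge0 _ (normr_ge0 _)) (v0 _).
Qed.

(** The numerator does not decrease, and s^2 <= 4 r^2 lets the denominator grow by a factor 4 at
    most. *)
Lemma hkernel_harnack (r s y : R) : 0 < r -> r <= s <= 2 * r ->
  hkernel r y <= 4 * hkernel s y.
Proof.
move=> r0 /andP[rs sr]; have s0 : 0 < s by exact: lt_le_trans rs.
have d1 : 0 < y ^+ 2 + r ^+ 2 by rewrite ltr_wpDl ?sqr_ge0 ?exprn_gt0.
have d2 : 0 < y ^+ 2 + s ^+ 2 by rewrite ltr_wpDl ?sqr_ge0 ?exprn_gt0.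
rewrite /hkernel mulrA ler_pdivlMr// mulrAC ler_pdivrMr//.
have s2 : s ^+ 2 <= 4 * r ^+ 2.
  rewrite (_ : 4 * r ^+ 2 = (2 * r) ^+ 2); last by ring.
  by rewrite ler_sqr ?nnegrE ?(ltW s0) ?mulr_ge0 ?(ltW r0).
apply: (@le_trans _ _ (s * (y ^+ 2 + s ^+ 2))).
  by rewrite ler_wpM2r// ltW.
rewrite -mulrA mulrCA ler_wpM2l ?(ltW s0)// mulrDr.
by have := sqr_ge0 y; lra.
Qed.

Lemma hardy_harnack v (r s : R) : 0 < r -> r <= s <= 2 * r ->
  measurable_fun setT v -> (forall y, 0 <= v y) ->
  (hardy v r <= 4%:E * hardy v s)%E.
Proof.
move=> r0 rs mv v0; have s0 : 0 < s by case/andP: rs => + _; exact: lt_le_trans.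
rewrite -ge0_integralZl//; first last.
- by move=> y _; rewrite lee_fin; exact: mulr_ge0 (hkernel_ge0 _ (ltW s0)) (v0 _).
- apply/measurable_EFinP; apply: measurable_funM => //.
  by apply: measurable_hkernel; [exact: measurable_cst|exact: measurable_id].
apply: le_integral_nonneg => y _.
  by rewrite lee_fin; exact: mulr_ge0 (hkernel_ge0 _ (ltW r0)) (v0 _).
by rewrite -EFinM lee_fin mulrA ler_wpM2r// hkernel_harnack.
Qed.

Lemma integral_hardy_powR p : 1 < p -> exists2 c : R, 0 <= c &
  forall v, measurable_fun setT v -> (forall y, 0 <= v y) ->
  (\int[leb]_y (v y `^ p)%:E < +oo)%E ->
  (\int[leb]_s (fine (hardy v `|s|) `^ p)%:E <=
     c%:E * \int[leb]_y (v y `^ p)%:E)%E.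
Proof.
move=> p1.
have pp' : p^-1 + ((1 - p^-1)^-1)^-1 = 1 by rewrite invrK; ring.
have [c c0 h] := @hardy_carleson _ (measurableTypeR R) R leb (@normr R R) 2 1 p
  _ p1 pp' (@normr_measurable R setT) (growth_lebesgue R) (lexx 1).
exists c => // v mv v0 vfin; have {h} := h v mv v0 vfin.
rewrite poweRe1; last first.
  by apply: integral_ge0 => y _; rewrite lee_fin powR_ge0.
apply: le_trans.
rewrite (@integral_support_le _ (measurableTypeR R) R leb [set s : R | 0 < `|s|]).
- apply: le_integral_nonneg => s s0; first by rewrite lee_fin powR_ge0.
  by rewrite mul1r -poweR_EFin fineK// (hardy_fin p1).
- by move=> s; rewrite lee_fin powR_ge0.
- move=> s /negP; rewrite normr_gt0 negbK => /eqP ->.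
  rewrite normr0 (_ : hardy v 0 = 0%E) ?powR0 ?gt_eqF//.
    by rewrite (lt_trans _ p1).
  by apply: integral0_eq => y _; rewrite /hkernel !mul0r.
Qed.

(* On [r, 2 r] the function [hardy v] is at least [hardy v r / 4], and the kernel
   is at least [1 / (5 r)]. *)
Lemma hardy_powR_harnack (p e : R) : 1 < p -> 0 <= e ->
  forall v (r : R), 0 < r -> measurable_fun setT v -> (forall y, 0 <= v y) ->
  (\int[leb]_y (v y `^ p)%:E < +oo)%E ->
  ((5^-1 * 4^-1 `^ e * fine (hardy v r) `^ e)%:E <=
     hardy (fun s => (fine (hardy v `|s|) `^ e)%R) r)%E.
Proof.
move=> p1 e0 v r r0 mv v0 vfin.
pose I : set R := `[r, 2 * r]%classic.
have lI : leb I = r%:E.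
  rewrite /I lebesgue_measure_itv/= lte_fin ifT; last by lra.
  by rewrite -EFinD; congr EFin; ring.
apply: (@le_trans _ _ (\int[leb]_(s in I)
    (5^-1 * r^-1 * (4^-1 `^ e * fine (hardy v r) `^ e))%:E)%E).
  rewrite integral_cst/=; last exact: measurable_itv.
  rewrite lI -EFinM lee_fin le_eqVlt; apply/orP; left; apply/eqP.
  by field; rewrite gt_eqF.
rewrite integral_mkcond; apply: le_integral_nonneg => s _.
  apply: erestrict_ge0 => t _; rewrite lee_fin !mulr_ge0 ?powR_ge0//.
  by rewrite invr_ge0 ltW.
rewrite patchE; case: ifPn => [|_]; last first.
  rewrite lee_fin; exact: mulr_ge0 (hkernel_ge0 _ (ltW r0)) (powR_ge0 _ _).
rewrite inE /I/= in_itv/= => rs.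
have s0 : 0 < s by case/andP: rs => + _; exact: lt_le_trans.
have f1 := hardy_fin p1 r0 mv v0 vfin.
have f2 := hardy_fin p1 s0 mv v0 vfin.
rewrite lee_fin (gtr0_norm s0); apply: ler_pM.
- by rewrite mulr_ge0 ?invr_ge0// ltW.
- by rewrite mulr_ge0 ?powR_ge0.
- rewrite /hkernel -invfM ler_pdivlMr; last first.
    by rewrite ltr_wpDl ?sqr_ge0 ?exprn_gt0.
  rewrite mulrC ler_pdivrMr ?mulr_gt0//.
  have s2 : s ^+ 2 <= 4 * r ^+ 2.
    case/andP: rs => _ rs; rewrite (_ : 4 * r ^+ 2 = (2 * r) ^+ 2); last by ring.
    by rewrite ler_sqr ?nnegrE ?(ltW s0) ?mulr_ge0 ?(ltW r0).
  by rewrite mulrCA -expr2; lra.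
- rewrite -powRM ?fine_ge0 ?hardy_ge0 ?(ltW r0)//.
  rewrite ge0_ler_powR ?nnegrE ?mulr_ge0 ?fine_ge0 ?hardy_ge0 ?(ltW r0) ?(ltW s0)//.
  rewrite mulrC ler_pdivrMr// mulrC -lee_fin EFinM !fineK//.
  exact: hardy_harnack.
Qed.

End hardy_more.

Section cLnorm_facts.
Context {d} {T : measurableType d} {R : realType}.
Variable mu : {measure set T -> \bar R}.

Lemma cLnormE (D : set T) (r : R) (f : T -> R[i]) : 0 < r ->
  cLnorm mu D r f = ((\int[mu]_(x in D) (normc (f x) `^ r)%:E) `^ r^-1)%E.
Proof.
move=> r0; rewrite /cLnorm unlock; congr (_ `^ _)%E.
rewrite [RHS]integral_mkcond; apply: eq_integral => x _.
rewrite !patchE; case: ifPn => _; first by rewrite /= ger0_norm ?normc_ge0.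
by rewrite abse0 poweR0r// gt_eqF.
Qed.

Lemma measurable_normc (D : set T) (f : T -> R[i]) : measurable D ->
  cmeasurable D f -> measurable_fun D (fun x => normc (f x)).
Proof.
move=> mD [m1 m2].
rewrite (_ : (fun _ => _) = (fun x =>
  (complex.Re (f x) ^+ 2 + complex.Im (f x) ^+ 2) `^ 2^-1)).
  apply: (measurableT_comp (measurable_powR _)).
  by apply: measurable_funD; exact: measurable_funX.
apply/funext => x; rewrite powR12_sqrt ?addr_ge0 ?sqr_ge0// -sqr_normcE.
by rewrite sqrtr_sqr ger0_norm ?normc_ge0.
Qed.

End cLnorm_facts.

Lemma Re_mulRC (R : realType) (a : R) (z : R[i]) :
  complex.Re (a%:C * z) = a * complex.Re z.
Proof. by case: z => x y /=; rewrite mul0r subr0. Qed.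

Lemma Im_mulRC (R : realType) (a : R) (z : R[i]) :
  complex.Im (a%:C * z) = a * complex.Im z.
Proof. by case: z => x y /=; rewrite mul0r addr0. Qed.

(* Inequality (E) of the header. *)
Definition carleson_bound (R : realType) (p q : R) (lambda b : nat -> R[i]) :=
  exists2 k : R, 0 <= k & forall v : R -> R,
    measurable_fun setT v -> (forall y, 0 <= v y) ->
    (\int[lebesgue_measure]_y (v y `^ p)%:E < +oo)%E ->
    (\sum_(0 <= n <oo) (carleson_weight q lambda b n)%:num%:E *
       hardy v (inv_radius lambda n) `^ q <=
     k%:E * (\int[lebesgue_measure]_y (v y `^ p)%:E) `^ (q / p))%E.

Section carleson_embedding.
Context (R : realType).
Variables (p q p' alpha c : R) (lambda b : nat -> R[i]).
Hypotheses (p1 : 1 < p) (q1 : 1 < q) (pp' : p^-1 + p'^-1 = 1).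
Hypotheses (alpha0 : 0 < alpha) (alphaq : alpha * q = p).
Hypotheses (c0 : 0 < c).
Hypotheses (lambda0 : forall n, lambda n != 0)
  (Re_lambda : forall n, c * normc (lambda n) <= complex.Re (lambda n)).

Notation leb := (@lebesgue_measure R).
Notation w := (carleson_weight q lambda b).
Notation mu := (carleson_measure q lambda b).
Notation z := (inv_point lambda).
Notation rho := (inv_radius lambda).
Let rho_gt0 := radius_gt0 lambda0.
Let z_rho := point_radius c0 lambda0 Re_lambda.
Let c_rho := radius_le_point2 c0 lambda0 Re_lambda.
Let z2_gt0 := point2_gt0 c0 lambda0 Re_lambda.

Let p0 : 0 < p. Proof. exact: lt_trans p1. Qed.
Let q0 : 0 < q. Proof. exact: lt_trans q1. Qed.

Lemma qp_alpha : q / p = alpha^-1.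
Proof. by rewrite -alphaq; field; rewrite (gt_eqF q0) (gt_eqF alpha0). Qed.

Lemma integral_carleson_measure (f : R * R -> \bar R) :
  (forall x, 0 <= f x)%E ->
  (\int[mu]_(x in halfplane) f x =
   \sum_(0 <= n <oo) (w n)%:num%:E * f (z n))%E.
Proof.
move=> f0; rewrite [LHS](discrete_measure_integral w z
  (@measurable_set1_pair R))//.
by apply: eq_eseriesr => n _; rewrite patchE mem_set//; exact: z2_gt0.
Qed.

(** The integrals of the real and the imaginary part are bounded separately, whence the factor 2. *)
Lemma poisson_ext_le (f : R -> R[i]) n : cmeasurable setT f ->
  ((normc (poisson_ext f (z n)))%:E <=
  (2 * (pi^-1 * (2 + 3 / c ^+ 2)))%:E * hardy (fun y => normc (f y)) (rho n))%E.
Proof.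
move=> mf; have K0 : 0 <= pi^-1 * (2 + 3 / c ^+ 2) :> R.
  by rewrite mulr_ge0 ?invr_ge0 ?pi_ge0// addr_ge0 ?divr_ge0 ?sqr_ge0.
have C0 : 0 <= c / (2 * pi) by rewrite divr_ge0 ?mulr_ge0 ?pi_ge0// ltW.
have mn := measurable_normc measurableT mf.
have mk : measurable_fun setT (hkernel (rho n)).
  by apply: measurable_hkernel; [exact: measurable_cst|exact: measurable_id].
have hg0 y : 0 <= hkernel (rho n) y * normc (f y).
  exact: mulr_ge0 (hkernel_ge0 _ (ltW (rho_gt0 n))) (normc_ge0 _).
have mpk : measurable_fun [set: R]
    (fun y => poisson_kernel (z n).2 ((z n).1 - y)).
  apply: measurable_funM; first exact: measurable_cst.
  apply: measurable_funM; first exact: measurable_cst.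
  apply: measurable_funV; apply: measurable_funD; first exact: measurable_cst.
  by apply: measurable_funX; apply: measurable_funB; first exact: measurable_cst.
have pk0 y : 0 <= poisson_kernel (z n).2 ((z n).1 - y).
  apply: le_trans (hkernel_le_poisson c0 (rho_gt0 n) (z_rho n) (c_rho n) y).
  exact: mulr_ge0 C0 (hkernel_ge0 _ (ltW (rho_gt0 n))).
have key (g : R -> R) : measurable_fun setT g ->
    (forall y, `|g y| <= normc (f y)) ->
    ((`|fine (\int[leb]_y (poisson_kernel (z n).2 ((z n).1 - y) * g y)%:E)|%R)%:E
      <= (pi^-1 * (2 + 3 / c ^+ 2))%:E * hardy (fun y => normc (f y)) (rho n))%E.
  move=> mg gf; rewrite -ge0_integralZl//; first last.
  - by move=> y _; rewrite lee_fin.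
  - by apply/measurable_EFinP; exact: measurable_funM.
  set I := (\int[leb]_y _)%E; apply: (@le_trans _ _ `|I|%E).
    (* An infinite integral is sent to 0 by [fine], and the bound is then trivial. *)
    by case: I => [x| |] //=; rewrite normr0 ?leey.
  apply: (le_trans (le_abse_integral _ _ _)) => //.
    by apply/measurable_EFinP; exact: measurable_funM.
  apply: le_integral_nonneg => y _; first exact: abse_ge0.
  rewrite abse_EFin normrM (ger0_norm (pk0 y)) -EFinM lee_fin mulrA.
  apply: ler_pM => //.
  exact: poisson_le_hkernel c0 (rho_gt0 n) (z_rho n) (c_rho n) y.
have k1 := key _ mf.1 (fun y => Re_le_normc (f y)).
have k2 := key _ mf.2 (fun y => Im_le_normc (f y)).
rewrite mulr_natl mulr2n EFinD ge0_muleDl ?lee_fin//.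
apply: le_trans (leeD k1 k2); rewrite -EFinD lee_fin.
apply: (le_trans (normc_le_ReIm _)).
rewrite /poisson_ext /cintegral /= /Rintegral le_eqVlt; apply/orP; left; apply/eqP.
congr (_ + _); congr (Num.norm _); congr fine; apply: eq_integral => y _.
  by rewrite Re_mulRC.
by rewrite Im_mulRC.
Qed.

Lemma poisson_ext_ge (P : R) (g : R -> R) n : 1 < P ->
  measurable_fun setT g -> (forall y, 0 <= g y) ->
  (\int[leb]_y (g y `^ P)%:E < +oo)%E ->
  c / (2 * pi) * fine (hardy g (rho n)) <=
  normc (poisson_ext (fun y => (g y)%:C) (z n)).
Proof.
move=> P1 mg g0 gfin.
have K0 : 0 <= pi^-1 * (2 + 3 / c ^+ 2) :> R.
  by rewrite mulr_ge0 ?invr_ge0 ?pi_ge0// addr_ge0 ?divr_ge0 ?sqr_ge0.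
have C0 : 0 <= c / (2 * pi) by rewrite divr_ge0 ?mulr_ge0 ?pi_ge0// ltW.
have hf := hardy_fin P1 (rho_gt0 n) mg g0 gfin.
have pk0 y : 0 <= poisson_kernel (z n).2 ((z n).1 - y).
  apply: le_trans (hkernel_le_poisson c0 (rho_gt0 n) (z_rho n) (c_rho n) y).
  exact: mulr_ge0 C0 (hkernel_ge0 _ (ltW (rho_gt0 n))).
have mk : measurable_fun setT (hkernel (rho n)).
  by apply: measurable_hkernel; [exact: measurable_cst|exact: measurable_id].
have mh : measurable_fun setT (fun y => (hkernel (rho n) y * g y)%:E).
  by apply/measurable_EFinP; exact: measurable_funM.
have hg0 y : 0 <= hkernel (rho n) y * g y.
  exact: mulr_ge0 (hkernel_ge0 _ (ltW (rho_gt0 n))) (g0 y).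
set I := (\int[leb]_y (poisson_kernel (z n).2 ((z n).1 - y) * g y)%:E)%E.
have I1 : ((c / (2 * pi))%:E * hardy g (rho n) <= I)%E.
  rewrite -ge0_integralZl//; last by move=> y _; rewrite lee_fin.
  apply: le_integral_nonneg => y _.
    by rewrite -EFinM lee_fin; exact: mulr_ge0 C0 (hg0 y).
  rewrite -EFinM lee_fin mulrA ler_wpM2r//.
  exact: hkernel_le_poisson c0 (rho_gt0 n) (z_rho n) (c_rho n) y.
(* Only finiteness of I is wanted from this upper bound: an infinite I would become 0 in
   [cintegral], and the lower bound would be lost. *)
have I2 : (I <= (pi^-1 * (2 + 3 / c ^+ 2))%:E * hardy g (rho n))%E.
  rewrite -ge0_integralZl//; last by move=> y _; rewrite lee_fin.
  apply: le_integral_nonneg => y _.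
    by rewrite lee_fin mulr_ge0.
  rewrite -EFinM lee_fin mulrA ler_wpM2r//.
  exact: poisson_le_hkernel c0 (rho_gt0 n) (z_rho n) (c_rho n) y.
have I0 : (0 <= I)%E by apply: integral_ge0 => y _; rewrite lee_fin mulr_ge0.
have Ifin : I \is a fin_num.
  rewrite ge0_fin_numE//; apply: (le_lt_trans I2).
  by rewrite lte_mul_pinfty// -ge0_fin_numE// hardy_ge0// ltW.
apply: le_trans (Re_le_normc _); apply: le_trans (ler_norm _).
rewrite /poisson_ext /cintegral /= /Rintegral.
rewrite -lee_fin EFinM fineK//; apply: (le_trans I1).
rewrite le_eqVlt; apply/orP; left; apply/eqP.
rewrite -[LHS](fineK Ifin); congr (fine _)%:E.
by apply: eq_integral => y _; rewrite mul0r subr0.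
Qed.

Lemma embedding_carleson_bound : embedding_carleson alpha mu ->
  carleson_bound p q lambda b.
Proof.
move=> [r [r1 ar1 [M hM]]].
have r0 : 0 < r by exact: lt_le_trans r1.
have ar0 : 0 < alpha * r by exact: lt_trans ar1.
have [c1 c10 hc1] := integral_hardy_powR p1.
(* With this e, the r-th power of h^e is h^q and its power alpha r is h^p, so both sides of the
   embedding acquire the exponents of (E). *)
pose e := q / r.
have e0 : 0 <= e by rewrite divr_ge0// ltW.
(* The constants of [poisson_ext_ge] and of [hardy_powR_harnack], multiplied. *)
pose kappa := c / (2 * pi) * (5^-1 * 4^-1 `^ e).
have pi0 := pi_gt0 R.
have kappa0 : 0 < kappa.
  by rewrite mulr_gt0 ?divr_gt0 ?mulr_gt0// powR_gt0 invr_gt0.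
exists (kappa `^ (- r) * (`|M| `^ r * c1 `^ (q / p))).
  by rewrite mulr_ge0 ?powR_ge0 ?mulr_ge0 ?powR_ge0.
move=> v mv v0 vfin.
set N := (\int[leb]_y (v y `^ p)%:E)%E in vfin *.
have N0 : (0 <= N)%E by apply: integral_ge0 => y _; rewrite lee_fin powR_ge0.
pose g (s : R) := (fine (hardy v `|s|) `^ e).
have g0 s : 0 <= g s by exact: powR_ge0.
have mg : measurable_fun [set: R] g.
  apply: measurable_fun_powR; apply: (measurableT_comp (fine_measurable _)) => //.
  exact: measurable_hardy.
(* Hardy's inequality puts the test function g into L^(alpha r). *)
have gint : (\int[leb]_s (g s `^ (alpha * r))%:E <= c1%:E * N)%E.
  apply: le_trans (hc1 v mv v0 vfin); apply: le_integral_nonneg => s _.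
    by rewrite lee_fin powR_ge0.
  rewrite lee_fin -powRrM (_ : e * (alpha * r) = p)//.
  by rewrite -alphaq /e; field; rewrite gt_eqF.
have gfin : (\int[leb]_s (g s `^ (alpha * r))%:E < +oo)%E.
  by apply: (le_lt_trans gint); rewrite lte_mul_pinfty.
pose f (s : R) := (g s)%:C.
have nf s : normc (f s) = g s by rewrite normc_real ger0_norm.
have Lf : (cLnorm leb setT (alpha * r) f =
    (\int[leb]_s (g s `^ (alpha * r))%:E) `^ (alpha * r)^-1)%E.
  rewrite (cLnormE _ _ _ ar0); congr poweR.
  by apply: eq_integral => s _; rewrite nf.
have Hf : cLfun leb setT (alpha * r) f.
  split; last by rewrite Lf poweR_lty.
  by split => //=; exact: measurable_cst.
have := hM f Hf; rewrite cLnormE// Lf integral_carleson_measure; last first.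
  by move=> x; rewrite lee_fin powR_ge0.
set S := (\sum_(0 <= n <oo) _)%E.
have S0 : (0 <= S)%E.
  by apply: nneseries_ge0 => n _ _; rewrite mule_ge0// lee_fin powR_ge0.
set G := (\int[leb]_s (g s `^ (alpha * r))%:E)%E in gint gfin *.
have G0 : (0 <= G)%E by apply: integral_ge0 => y _; rewrite lee_fin powR_ge0.
move=> SM; have {SM} : (S <= (`|M|%:E * G `^ (alpha * r)^-1) `^ r)%E.
  rewrite -[leLHS]poweRe1// -(@mulVf _ r) ?gt_eqF// poweRrM.
  apply: lee_poweR (ltW r0) (poweR_ge0 _ _) _; apply: (le_trans SM).
  by rewrite lee_wpmul2r ?poweR_ge0// lee_fin ler_norm.
rewrite poweRM ?poweR_ge0 ?lee_fin// -poweRrM.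
rewrite (_ : (alpha * r)^-1 * r = q / p); last first.
  by rewrite qp_alpha; field; rewrite (gt_eqF r0) (gt_eqF alpha0).
have qp0 : 0 <= q / p by rewrite divr_ge0// ltW.
have GN := lee_poweR qp0 G0 gint.
rewrite poweRM ?lee_fin// !poweR_EFin in GN.
rewrite poweR_EFin => SM.
have {GN}SM : (S <= (`|M| `^ r)%:E * ((c1 `^ (q / p))%:E * N `^ (q / p)))%E.
  by apply: (le_trans SM); rewrite lee_wpmul2l ?lee_fin ?powR_ge0.
rewrite EFinM -muleA EFinM -[X in (_ <= _ * X)%E]muleA.
apply: (@le_trans _ _ ((kappa `^ (- r))%:E * S)%E); last first.
  by rewrite lee_wpmul2l ?lee_fin ?powR_ge0.
rewrite -nneseriesZl; last by move=> n _; rewrite mule_ge0 ?lee_fin ?powR_ge0.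
apply: lee_nneseries => n _.
  by rewrite mule_ge0 ?lee_fin ?poweR_ge0.
have hf := hardy_fin p1 (rho_gt0 n) mv v0 vfin.
rewrite muleCA lee_wpmul2l ?lee_fin//.
rewrite -(fineK hf) poweR_EFin -EFinM lee_fin.
have h0 : 0 <= fine (hardy v (rho n)).
  by rewrite fine_ge0// hardy_ge0// ltW.
set h := fine _ in h0 *.
have b1 : kappa * h `^ e <= normc (poisson_ext f (z n)).
  apply: le_trans (poisson_ext_ge n ar1 mg g0 gfin).
  rewrite /kappa -[leLHS]mulrA ler_wpM2l ?divr_ge0 ?mulr_ge0 ?(ltW c0) ?(ltW pi0)//.
  rewrite -lee_fin [leRHS]fineK; last exact: hardy_fin ar1 (rho_gt0 n) mg g0 gfin.
  exact: hardy_powR_harnack p1 e0 v (rho n) (rho_gt0 n) mv v0 vfin.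
have -> : h `^ q = kappa `^ (- r) * (kappa * h `^ e) `^ r.
  rewrite powRM ?powR_ge0 ?(ltW kappa0)// -powRrM mulrA powRN mulVf; last first.
    by rewrite gt_eqF// powR_gt0.
  by rewrite mul1r /e divfK// gt_eqF.
rewrite ler_wpM2l ?powR_ge0// ge0_ler_powR ?(ltW r0)// ?nnegrE ?normc_ge0//.
by rewrite mulr_ge0 ?powR_ge0 ?(ltW kappa0).
Qed.

Lemma carleson_bound_growth : carleson_bound p q lambda b ->
  carleson_growth p q lambda b.
Proof.
(* The factor 2^q appears because the indicator of [0, L] has [hardy] at least 1/2 at every rho <=
   L: on [0, rho] the kernel is at least 1 / (2 rho). *)
move=> [k k0 hk]; exists (k * 2 `^ q); split; first by rewrite mulr_ge0 ?powR_ge0.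
move=> L L0; pose v : R -> R := \1_(`[0, L]%classic).
have v0 y : 0 <= v y by rewrite /v indicE.
have mv : measurable_fun [set: R] v by exact: measurable_indic.
have vp y : v y `^ p = v y.
  rewrite /v indicE; case: (_ \in _); first by rewrite powR1.
  by rewrite powR0// gt_eqF.
have vint : (\int[leb]_y (v y `^ p)%:E = L%:E)%E.
  under eq_integral do rewrite vp.
  rewrite integral_indic//= setIT lebesgue_measure_itv/= lte_fin L0.
  by rewrite sube0.
have vfin : (\int[leb]_y (v y `^ p)%:E < +oo)%E by rewrite vint ltry.
have := hk v mv v0 vfin; rewrite vint poweR_EFin -EFinM => h.
rewrite [leLHS](carleson_nat_measureE q lambda b) mulrAC [_ * 2 `^ q]mulrC EFinM.
apply: le_trans (lee_wpmul2l _ h); last by rewrite lee_fin powR_ge0.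
rewrite -nneseriesZl; last by move=> n _; rewrite mule_ge0 ?lee_fin ?poweR_ge0.
apply: lee_nneseries => n _; first by rewrite lee_fin mulr_ge0.
rewrite EFinM muleCA lee_wpmul2l ?lee_fin// indicE.
case: (boolP (n \in [set m | 0 < rho m <= L])) => [|_]; last first.
  by rewrite mule_ge0 ?poweR_ge0 ?lee_fin ?powR_ge0.
rewrite inE /= => /andP[r0 rL].
have hf := hardy_fin p1 (rho_gt0 n) mv v0 vfin.
rewrite -(fineK hf) poweR_EFin -EFinM lee_fin.
rewrite -powRM ?fine_ge0 ?hardy_ge0 ?(ltW r0)//.
have e1 : (1 : R) `^ q = true%:R by rewrite powR1.
rewrite -[leLHS]e1 ge0_ler_powR ?(ltW q0)// ?nnegrE ?mulr_ge0 ?fine_ge0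
  ?hardy_ge0 ?(ltW r0)//.
rewrite -lee_fin EFinM fineK//.
have -> : (1%:E = 2%:E * (2^-1)%:E :> \bar R)%E by rewrite -EFinM mulfV.
rewrite lee_wpmul2l ?lee_fin//.
have -> : (2^-1 = (2 * rho n)^-1 * rho n)%R by field; rewrite gt_eqF.
have lI : leb `[0, rho n]%classic = (rho n)%:E.
  by rewrite lebesgue_measure_itv/= lte_fin r0 sube0.
rewrite [leLHS]EFinM -lI -[leLHS]integral_cst; last exact: measurable_itv.
rewrite integral_mkcond; apply: le_integral_nonneg => y _.
  by apply: erestrict_ge0 => x _; rewrite lee_fin invr_ge0 mulr_ge0 ?(ltW r0).
rewrite patchE; case: ifPn => [|_]; last first.
  by rewrite lee_fin; exact: mulr_ge0 (hkernel_ge0 _ (ltW r0)) (v0 _).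
rewrite inE/= in_itv/= => /andP[y0 yr].
rewrite /v indicE mem_set; last by rewrite /= in_itv/= y0 (le_trans yr).
rewrite lee_fin mulr1 /hkernel ler_pdivlMr; last first.
  by rewrite ltr_wpDl ?sqr_ge0 ?exprn_gt0.
rewrite mulrC ler_pdivrMr ?mulr_gt0//.
have y2 : y ^+ 2 <= rho n ^+ 2 by rewrite ler_sqr ?nnegrE ?(ltW r0).
by rewrite mulrCA -expr2; lra.
Qed.

Lemma growth_embedding_carleson : p <= q -> carleson_growth p q lambda b ->
  embedding_carleson alpha mu.
Proof.
move=> pq [C gr].
have qp1 : 1 <= q / p by rewrite ler_pdivlMr// mul1r.
have [k k0 hk] := @hardy_carleson _ nat R (carleson_nat_measure q lambda b) rho
  C (q / p) p p' p1 pp' (fun _ _ _ => I) gr qp1.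
pose K : R := 2 * (pi^-1 * (2 + 3 / c ^+ 2)).
have K0 : 0 <= K.
  rewrite mulr_ge0// mulr_ge0 ?invr_ge0 ?pi_ge0// addr_ge0//.
  by rewrite divr_ge0 ?sqr_ge0.
(* The choice r = q turns alpha r into p, the exponent for which the Hardy bound is available. *)
exists q; split; [exact: ltW|by rewrite alphaq|].
rewrite alphaq; exists (K * k `^ q^-1) => f [mf ff].
pose v y := normc (f y).
have mv : measurable_fun setT v := measurable_normc measurableT mf.
have v0 y : 0 <= v y by exact: normc_ge0.
move: ff; rewrite !cLnormE// => ff.
have vfin : (\int[leb]_y (v y `^ p)%:E < +oo)%E.
  by apply: lty_poweRy ff; rewrite invr_eq0 gt_eqF.
have := hk v mv v0 vfin.
rewrite (discrete_measure_integral w id) => [|//|x _]; last exact: poweR_ge0.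
set N := (\int[leb]_y (v y `^ p)%:E)%E in vfin *.
have N0 : (0 <= N)%E by apply: integral_ge0 => y _; rewrite lee_fin powR_ge0.
move=> S.
rewrite integral_carleson_measure; last by move=> x; rewrite lee_fin powR_ge0.
have -> : ((K * k `^ q^-1)%:E * N `^ p^-1 =
    ((K `^ q)%:E * (k%:E * N `^ (q / p))) `^ q^-1)%E.
  rewrite poweRM ?mule_ge0 ?lee_fin ?powR_ge0 ?poweR_ge0//.
  rewrite poweRM ?lee_fin ?poweR_ge0// !poweR_EFin -powRrM mulfV ?gt_eqF//.
  rewrite powRr1// -poweRrM (_ : q / p * q^-1 = p^-1) ?EFinM ?muleA//.
  by field; rewrite (gt_eqF p0) (gt_eqF q0).
apply: lee_poweR.
- by rewrite invr_ge0 ltW.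
- by apply: nneseries_ge0 => n _ _; rewrite mule_ge0 ?lee_fin ?powR_ge0.
apply: le_trans (lee_wpmul2l _ S); last by rewrite lee_fin powR_ge0.
rewrite -nneseriesZl; last first.
  move=> n _; rewrite mule_ge0 ?lee_fin//; apply: erestrict_ge0 => m _.
  exact: poweR_ge0.
apply: lee_nneseries => n _; first by rewrite mule_ge0 ?lee_fin ?powR_ge0.
rewrite muleCA lee_wpmul2l ?lee_fin// patchE mem_set; last exact: rho_gt0.
rewrite divfK ?gt_eqF// -poweR_EFin -[(K `^ q)%:E]poweR_EFin -poweRM ?lee_fin//.
  apply: lee_poweR; rewrite ?lee_fin ?normc_ge0 ?(ltW q0)//.
  exact: poisson_ext_le.
by apply: hardy_ge0 => //; exact: ltW.
Qed.

End carleson_embedding.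

(** * Bochner integrals in X_(-1) *)

Section list_membership.
Context {T U : Type}.

Lemma In_map (f : T -> U) (s : seq T) y :
  List.In y (map f s) -> exists2 x, List.In x s & y = f x.
Proof.
elim: s => //= x s IH [<-|/IH[x' ? ?]]; first by exists x => //; left.
by exists x' => //; right.
Qed.

Lemma In_cat (s t : seq T) y : List.In y (s ++ t) -> List.In y s \/ List.In y t.
Proof.
elim: s => [|x s IH] /=; first by right.
by move=> [->|/IH[]]; [left; left|left; right|right].
Qed.

Lemma In_flatten (ss : seq (seq T)) y :
  List.In y (flatten ss) -> exists2 s, List.In s ss & List.In y s.
Proof.
elim: ss => //= s ss IH /In_cat[|/IH[s' ? ?]]; first by exists s => //; left.
by exists s' => //; right.
Qed.

End list_membership.

(** * Approximation of scalar functions by simple functions *)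

Section simple_approximation.
Context {R : realType}.
Import HBNNSimple.

Definition eval_real (s : seq (set R * R)) (x : R) : R :=
  \sum_(Ar <- s) \1_(Ar.1) x * Ar.2.

Definition eval_complex (s : seq (set R * R[i])) (x : R) : R[i] :=
  \sum_(Ac <- s) (\1_(Ac.1) x)%:C * Ac.2.

Lemma nnsfun_list (h : {nnsfun (measurableTypeR R) >-> R}) :
  exists s : seq (set R * R),
    (forall A r, List.In (A, r) s -> measurable A) /\
    forall x, h x = eval_real s x.
Proof.
have mh : measurable_fun [set: measurableTypeR R] h by exact: measurable_funP.
exists [seq (h @^-1` [set y], y) | y <- finmap.enum_fset (fset_set (range h))]; split.
  move=> A r Ar; have [y _ [-> _]] := In_map Ar.
  by rewrite -[X in measurable X]setTI; exact: mh.
move=> x; rewrite /eval_real big_map fimfunE fsbig_finite//=.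
by apply: eq_bigr => y _; rewrite mulrC.
Qed.

(** The positive and negative parts are approximated from below, and at each point one of them
    vanishes; hence the error never exceeds |g|, as dominated convergence will require. *)
Lemma real_simple_approx (g : R -> R) : measurable_fun setT g ->
  exists phi : nat -> seq (set R * R),
  [/\ forall k A r, List.In (A, r) (phi k) -> measurable A,
      forall k x, `|g x - eval_real (phi k) x| <= `|g x| &
      forall x, (fun k => eval_real (phi k) x) @ \oo --> g x].
Proof.
move=> mg.
have mp : measurable_fun [set: measurableTypeR R] (EFin \o g^\+).
  by apply/measurable_EFinP; exact: measurable_funrpos.
have mn : measurable_fun [set: measurableTypeR R] (EFin \o g^\-).
  by apply/measurable_EFinP; exact: measurable_funrneg.
pose hp := nnsfun_approx measurableT mp.
pose hn := nnsfun_approx measurableT mn.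
have [sp hsp] := choice (fun k => nnsfun_list (hp k)).
have [sn hsn] := choice (fun k => nnsfun_list (hn k)).
exists (fun k => sp k ++ [seq (Ar.1, - Ar.2) | Ar <- sn k]).
have ev k x : eval_real (sp k ++ [seq (Ar.1, - Ar.2) | Ar <- sn k]) x =
    hp k x - hn k x.
  rewrite /eval_real big_cat big_map/= -/(eval_real _ _) -(hsp k).2.
  congr (_ + _); rewrite (hsn k).2 /eval_real -sumrN.
  by apply: eq_bigr => i _; rewrite mulrN.
have p0 x : (0 <= (EFin \o (g^\+)%R) x)%E by rewrite lee_fin funrpos_ge0.
have n0 x : (0 <= (EFin \o (g^\-)%R) x)%E by rewrite lee_fin funrneg_ge0.
have lep k x : hp k x <= g^\+ x.
  by rewrite -lee_fin nnsfun_approxE; exact: le_approx.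
have len k x : hn k x <= g^\- x.
  by rewrite -lee_fin nnsfun_approxE; exact: le_approx.
have hp0 k x : 0 <= hp k x by [].
have hn0 k x : 0 <= hn k x by [].
split.
- move=> k A r Ar; have [|{}Ar] := In_cat Ar; first exact: (hsp k).1.
  by have [[B s] /(hsn k).1 mB [-> _]] := In_map Ar.
- move=> k x; rewrite ev.
  have := lep k x; have := len k x; have := hp0 k x; have := hn0 k x.
  rewrite /funrpos /funrneg /=; case: (leP 0 (g x)) => gx.
    rewrite max_r ?oppr_le0// (ger0_norm gx) => *.
    by rewrite ler_norml; apply/andP; split; lra.
  rewrite max_l ?oppr_ge0 ?(ltW gx)// (ltr0_norm gx) => *.
  by rewrite ler_norml; apply/andP; split; lra.
- move=> x; under eq_fun do rewrite ev.
  have -> : g x = g^\+ x - g^\- x.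
    by rewrite -[in LHS](funrposBneg g).
  have cp := @cvg_nnsfun_approx _ _ _ _ measurableT _ mp (fun x _ => p0 x) x I.
  have cn := @cvg_nnsfun_approx _ _ _ _ measurableT _ mn (fun x _ => n0 x) x I.
  apply: cvgB.
  + by move/fine_cvgP: cp => [_].
  + by move/fine_cvgP: cn => [_].
Qed.

Lemma complex_simple_approx (g : R -> R[i]) : cmeasurable setT g ->
  exists phi : nat -> seq (set R * R[i]),
  [/\ forall k A c, List.In (A, c) (phi k) -> measurable A,
      forall k x, normc (g x - eval_complex (phi k) x) <= 2 * normc (g x) &
      forall x, (fun k => normc (g x - eval_complex (phi k) x)) @ \oo --> 0].
Proof.
move=> [/real_simple_approx[f [mf lef cf]] /real_simple_approx[h [mh leh ch]]].
exists (fun k => [seq (Ar.1, Ar.2 +i* 0) | Ar <- f k] ++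
                 [seq (Ar.1, 0 +i* Ar.2) | Ar <- h k]).
have ev k x : eval_complex ([seq (Ar.1, Ar.2 +i* 0) | Ar <- f k] ++
    [seq (Ar.1, 0 +i* Ar.2) | Ar <- h k]) x =
    eval_real (f k) x +i* eval_real (h k) x.
  rewrite /eval_complex big_cat !big_map/=.
  have -> : \sum_(j <- f k) (\1_(j.1) x)%:C * (j.2 +i* 0) =
      eval_real (f k) x +i* 0.
    rewrite /eval_real; elim: (f k) => [|a s IH]; first by rewrite !big_nil.
    by rewrite !big_cons IH; simpc.
  have -> : \sum_(j <- h k) (\1_(j.1) x)%:C * (0 +i* j.2) =
      0 +i* eval_real (h k) x.
    rewrite /eval_real; elim: (h k) => [|a s IH]; first by rewrite !big_nil.
    by rewrite !big_cons IH; simpc.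
  by simpc.
have le k x : normc (g x - (eval_real (f k) x +i* eval_real (h k) x)) <=
    `|complex.Re (g x) - eval_real (f k) x| +
    `|complex.Im (g x) - eval_real (h k) x|.
  by case: (g x) => u v; exact: normc_le_ReIm.
split.
- move=> k A z Az; have [{}Az|{}Az] := In_cat Az.
    by have [[B s] /mf mB [-> _]] := In_map Az.
  by have [[B s] /mh mB [-> _]] := In_map Az.
- move=> k x; rewrite ev; apply: (le_trans (le k x)).
  rewrite mulr_natl mulr2n lerD//.
    exact: le_trans (lef k x) (Re_le_normc _).
  exact: le_trans (leh k x) (Im_le_normc _).
- move=> x; under eq_fun do rewrite ev.
  apply: (@squeeze_cvgr _ _ _ _ (cst 0) (fun k =>
    `|complex.Re (g x) - eval_real (f k) x| +
    `|complex.Im (g x) - eval_real (h k) x|)).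
  + by apply: nearW => k; rewrite normc_ge0 le.
  + exact: cvg_cst.
  + rewrite -[X in _ --> X]addr0; apply: cvgD.
      rewrite -(normr0 R) -(subrr (complex.Re (g x))); apply: cvg_norm.
      by apply: cvgB => //; exact: cvg_cst.
    rewrite -(normr0 R) -(subrr (complex.Im (g x))); apply: cvg_norm.
    by apply: cvgB => //; exact: cvg_cst.
Qed.

End simple_approximation.

Lemma poweR_cvg0 (R : realType) (f : nat -> \bar R) (r : R) : 0 < r ->
  (forall k, 0 <= f k)%E -> f @ \oo --> 0%E ->
  (fun k => f k `^ r)%E @ \oo --> 0%E.
Proof.
move=> r0 f0 /fine_cvgP[ffin cf]; apply/fine_cvgP; split.
  by apply: filterS ffin => k; exact: fin_num_poweR.
apply/cvgrPdist_lt => e e0.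
have er0 : 0 < e `^ r^-1 by exact: powR_gt0.
have /cvgrPdist_lt/(_ _ er0) := cf; apply: filterS => k /=.
rewrite !sub0r !normrN fine_poweR !ger0_norm ?powR_ge0 ?fine_ge0// => h.
have := gt0_ltr_powR r0 _ _ h; rewrite !nnegrE fine_ge0// powR_ge0.
by rewrite -powRrM mulVf ?gt_eqF// powRr1 ?(ltW e0)//; apply.
Qed.

(** Dominated convergence for the counting measure. *)
Lemma nneseries_dominated_cvg0 (R : realType) (F : nat -> nat -> \bar R)
    (G : nat -> R) :
  (forall k m, 0 <= F k m <= (G m)%:E)%E ->
  (\sum_(0 <= m <oo) (G m)%:E < +oo)%E ->
  (forall m, F ^~ m @ \oo --> 0%E) ->
  (fun k => \sum_(0 <= m <oo) F k m)%E @ \oo --> 0%E.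
Proof.
move=> FG Gfin cF.
have F0 k m : (0 <= F k m)%E by case/andP: (FG k m).
have G0 m : (0 <= (G m)%:E)%E by case/andP: (FG 0%N m) => h1 h2; exact: le_trans h2.
have E k : (\sum_(0 <= m <oo) F k m = \int[counting]_m F k m)%E.
  by rewrite ge0_integral_count.
under eq_fun do rewrite E.
have Z : (\int[@counting nat R]_(m in [set: nat]) cst 0 m = 0)%E.
  exact: integral0.
have := @dominated_cvg _ _ _ (@counting nat R) setT measurableT F (cst 0%E)
  (EFin \o G).
rewrite Z; apply => //.
- by move=> m _; exact: cF.
- apply/integrableP; split => //.
  rewrite (eq_integral (fun m => (G m)%:E)); last first.
    by move=> m _; rewrite /= ger0_norm// -lee_fin.
  by rewrite ge0_integral_count.
- by move=> k m _; rewrite gee0_abs//; case/andP: (FG k m).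
Qed.

Section bochner.
Context {R : realType}.
Notation leb := (@lebesgue_measure R).
Variable D : set (measurableTypeR R).
Hypotheses (mD : measurable D) (Dfin : (leb D < +oo)%E).

Lemma eval_real_integral (s : seq (set R * R)) :
  (forall A r, List.In (A, r) s -> measurable A) ->
  leb.-integrable D (EFin \o eval_real s) /\
  Rintegral leb D (eval_real s) =
    \sum_(Ar <- s) fine (leb (Ar.1 `&` D)) * Ar.2.
Proof.
elim: s => [_|[A r] s IH ms].
  rewrite big_nil; split; last first.
    rewrite /Rintegral (eq_integral (cst 0%E)) ?integral0// => x _.
    by rewrite /eval_real big_nil.
  rewrite (_ : _ \o _ = cst 0%E); first exact: integrable0.
  by apply/funext => x /=; rewrite /eval_real big_nil.
have mA : measurable A by apply: (ms A r); left.
have [|i1 e1] := IH; first by move=> B t Bt; apply: (ms B t); right.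
have iA : leb.-integrable D (EFin \o (fun x => \1_A x * r)).
  apply: measurable_bounded_integrable => //.
    by apply: measurable_funM; [exact: measurable_indic|exact: measurable_cst].
  exists `|r|; split; first exact: num_real.
  move=> M rM x _ /=; apply: le_trans (ltW rM).
  by rewrite normrM indicE ler_piMl// normr_nat lern1 leq_b1.
have evE : eval_real ((A, r) :: s) = (fun x => \1_A x * r + eval_real s x).
  by apply/funext => x; rewrite /eval_real big_cons.
rewrite evE big_cons/= -e1; split.
  by have := integrableD mD iA i1; apply: eq_integrable => // x _ /=; rewrite EFinD.
rewrite RintegralD//; congr (_ + _).
have i1A : leb.-integrable D (EFin \o \1_A).
  apply: measurable_bounded_integrable => //.
  exists 1; split; first exact: num_real.
  move=> M rM x _ /=; apply: le_trans (ltW rM).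
  by rewrite indicE normr_nat lern1 leq_b1.
rewrite RintegralZr// /Rintegral integral_indic//.
Qed.

Definition real_part (s : @simple_fct R) n : seq (set R * R) :=
  [seq (Ac.1, complex.Re (Ac.2 n)) | Ac <- s].

Definition imag_part (s : @simple_fct R) n : seq (set R * R) :=
  [seq (Ac.1, complex.Im (Ac.2 n)) | Ac <- s].

Lemma simple_evalE (s : @simple_fct R) n x :
  simple_eval s x n =
  eval_real (real_part s n) x +i*
  eval_real (imag_part s n) x.
Proof.
rewrite /simple_eval /eval_real /real_part /imag_part !big_map /=.
elim: s => [|[A v] s IH]; first by rewrite !big_nil.
by rewrite !big_cons IH /=; case: (v n) => a b /=; simpc.
Qed.

Lemma simple_integralE (s : @simple_fct R) n :
  (forall A v, List.In (A, v) s -> measurable A) ->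
  simple_integral D s n = cintegral leb D (fun x => simple_eval s x n) /\
  leb.-integrable D (fun x => (complex.Re (simple_eval s x n))%:E) /\
  leb.-integrable D (fun x => (complex.Im (simple_eval s x n))%:E).
Proof.
move=> ms.
have [] := @eval_real_integral (real_part s n).
  by move=> A r Ar; have [[B v] /ms mB [-> _]] := In_map Ar.
move=> i1 e1.
have [] := @eval_real_integral (imag_part s n).
  by move=> A r Ar; have [[B v] /ms mB [-> _]] := In_map Ar.
move=> i2 e2.
have re : (fun x => complex.Re (simple_eval s x n)) =
    eval_real (real_part s n).
  by apply/funext => x; rewrite simple_evalE.
have im : (fun x => complex.Im (simple_eval s x n)) =
    eval_real (imag_part s n).
  by apply/funext => x; rewrite simple_evalE.
split; last first.
  split.
    by apply: eq_integrable i1 => // x _ /=; rewrite -re.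
  by apply: eq_integrable i2 => // x _ /=; rewrite -im.
rewrite /cintegral re im e1 e2 /simple_integral /real_part /imag_part !big_map /=.
elim: (s) => [|[A v] t IH]; first by rewrite !big_nil.
by rewrite !big_cons IH /=; case: (v n) => a b /=; simpc.
Qed.

End bochner.

Section Xm1_coordinates.
Context {R : realType}.
Variables (q : R) (lambda : nat -> R[i]).
Hypotheses (q0 : 0 < q) (lambda1 : forall n, 0 < normc (1 + lambda n)).

Lemma lq_coord (x : nat -> R[i]) n : ((normc (x n))%:E <= lq_norm q x)%E.
Proof.
have -> : ((normc (x n))%:E = ((normc (x n) `^ q)%:E) `^ q^-1)%E.
  by rewrite poweR_EFin -powRrM mulfV ?gt_eqF// powRr1 ?normc_ge0.
apply: lee_poweR; rewrite ?lee_fin ?powR_ge0 ?invr_ge0 ?(ltW q0)//.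
apply: le_trans (nneseries_lim_ge n.+1 _); last first.
  by move=> m _ _; rewrite lee_fin powR_ge0.
rewrite big_mkord big_ord_recr /= -[leLHS]add0e leeD// sume_ge0// => m _.
by rewrite lee_fin powR_ge0.
Qed.

Lemma Xm1_normE (x : nat -> R[i]) : Xm1_norm q lambda x =
  ((\sum_(0 <= n <oo) ((normc (x n) / normc (1 + lambda n)) `^ q)%:E)
    `^ q^-1)%E.
Proof.
congr (_ `^ _)%E; apply: eq_eseriesr => n _.
by rewrite normcM normcV.
Qed.

(** Coordinate functionals are bounded on X_(-1); through them Bochner integrals are compared with
    scalar ones. *)
Lemma Xm1_coord (x : nat -> R[i]) n :
  ((normc (x n))%:E <= (normc (1 + lambda n))%:E * Xm1_norm q lambda x)%E.
Proof.
have -> : normc (x n) = normc (1 + lambda n) * normc (x n / (1 + lambda n)).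
  by rewrite normcM normcV mulrC divfK// gt_eqF.
rewrite EFinM lee_wpmul2l ?lee_fin ?normc_ge0//.
exact: (lq_coord (fun n => x n / (1 + lambda n))).
Qed.

End Xm1_coordinates.

Section complex_integrals.
Context {R : realType}.
Notation leb := (@lebesgue_measure R).
Variable D : set (measurableTypeR R).
Hypothesis mD : measurable D.

(** Bounding real and imaginary parts separately costs a factor 2, which the constants of the later
    estimates absorb. *)
Lemma normc_cintegral_le (f : R -> R[i]) : cmeasurable D f ->
  ((normc (cintegral leb D f))%:E <=
    2%:E * \int[leb]_(x in D) (normc (f x))%:E)%E.
Proof.
move=> mf.
have key (g : R -> R) : measurable_fun D g ->
    (forall y, `|g y| <= normc (f y)) ->
    ((`|Rintegral leb D g|%R)%:E <= \int[leb]_(x in D) (normc (f x))%:E)%E.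
  move=> mg gf; rewrite /Rintegral; set I := (\int[leb]_(x in D) (g x)%:E)%E.
  apply: (@le_trans _ _ `|I|%E).
    by case: I => [x| |] /=; rewrite ?normr0 ?leey.
  apply: (le_trans (le_abse_integral _ _ _)) => //.
    by apply/measurable_EFinP.
  by apply: le_integral_nonneg => y _; rewrite ?abse_ge0// lee_fin.
have k1 := key _ mf.1 (fun y => Re_le_normc (f y)).
have k2 := key _ mf.2 (fun y => Im_le_normc (f y)).
rewrite mule_natl mule2n; apply: le_trans (leeD k1 k2).
by rewrite -EFinD lee_fin; exact: normc_le_ReIm.
Qed.

Lemma cintegralB (f g : R -> R[i]) :
  leb.-integrable D (fun x => (complex.Re (f x))%:E) ->
  leb.-integrable D (fun x => (complex.Im (f x))%:E) ->
  leb.-integrable D (fun x => (complex.Re (g x))%:E) ->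
  leb.-integrable D (fun x => (complex.Im (g x))%:E) ->
  cintegral leb D (fun x => f x - g x) = cintegral leb D f - cintegral leb D g.
Proof.
move=> f1 f2 g1 g2; rewrite /cintegral.
have -> : Rintegral leb D (fun x => complex.Re (f x - g x)) =
  Rintegral leb D (fun x => complex.Re (f x)) -
  Rintegral leb D (fun x => complex.Re (g x)).
  rewrite -RintegralB//; apply: eq_Rintegral => x _.
  by case: (f x) (g x) => [a b] [a' b'].
have -> : Rintegral leb D (fun x => complex.Im (f x - g x)) =
  Rintegral leb D (fun x => complex.Im (f x)) -
  Rintegral leb D (fun x => complex.Im (g x)).
  rewrite -RintegralB//; apply: eq_Rintegral => x _.
  by case: (f x) (g x) => [a b] [a' b'].
by simpc.
Qed.

Lemma cmeasurableB (f g : R -> R[i]) : cmeasurable D f -> cmeasurable D g ->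
  cmeasurable D (fun x => f x - g x).
Proof.
move=> [f1 f2] [g1 g2]; split.
  rewrite (_ : (fun _ => _) = (fun x => complex.Re (f x) - complex.Re (g x))).
    exact: measurable_funB.
  by apply/funext => x; case: (f x) (g x) => [a b] [a' b'].
rewrite (_ : (fun _ => _) = (fun x => complex.Im (f x) - complex.Im (g x))).
  exact: measurable_funB.
by apply/funext => x; case: (f x) (g x) => [a b] [a' b'].
Qed.

Lemma integrable_cmeasurable (f : R -> R[i]) :
  leb.-integrable D (fun x => (complex.Re (f x))%:E) ->
  leb.-integrable D (fun x => (complex.Im (f x))%:E) -> cmeasurable D f.
Proof.
by move=> /measurable_int/measurable_EFinP h1 /measurable_int/measurable_EFinP h2.
Qed.

Variables (q : R) (lambda : nat -> R[i]).
Hypotheses (q0 : 0 < q) (lambda1 : forall n, 0 < normc (1 + lambda n)).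
Hypothesis Dfin : (leb D < +oo)%E.

(** The n-th coordinates of the simple integrals converge to v n by [c2] and to the scalar integral
    by [c1]. Hence the sequence that admissibility only asserts to exist can be computed coordinate
    by coordinate. *)
Lemma bochner_coord (f : R -> nat -> R[i]) v n :
  is_bochner_integral (Xm1_norm q lambda) D f v ->
  leb.-integrable D (fun x => (complex.Re (f x n))%:E) ->
  leb.-integrable D (fun x => (complex.Im (f x n))%:E) ->
  v n = cintegral leb D (fun x => f x n).
Proof.
move=> [s [wf _ c1 c2]] f1 f2.
have ms k A w : List.In (A, w) (s k) -> measurable A.
  by move=> Aw; exact: (wf k A w Aw).1.
pose N := Xm1_norm q lambda.
set c := normc (1 + lambda n).
have N0 x : (0 <= N x)%E by exact: poweR_ge0.
have key k : ((normc (v n - cintegral leb D (fun x => f x n)))%:E <=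
    c%:E * (N (simple_integral D (s k) - v)%R +
    2%:E * \int[leb]_(x in D) N (f x - simple_eval (s k) x)%R))%E.
  have [e [i1 i2]] := simple_integralE mD Dfin n (ms k).
  have mfs : cmeasurable D (fun x => f x n - simple_eval (s k) x n).
    by apply: cmeasurableB; exact: integrable_cmeasurable.
  have h1 : ((normc (simple_integral D (s k) n - v n))%:E <=
      c%:E * N (simple_integral D (s k) - v)%R)%E.
    exact: (Xm1_coord q0 lambda1 (simple_integral D (s k) - v) n).
  have h2 : ((normc (cintegral leb D (fun x => f x n) -
      simple_integral D (s k) n))%:E <=
      c%:E * (2%:E * \int[leb]_(x in D) N (f x - simple_eval (s k) x)%R))%E.
    rewrite e -cintegralB//; apply: (le_trans (normc_cintegral_le mfs)).
    rewrite muleCA lee_wpmul2l//.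
    rewrite -lee_pdivrMl; last exact: lambda1.
    rewrite -ge0_integralZl//; first last.
    - by rewrite lee_fin invr_ge0 normc_ge0.
    - by move=> x _; rewrite lee_fin normc_ge0.
    - by apply/measurable_EFinP; exact: measurable_normc.
    apply: le_integral_nonneg => x _.
      by rewrite lee_fin mulr_ge0 ?invr_ge0 ?normc_ge0.
    rewrite lee_pdivrMl; last exact: lambda1.
    exact: (Xm1_coord q0 lambda1 (f x - simple_eval (s k) x) n).
  rewrite ge0_muleDr//; last first.
    by rewrite mule_ge0// integral_ge0.
  apply: le_trans (leeD h1 h2); rewrite -EFinD lee_fin.
  have -> : v n - cintegral leb D (fun x => f x n) =
      - ((simple_integral D (s k) n - v n) +
      (cintegral leb D (fun x => f x n) - simple_integral D (s k) n)).
    by ring.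
  by rewrite normcN le_normcD.
have lim : (fun k => c%:E * (N (simple_integral D (s k) - v)%R +
    2%:E * \int[leb]_(x in D) N (f x - simple_eval (s k) x)%R))%E @ \oo --> 0%E.
  rewrite (_ : 0%E = c%:E * (0 + 2%:E * 0))%E; last by rewrite mule0 adde0 mule0.
  apply: cvgeZl => //; apply: cvgeD => //; apply: cvgeZl => //.
have : ((normc (v n - cintegral leb D (fun x => f x n)))%:E <= 0)%E.
  by apply: cvge_to_ge lim _; apply: nearW => k; exact: key.
rewrite lee_fin => h; apply/eqP; rewrite -subr_eq0; apply/eqP.
by apply: eq0_normc; apply: le_anti; rewrite h normc_ge0.
Qed.

End complex_integrals.

(** * Existence of Bochner integrals for dominated coordinates *)

Section bochner_existence.
Context {R : realType}.
Notation leb := (@lebesgue_measure R).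
Variables (q : R) (lambda : nat -> R[i]).
Hypothesis q0 : 0 < q.

Definition coordinate_simple (s : seq (set R * R[i])) (n : nat) : @simple_fct R :=
  [seq (Ac.1, fun m => if m == n then Ac.2 else 0) | Ac <- s].

(** Only the coordinates below k are filled: the values are then finitely supported sequences, which
    always belong to X_(-1). *)
Definition simple_of_coordinates (phi : nat -> seq (set R * R[i])) (k : nat) :
    @simple_fct R :=
  flatten [seq coordinate_simple (phi n) n | n <- iota 0 k].

Lemma simple_of_coordinatesE phi k x m :
  simple_eval (simple_of_coordinates phi k) x m =
  if (m < k)%N then eval_complex (phi m) x else 0.
Proof.
rewrite /simple_eval /simple_of_coordinates big_flatten big_map.
rewrite (eq_bigr (fun n => if n == m then eval_complex (phi n) x else 0)).
  have -> : iota 0 k = index_iota 0 k by rewrite /index_iota subn0.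
  by rewrite -big_mkcond big_nat1_eq.
move=> n _; rewrite big_map /= eq_sym; case: eqP => // _.
by rewrite big1// => i _; rewrite mulr0.
Qed.

Lemma coordinate_simple_wf phi k A v :
  (forall n A c, List.In (A, c) (phi n) -> measurable A) ->
  List.In (A, v) (simple_of_coordinates phi k) ->
  measurable A /\ (Xm1_norm q lambda v < +oo)%E.
Proof.
move=> mphi Av; have [s sk As] := In_flatten Av.
have [n _ sE] := In_map sk; rewrite sE in As.
have [[B c] Bc [-> ->]] := In_map As; split; first exact: mphi Bc.
rewrite Xm1_normE; apply: poweR_lty.
rewrite (@nneseries_split _ _ 0 n.+1); last first.
  by move=> m _; rewrite lee_fin powR_ge0.
rewrite [X in (_ + X)%E]eseries0 => [|m nm _].
  by rewrite adde0 sumEFin ltry.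
by rewrite add0n in nm; rewrite gtn_eqF// normc0 mul0r powR0// gt_eqF.
Qed.

Variable D : set (measurableTypeR R).
Hypotheses (mD : measurable D) (Dfin : (leb D < +oo)%E).
Variables (f : R -> nat -> R[i]) (B : nat -> R) (U : R -> R).
Hypotheses (mf : forall n, cmeasurable D (fun x => f x n)).
Hypotheses (mU : measurable_fun D U) (U0 : forall x, 0 <= U x)
  (Ufin : (\int[leb]_(x in D) (U x)%:E < +oo)%E).
Hypotheses (B0 : forall n, 0 <= B n)
  (Bfin : (\sum_(0 <= n <oo) ((B n / normc (1 + lambda n)) `^ q)%:E < +oo)%E).
Hypothesis fB : forall x n, D x -> normc (f x n) <= B n * U x.

(** Extension by 0 outside D, since the approximation by simple functions is stated on the whole
    line. *)
Let restrict_coordinate n (x : R) : R[i] := if x \in D then f x n else 0.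

Let measurable_restrict_coordinate n : cmeasurable setT (restrict_coordinate n).
Proof.
have [m1 m2] := mf n; split.
- rewrite (_ : (fun _ => _) = (fun x => complex.Re (f x n)) \_ D).
    by apply: (measurable_restrictT _ mD).1.
  by apply/funext => x; rewrite patchE /restrict_coordinate; case: ifP.
- rewrite (_ : (fun _ => _) = (fun x => complex.Im (f x n)) \_ D).
    by apply: (measurable_restrictT _ mD).1.
  by apply/funext => x; rewrite patchE /restrict_coordinate; case: ifP.
Qed.

Lemma integrable_dominated_coordinate n :
  leb.-integrable D (fun x => (complex.Re (f x n))%:E) /\
  leb.-integrable D (fun x => (complex.Im (f x n))%:E).
Proof.
have iBU : leb.-integrable D (EFin \o (fun x => B n * U x)).
  apply/integrableP; split.
    by apply/measurable_EFinP; apply: measurable_funM => //; exact: measurable_cst.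
  rewrite (eq_integral (fun x : measurableTypeR R =>
    (B n)%:E * (U x)%:E)%E); last first.
    by move=> x _; rewrite /= ger0_norm ?mulr_ge0.
  rewrite ge0_integralZl//.
  + by rewrite lte_mul_pinfty ?lee_fin.
  + by apply/measurable_EFinP.
  + by move=> x _; rewrite lee_fin.
  + by rewrite lee_fin.
have [m1 m2] := mf n; split.
  apply: (le_integrable mD _ _ iBU); first by apply/measurable_EFinP.
  move=> x Dx /=; rewrite lee_fin [leRHS]ger0_norm ?mulr_ge0//.
  exact: le_trans (Re_le_normc _) (fB n Dx).
apply: (le_integrable mD _ _ iBU); first by apply/measurable_EFinP.
move=> x Dx /=; rewrite lee_fin [leRHS]ger0_norm ?mulr_ge0//.
exact: le_trans (Im_le_normc _) (fB n Dx).
Qed.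

(** Dominated convergence is used over n at fixed x, with the summable majorant given by B, and then
    over x, with a multiple of U as majorant. Convergence of the integrals follows coordinatewise in
    the same way. *)
Lemma bochner_exists : is_bochner_integral (Xm1_norm q lambda) D f
  (fun n => cintegral leb D (fun x => f x n)).
Proof.
have [phi hphi] := choice (fun n =>
  complex_simple_approx (measurable_restrict_coordinate n)).
(* Diagonal choice: k is both the number of coordinates kept and the accuracy of each. *)
pose s k := simple_of_coordinates (phi ^~ k) k.
have ms k : forall n A c, List.In (A, c) (phi n k) -> measurable A.
  by move=> n A c; have [h _ _] := hphi n; exact: h.
have mws k A v : List.In (A, v) (s k) -> measurable A.
  by move=> /(coordinate_simple_wf (ms k))[].
have sE k x m : simple_eval (s k) x m =
    if (m < k)%N then eval_complex (phi m k) x else 0.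
  exact: simple_of_coordinatesE.
pose E k m (x : R) := normc (f x m - simple_eval (s k) x m).
(* The factor 2 of [complex_simple_approx] also covers the coordinates m >= k, where the approximant
   is 0. *)
have Ele k m x : D x -> E k m x <= 2 * (B m * U x).
  move=> Dx; apply: (@le_trans _ _ (2 * normc (f x m))); last first.
    by rewrite ler_wpM2l// fB.
  rewrite /E sE; case: ifP => _.
    have [_ /(_ k x) h _] := hphi m.
    by rewrite /restrict_coordinate mem_set// in h.
  by rewrite subr0 ler_peMl ?normc_ge0// ler1n.
have Ecvg m x : D x -> (fun k => E k m x) @ \oo --> 0.
  move=> Dx; have [_ _ /(_ x) h] := hphi m.
  rewrite /restrict_coordinate mem_set// in h.
  apply: cvg_trans h; apply: near_eq_cvg.
  exists m.+1 => // k /= mk; by rewrite /E sE mk.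
have mE k m : measurable_fun D (E k m).
  apply: measurable_normc => //; apply: cmeasurableB => //.
  have [_ [i1 i2]] := simple_integralE mD Dfin m (mws k).
  exact: integrable_cmeasurable.
have E0 k m x : 0 <= E k m x by exact: normc_ge0.
pose S := (\sum_(0 <= n <oo) ((B n / normc (1 + lambda n)) `^ q)%:E)%E.
have SF : (S < +oo)%E by exact: Bfin.
have S0 : (0 <= S)%E by apply: nneseries_ge0 => n _ _; rewrite lee_fin powR_ge0.
have SU (c : R) : 0 <= c ->
    (\sum_(0 <= n <oo) (((c * B n) / normc (1 + lambda n)) `^ q)%:E =
     (c `^ q)%:E * S)%E.
  move=> cc; rewrite -nneseriesZl; last by move=> n _; rewrite lee_fin powR_ge0.
  apply: eq_eseriesr => n _; rewrite -EFinM -powRM ?mulrA//.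
  by rewrite divr_ge0 ?normc_ge0.
have nE k x : Xm1_norm q lambda (f x - simple_eval (s k) x)%R =
    ((\sum_(0 <= n <oo) ((E k n x / normc (1 + lambda n)) `^ q)%:E) `^ q^-1)%E.
  by rewrite Xm1_normE.
have nle k x : D x -> (\sum_(0 <= n <oo) ((E k n x / normc (1 + lambda n)) `^ q)%:E
    <= ((2 * U x) `^ q)%:E * S)%E.
  move=> Dx; rewrite -SU; last by rewrite mulr_ge0.
  apply: lee_nneseries => n _; first by rewrite lee_fin powR_ge0.
  rewrite lee_fin ge0_ler_powR ?nnegrE ?divr_ge0 ?mulr_ge0 ?normc_ge0 ?(ltW q0)//.
  rewrite ler_wpM2r ?invr_ge0 ?normc_ge0//.
  apply: le_trans (Ele k n x Dx) _.
  by rewrite le_eqVlt; apply/orP; left; apply/eqP; ring.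
have qV0 : 0 <= q^-1 by rewrite invr_ge0 ltW.
(* Coordinatewise convergence under a majorant in X_(-1) implies convergence in norm; it serves for
   the functions at fixed x and again for their integrals. *)
have coord_cvg (e : nat -> nat -> R) (g : nat -> R) :
    (forall k n, 0 <= e k n <= g n) -> (forall n, e ^~ n @ \oo --> 0) ->
    (\sum_(0 <= n <oo) ((g n / normc (1 + lambda n)) `^ q)%:E < +oo)%E ->
    (fun k => (\sum_(0 <= n <oo) ((e k n / normc (1 + lambda n)) `^ q)%:E)
      `^ q^-1)%E @ \oo --> 0%E.
  move=> eg ce gfin; apply: poweR_cvg0.
  - by rewrite invr_gt0.
  - by move=> k; apply: nneseries_ge0 => n _ _; rewrite lee_fin powR_ge0.
  apply: (nneseries_dominated_cvg0
    (G := fun n => (g n / normc (1 + lambda n)) `^ q)) => //.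
    move=> k n; have /andP[h1 h2] := eg k n.
    rewrite !lee_fin powR_ge0/= ge0_ler_powR ?nnegrE ?divr_ge0 ?normc_ge0 ?(ltW q0)//.
      exact: le_trans h2.
    by rewrite ler_wpM2r ?invr_ge0 ?normc_ge0.
  move=> n; have := @poweR_cvg0 R (fun k => (e k n / normc (1 + lambda n))%:E) q q0.
  apply; first by move=> k; rewrite lee_fin divr_ge0 ?normc_ge0//; case/andP: (eg k n).
  apply: cvg_EFin; first exact: nearW.
  rewrite -(mul0r (normc (1 + lambda n))^-1); apply: cvgMl.
  exact: ce.
have pcvg x : D x ->
    (fun k => Xm1_norm q lambda (f x - simple_eval (s k) x)%R) @ \oo --> 0%E.
  move=> Dx; under eq_fun do rewrite nE.
  apply: (coord_cvg _ (fun n => (2 * U x) * B n)).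
  - move=> k n; rewrite E0/=; apply: le_trans (Ele k n x Dx) _.
    by rewrite le_eqVlt; apply/orP; left; apply/eqP; ring.
  - by move=> n; exact: Ecvg.
  - by rewrite SU ?mulr_ge0// lte_mul_pinfty ?lee_fin ?powR_ge0.
have Sfin : S \is a fin_num by rewrite ge0_fin_numE.
exists s; split.
- by move=> k A v Av; exact: (coordinate_simple_wf (ms k) Av).
- by apply: aeW => x; exact: pcvg.
- have Z : (\int[leb]_(x in D) cst 0 x = 0)%E by exact: integral0.
  have := @dominated_cvg _ _ _ leb D mD
    (fun k x => Xm1_norm q lambda (f x - simple_eval (s k) x)%R) (cst 0%E)
    (fun x => (2 * U x * fine (S `^ q^-1)%E)%:E).
  rewrite Z; apply.
  + move=> k; rewrite (_ : (fun _ => _) = (fun x => ((\sum_(0 <= n <oo)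
      ((E k n x / normc (1 + lambda n)) `^ q)%:E) `^ q^-1)%E)).
      apply: (measurableT_comp (measurable_poweR _)).
      apply: ge0_emeasurable_sum => [n x Dx _|n _]; first by rewrite lee_fin powR_ge0.
      apply/measurable_EFinP; apply: (measurableT_comp (measurable_powR _)).
      by apply: measurable_funM => //; exact: measurable_cst.
    by apply/funext => x; rewrite nE.
  + by move=> x Dx; exact: pcvg.
  + by [].
  + apply/integrableP; split.
      apply/measurable_EFinP; apply: measurable_funM; last exact: measurable_cst.
      by apply: measurable_funM => //; exact: measurable_cst.
    rewrite (eq_integral (fun x : measurableTypeR R =>
      (2 * fine (S `^ q^-1)%E)%:E * (U x)%:E)%E); last first.
      move=> x _; rewrite /= ger0_norm ?mulr_ge0 ?fine_ge0 ?poweR_ge0//.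
      by rewrite mulrAC.
    rewrite ge0_integralZl//.
    * by rewrite lte_mul_pinfty// lee_fin mulr_ge0 ?fine_ge0 ?poweR_ge0.
    * by apply/measurable_EFinP.
    * by move=> x _; rewrite lee_fin.
    * by rewrite lee_fin mulr_ge0 ?fine_ge0 ?poweR_ge0.
  + move=> k x Dx; rewrite gee0_abs; last by rewrite poweR_ge0.
    rewrite nE; apply: (@le_trans _ _ ((((2 * U x) `^ q)%:E * S) `^ q^-1)%E).
      apply: lee_poweR => //; last exact: nle.
      by apply: nneseries_ge0 => n _ _; rewrite lee_fin powR_ge0.
    rewrite poweRM ?lee_fin ?powR_ge0// poweR_EFin -powRrM mulfV ?gt_eqF//.
    by rewrite powRr1 ?mulr_ge0// [leRHS]EFinM fineK// fin_num_poweR.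
- rewrite (_ : (fun _ => _) = (fun k => ((\sum_(0 <= n <oo)
      ((normc (simple_integral D (s k) n - cintegral leb D (fun x => f x n)) /
        normc (1 + lambda n)) `^ q)%:E) `^ q^-1)%E)); last first.
    by apply/funext => k; rewrite Xm1_normE.
  pose W := fine (\int[leb]_(x in D) (U x)%:E)%E.
  have WE : (\int[leb]_(x in D) (U x)%:E = W%:E)%E.
    rewrite fineK// ge0_fin_numE//; apply: integral_ge0 => x _.
    by rewrite lee_fin.
  have W0 : 0 <= W by apply: fine_ge0; apply: integral_ge0 => x _; rewrite lee_fin.
  have sle k n : ((normc (simple_integral D (s k) n -
      cintegral leb D (fun x => f x n)))%:E <=
      2%:E * \int[leb]_(x in D) (E k n x)%:E)%E.
    have [e [i1 i2]] := simple_integralE mD Dfin n (mws k).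
    have [j1 j2] := integrable_dominated_coordinate n.
    rewrite -normcN opprB e -cintegralB//; apply: normc_cintegral_le => //.
    by apply: cmeasurableB => //; exact: integrable_cmeasurable.
  have Eint k n : (\int[leb]_(x in D) (E k n x)%:E <= (2 * B n * W)%:E)%E.
    rewrite EFinM -WE -ge0_integralZl//; first last.
    + by rewrite lee_fin mulr_ge0.
    + by move=> x _; rewrite lee_fin.
    + by apply/measurable_EFinP.
    apply: le_integral_nonneg => x Dx; first by rewrite lee_fin.
    by rewrite -EFinM lee_fin -mulrA Ele.
  (* The 4 is the 2 of [normc_cintegral_le] times the 2 of [Ele]. *)
  apply: (coord_cvg _ (fun n => (4 * W) * B n)).
  + move=> k n; rewrite normc_ge0/= -lee_fin; apply: (le_trans (sle k n)).
    apply: (@le_trans _ _ (2%:E * (2 * B n * W)%:E)%E).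
      by rewrite lee_wpmul2l.
    rewrite -EFinM lee_fin le_eqVlt; apply/orP; left; apply/eqP; ring.
  + move=> n; apply: (@squeeze_cvgr _ _ _ _ (cst 0)
      (fun k => fine (2%:E * \int[leb]_(x in D) (E k n x)%:E)%E)).
    * apply: nearW => k; rewrite normc_ge0/= -lee_fin fineK//.
      rewrite fin_numM// ge0_fin_numE; last first.
        by apply: integral_ge0 => x _; rewrite lee_fin.
      exact: le_lt_trans (Eint k n) (ltry _).
    * exact: cvg_cst.
    have h : (fun k => (2%:E * \int[leb]_(x in D) (E k n x)%:E)%E) @ \oo --> 0%E.
      rewrite (_ : 0%E = 2%:E * 0)%E; last by rewrite mule0.
      apply: cvgeZl => //.
      have Z : (\int[leb]_(x in D) cst 0 x = 0)%E by exact: integral0.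
      have := @dominated_cvg _ _ _ leb D mD (fun k x => (E k n x)%:E) (cst 0%E)
        (fun x => (2 * (B n * U x))%:E).
      rewrite Z; apply.
      - by move=> k; apply/measurable_EFinP.
      - by move=> x Dx; apply: cvg_EFin; [exact: nearW|exact: Ecvg].
      - by [].
      - apply/integrableP; split.
          apply/measurable_EFinP; apply: measurable_funM; first exact: measurable_cst.
          by apply: measurable_funM => //; exact: measurable_cst.
        rewrite (eq_integral (fun x : measurableTypeR R =>
          (2 * B n)%:E * (U x)%:E)%E); last first.
          by move=> x _; rewrite /= ger0_norm ?mulr_ge0// mulrA.
        rewrite ge0_integralZl//.
        + by rewrite lte_mul_pinfty// lee_fin mulr_ge0.
        + by apply/measurable_EFinP.
        + by move=> x _; rewrite lee_fin.
        + by rewrite lee_fin mulr_ge0.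
      - by move=> k x Dx; rewrite gee0_abs ?lee_fin ?Ele.
    by have [_] := (fine_cvgP _ _).1 h.
  + by rewrite SU ?mulr_ge0// lte_mul_pinfty ?lee_fin ?powR_ge0.
Qed.

End bochner_existence.

(** * Admissibility *)

Section reflection.
Local Open Scope ereal_scope.
Context {R : realType}.
Notation leb := (@lebesgue_measure R).
Variable t : R.

Let phi (s : measurableTypeR R) : measurableTypeR R := (t - s)%R.

Let measurable_phi : measurable_fun setT phi.
Proof. by apply: measurable_funB => //; exact: measurable_cst. Qed.

Let phi_mixin := isMeasurableFun.Build _ _ _ _ _ measurable_phi.
Let phi_mfun : {mfun _ >-> _} := HB.pack phi phi_mixin.

Lemma lebesgue_measure_reflect (A : set R) : measurable A ->
  leb A = pushforward leb phi_mfun A.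
Proof.
move=> mA; apply: lebesgue_measure_unique => //= _ [[a b] _ <-].
rewrite /pushforward.
(* The reflection turns ]a, b] into [t - b, t - a[, of the same length; uniqueness of Lebesgue
   measure does the rest. *)
rewrite (_ : _ @^-1` _ = `[(t - b)%R, (t - a)%R[%classic); last first.
  apply/seteqP; split => s /=; rewrite !in_itv/= /phi => /andP[h1 h2];
    apply/andP; split; lra.
rewrite !lebesgue_measure_itv/= !lte_fin ltrD2l ltrN2.
by case: ifPn => // _; rewrite -!EFinD; congr EFin; ring.
Qed.

Lemma integral_reflect (g : R -> \bar R) : measurable_fun setT g ->
  (forall x, 0 <= g x) -> \int[leb]_s g (t - s)%R = \int[leb]_s g s.
Proof.
move=> mg g0.
rewrite -[LHS](@ge0_integral_pushforward _ _ _ _ _ phi measurable_phi leb setT g)//.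
by apply: eq_measure_integral => A mA _; exact/esym/lebesgue_measure_reflect.
Qed.

End reflection.

(** * Explicit integral of the exponential orbits *)

Section exponential_integral.
Context {R : realType}.
Notation leb := (@lebesgue_measure R).

(** The real part of e^(-l (L - s)) b for l = x + i y and b = b1 + i b2. Replacing b by -i b, that
    is (b1, b2) by (b2, -b1), gives the imaginary part. *)
Definition expR_trig (x y b1 b2 L s : R) : R := expR (- (x * (L - s))) *
  (cos (y * (L - s)) * b1 + sin (y * (L - s)) * b2).

(** Differentiation in s multiplies b by l, so the family is closed under derivation and primitives
    are explicit. *)
Lemma is_derive_expR_trig (x y b1 b2 L s : R) :
  is_derive s 1 (expR_trig x y b1 b2 L)
    (expR_trig x y (x * b1 - y * b2) (x * b2 + y * b1) L s).
Proof.
rewrite /expR_trig.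
have dl (k : R) : is_derive s 1 (fun s => k * (L - s)) (- k).
  have d1 : is_derive s 1 (fun s : R => L - s) (0 - 1) by exact: is_deriveB.
  have := @is_deriveZ _ _ _ (fun s : R => L - s) k s 1 _ d1.
  by rewrite sub0r scalerN /GRing.scale /= mulr1.
have dE : is_derive s 1 (fun s => expR (- (x * (L - s))))
    (expR (- (x * (L - s))) * x).
  have d1 : is_derive s 1 (fun s => - (x * (L - s))) x.
    by have := is_deriveN (dl x); rewrite opprK.
  exact: (@is_derive1_comp _ expR (fun s => - (x * (L - s)))).
have dC : is_derive s 1 (fun s => cos (y * (L - s)))
    (- sin (y * (L - s)) * - y).
  by have := dl y => d1; exact: (@is_derive1_comp _ cos (fun s => y * (L - s))).
have dS : is_derive s 1 (fun s => sin (y * (L - s)))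
    (cos (y * (L - s)) * - y).
  by have := dl y => d1; exact: (@is_derive1_comp _ sin (fun s => y * (L - s))).
have dCb := is_deriveM dC (is_derive_cst b1 s 1).
have dSb := is_deriveM dS (is_derive_cst b2 s 1).
have [h1 h2] := is_deriveM dE (is_deriveD dCb dSb).
split; first exact: h1.
rewrite [LHS]h2 /GRing.scale /=.
rewrite (_ : (_ + _)%R s = cos (y * (L - s)) * b1 + sin (y * (L - s)) * b2)//.
ring.
Qed.

Lemma continuous_expR_trig (x y b1 b2 L : R) :
  continuous (expR_trig x y b1 b2 L).
Proof.
move=> s; apply: differentiable_continuous; apply/derivable1_diffP.
by have [] := is_derive_expR_trig x y b1 b2 L s.
Qed.

Lemma integral_expR_trig (x y b1 b2 L : R) : 0 < L ->
  Rintegral leb `]0, L[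
    (expR_trig x y (x * b1 - y * b2) (x * b2 + y * b1) L) =
  b1 - expR (- (x * L)) * (cos (y * L) * b1 + sin (y * L) * b2).
Proof.
move=> L0; pose f := expR_trig x y (x * b1 - y * b2) (x * b2 + y * b1) L.
have cf : continuous f by exact: continuous_expR_trig.
have := @continuous_FTC2 R f (expR_trig x y b1 b2 L) 0 L L0.
rewrite /Rintegral => h.
rewrite -(@integral_itv_bndoo _ 0 L _ true false); last first.
  apply/measurable_EFinP; apply: (@measurable_funS _ _ _ _ setT) => //.
  exact: continuous_measurable_fun.
rewrite h//.
- rewrite -EFinB /= /expR_trig !subrr !subr0 !mulr0 oppr0 expR0 cos0 sin0.
  ring.
- exact: continuous_subspaceT.
- split.
  + by move=> s _; have [] := is_derive_expR_trig x y b1 b2 L s.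
  + by apply: cvg_at_right_filter; exact: continuous_expR_trig.
  + by apply: cvg_at_left_filter; exact: continuous_expR_trig.
- move=> s _; rewrite derive1E.
  by have [_ ->] := is_derive_expR_trig x y b1 b2 L s.
Qed.

End exponential_integral.

Section cexp_facts.
Context {R : realType}.

Lemma Re_cexp_mul (l b : R[i]) (L s : R) :
  complex.Re (cexp (- (l * (L - s)%:C)) * b) =
  expR_trig (complex.Re l) (complex.Im l) (complex.Re b) (complex.Im b) L s.
Proof.
case: l b => x y [b1 b2]; rewrite /expR_trig /=.
rewrite !mulr0 subr0 add0r cosN sinN; ring.
Qed.

Lemma Im_cexp_mul (l b : R[i]) (L s : R) :
  complex.Im (cexp (- (l * (L - s)%:C)) * b) =
  expR_trig (complex.Re l) (complex.Im l) (complex.Im b) (- complex.Re b) L s.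
Proof.
case: l b => x y [b1 b2]; rewrite /expR_trig /=.
rewrite !mulr0 subr0 add0r cosN sinN; ring.
Qed.

Lemma normc_cexp_mul (l : R[i]) (a : R) :
  normc (cexp (- (l * a%:C))) = expR (- (complex.Re l * a)).
Proof. by rewrite normc_cexp; case: l => x y /=; rewrite mulr0 subr0. Qed.

Lemma cintegral_cexp (l b : R[i]) (L : R) : 0 < L -> l != 0 ->
  cintegral (@lebesgue_measure R) `]0, L[
    (fun s => cexp (- (l * (L - s)%:C)) * b) =
  (1 - cexp (- (l * L%:C))) * (b / l).
Proof.
(* Writing b as l (b / l) exhibits the integrand as a derivative. *)
move=> L0 l0; have bE : b = l * (b / l) by rewrite mulrC divfK.
move: (b / l) bE => be ->; rewrite /cintegral.
have -> : (fun s => complex.Re (cexp (- (l * (L - s)%:C)) * (l * be))) =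
    expR_trig (complex.Re l) (complex.Im l)
      (complex.Re l * complex.Re be - complex.Im l * complex.Im be)
      (complex.Re l * complex.Im be + complex.Im l * complex.Re be) L.
  apply/funext => s; rewrite Re_cexp_mul.
  by case: l be {l0} => x y [b1 b2].
rewrite integral_expR_trig//.
have -> : (fun s => complex.Im (cexp (- (l * (L - s)%:C)) * (l * be))) =
    expR_trig (complex.Re l) (complex.Im l)
      (complex.Re l * complex.Im be - complex.Im l * - complex.Re be)
      (complex.Re l * - complex.Re be + complex.Im l * complex.Im be) L.
  apply/funext => s; rewrite Im_cexp_mul.
  case: l be {l0} => x y [b1 b2] /=.
  by congr expR_trig; ring.
rewrite integral_expR_trig//.
case: l be {l0} => x y [b1 b2] /=.
rewrite /cexp /= !mulr0 subr0 add0r cosN sinN.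
by congr (_ +i* _); ring.
Qed.

End cexp_facts.

Section admissibility.
Context (R : realType).
Variables (p q c : R) (lambda b : nat -> R[i]).
Hypotheses (p1 : 1 < p) (q1 : 1 < q).
Hypotheses (c0 : 0 < c) (c1 : c <= 1).
Hypotheses (lambda0 : forall n, lambda n != 0)
  (Re_lambda : forall n, c * normc (lambda n) <= complex.Re (lambda n)).

Notation leb := (@lebesgue_measure R).
Notation w := (carleson_weight q lambda b).
Notation rho := (inv_radius lambda).
Let rho_gt0 := radius_gt0 lambda0.

Let p0 : 0 < p. Proof. exact: lt_trans p1. Qed.
Let q0 : 0 < q. Proof. exact: lt_trans q1. Qed.

Let Re_ge0 n : 0 <= complex.Re (lambda n).
Proof. by apply: le_trans (Re_lambda n); rewrite mulr_ge0 ?normc_ge0// ltW. Qed.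

Let lambda1 n : 0 < normc (1 + lambda n).
Proof. by apply: lt_le_trans (normc1D_ge (Re_ge0 n)).1. Qed.

Let lambda_rho n : normc (lambda n) = (rho n)^-1.
Proof. by rewrite invrK. Qed.

Let c_rho n : c / rho n <= complex.Re (lambda n).
Proof. by rewrite -lambda_rho. Qed.

Lemma Xm1_summable : Xm1 q lambda b ->
  (\sum_(0 <= n <oo) ((normc (b n) / normc (1 + lambda n)) `^ q)%:E < +oo)%E.
Proof.
by rewrite /Xm1 /= Xm1_normE => /lty_poweRy; apply; rewrite invr_eq0 gt_eqF.
Qed.

Lemma cmeasurable_orbit (u : R -> R[i]) (t : R) (D : set (measurableTypeR R)) n :
  measurable D -> cmeasurable D u ->
  cmeasurable D (fun s => diag_sg lambda (t - s) b n * u s).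
Proof.
move=> mD [u1 u2].
have mt (x : R) (g : R -> R) : continuous g ->
    measurable_fun D (fun s => g (x * (t - s))).
  move=> cg; apply: (measurableT_comp (continuous_measurable_fun cg)).
  apply: measurable_funM; first exact: measurable_cst.
  by apply: measurable_funB; [exact: measurable_cst|exact: measurable_id].
have mE x b1 b2 y : measurable_fun D (expR_trig x y b1 b2 t).
  apply: (@measurable_funS _ _ _ _ setT) => //.
  by apply: continuous_measurable_fun; exact: continuous_expR_trig.
rewrite /diag_sg; split.
  rewrite (_ : (fun _ => _) = (fun s =>
    expR_trig (complex.Re (lambda n)) (complex.Im (lambda n)) (complex.Re (b n))
      (complex.Im (b n)) t s * complex.Re (u s) -
    expR_trig (complex.Re (lambda n)) (complex.Im (lambda n)) (complex.Im (b n))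
      (- complex.Re (b n)) t s * complex.Im (u s))).
    by apply: measurable_funB; exact: measurable_funM.
  apply/funext => s; rewrite -Re_cexp_mul -Im_cexp_mul.
  by case: (cexp _ * _) (u s) => [a1 a2] [d1 d2].
rewrite (_ : (fun _ => _) = (fun s =>
  expR_trig (complex.Re (lambda n)) (complex.Im (lambda n)) (complex.Re (b n))
    (complex.Im (b n)) t s * complex.Im (u s) +
  expR_trig (complex.Re (lambda n)) (complex.Im (lambda n)) (complex.Im (b n))
    (- complex.Re (b n)) t s * complex.Re (u s))).
  by apply: measurable_funD; exact: measurable_funM.
apply/funext => s; rewrite -Re_cexp_mul -Im_cexp_mul.
by case: (cexp _ * _) (u s) => [a1 a2] [d1 d2].
Qed.

Lemma normc_orbit (u : R -> R[i]) (t s : R) n :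
  normc (diag_sg lambda (t - s) b n * u s) =
  expR (- (complex.Re (lambda n) * (t - s))) * normc (b n) * normc (u s).
Proof. by rewrite /diag_sg !normcM normc_cexp_mul. Qed.

Lemma normc_orbit_le (u : R -> R[i]) (t s : R) n : s <= t ->
  normc (diag_sg lambda (t - s) b n * u s) <= normc (b n) * normc (u s).
Proof.
move=> st; rewrite normc_orbit -mulrA ler_piMl ?mulr_ge0 ?normc_ge0//.
by rewrite -[leRHS]expR0 ler_expR oppr_le0 mulr_ge0// subr_ge0.
Qed.

Lemma lebesgue_measure_0itv (t : R) : 0 <= t ->
  leb `]0, t[%classic = t%:E.
Proof.
move=> t0; rewrite lebesgue_measure_itv/= lte_fin.
case: ltP => h; first by rewrite sube0.
by congr EFin; apply: le_anti; rewrite h t0.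
Qed.

Lemma admissible_growth : admissible q lambda p b -> carleson_growth p q lambda b.
Proof.
move=> [bX [K K0 adm]].
(* One has |1 - e^(-lambda L)| >= 1 - e^(-L Re lambda), and L Re lambda >= c L / rho >= c when rho
   <= L. *)
pose kappa := 1 - expR (- c).
have kappa0 : 0 < kappa by rewrite subr_gt0 -expR0 ltr_expR oppr_lt0.
exists (kappa `^ (- q) * K `^ q); split; first by rewrite mulr_ge0 ?powR_ge0.
move=> L L0; pose D : set (measurableTypeR R) := `]0, L[%classic.
have mD : measurable D by exact: measurable_itv.
have lD : leb D = L%:E by apply: lebesgue_measure_0itv; exact: ltW.
have Dfin : (leb D < +oo)%E by rewrite lD ltry.
pose u : R -> R[i] := fun=> 1.
have nu s : normc (u s) = 1 by exact: normc1.
have mu : cmeasurable D u by split; exact: measurable_cst.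
(* This norm, raised to the power q, produces the growth exponent q / p. *)
have Lu : cLnorm leb D p u = ((L `^ p^-1)%:E)%E.
  rewrite cLnormE// (eq_integral (cst 1%E)); last by move=> s _; rewrite nu powR1.
  by rewrite integral_cst// mul1e -poweR_EFin; congr (_ `^ _)%E; exact: lD.
have Hu : cLfun leb D p u by split => //; rewrite Lu ltry.
have tL : 0 <= L <= L by rewrite lexx (ltW L0).
have [v [bv _ vK]] := adm L u L0 Hu L tL.
have vE n : v n = (1 - cexp (- (lambda n * L%:C))) * (b n / lambda n).
  have fB s m : D s -> normc (diag_sg lambda (L - s) b m * u s) <=
      normc (b m) * normc (u s).
    by rewrite /D/= in_itv/= => /andP[_ sL]; apply: normc_orbit_le; exact: ltW.
  have Ufin : (\int[leb]_(s in D) (normc (u s))%:E < +oo)%E.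
    rewrite (eq_integral (cst 1%E)); last by move=> s _; rewrite nu.
    by rewrite integral_cst// mul1e.
  have mU : measurable_fun D (fun s => normc (u s)) by exact: measurable_normc.
  have [i1 i2] := integrable_dominated_coordinate mD
    (fun n => cmeasurable_orbit L n mD mu) mU (fun x => normc_ge0 (u x)) Ufin
    (fun n => normc_ge0 (b n)) fB n.
  rewrite (bochner_coord mD q0 lambda1 Dfin bv i1 i2) -cintegral_cexp//.
  by congr cintegral; apply/funext => s; rewrite /diag_sg mulr1.
have nv n : rho n <= L -> kappa * normc (b n / lambda n) <= normc (v n).
  move=> rL; rewrite vE [leRHS]normcM ler_wpM2r ?normc_ge0//.
  have h : 1 - normc (cexp (- (lambda n * L%:C))) <=
      normc (1 - cexp (- (lambda n * L%:C))).
    rewrite lerBlDr; have := le_normcD (1 - cexp (- (lambda n * L%:C)))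
      (cexp (- (lambda n * L%:C))).
    by rewrite subrK normc1.
  apply: le_trans h; rewrite lerD2l lerN2 normc_cexp_mul ler_expR lerN2.
  apply: (@le_trans _ _ (c / rho n * L)); last by rewrite ler_wpM2r// ltW.
  by rewrite mulrAC ler_pdivlMr// ler_wpM2l// ltW.
rewrite [leLHS](carleson_nat_measureE q lambda b).
have qV0 : 0 <= q^-1 by rewrite invr_ge0 ltW.
have S1 : (\sum_(0 <= n <oo) (normc (v n) `^ q)%:E <= ((K * L `^ p^-1) `^ q)%:E)%E.
  rewrite Lu -EFinM in vK; rewrite -poweR_EFin.
  apply: le_trans (lee_poweR (ltW q0) (poweR_ge0 _ _) vK).
  rewrite -poweRrM mulVf ?gt_eqF// poweRe1//.
  by apply: nneseries_ge0 => n _ _; rewrite lee_fin powR_ge0.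
rewrite powRM ?powR_ge0 ?(ltW K0)// -powRrM [p^-1 * q]mulrC in S1.
rewrite -mulrA EFinM; apply: le_trans (lee_wpmul2l _ S1); last first.
  by rewrite lee_fin powR_ge0.
rewrite -nneseriesZl; last by move=> n _; rewrite lee_fin powR_ge0.
apply: lee_nneseries => n _; first by rewrite lee_fin mulr_ge0.
rewrite -EFinM lee_fin indicE.
have [|_] := boolP (n \in [set m | 0 < rho m <= L]); last first.
  by rewrite mulr0 mulr_ge0 ?powR_ge0.
rewrite inE /= => /andP[_ rL]; rewrite mulr1 powRN ler_pdivlMl ?powR_gt0//.
rewrite -powRM ?normc_ge0 ?(ltW kappa0)// ge0_ler_powR ?nnegrE ?(ltW q0)//.
- by rewrite mulr_ge0 ?normc_ge0 ?(ltW kappa0).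
- exact: normc_ge0.
- exact: nv.
Qed.

Lemma carleson_bound_admissible : carleson_bound p q lambda b ->
  Xm1 q lambda b -> admissible q lambda p b.
Proof.
move=> [k k0 hk] bX; split => //.
have [C C0 CE] : exists2 C : R, 0 <= C & C = 4 / c ^+ 2.
  by exists (4 / c ^+ 2); rewrite ?divr_ge0 ?sqr_ge0.
(* Adding 1 keeps the admissibility constant positive even when k = 0. *)
exists (2 * C * k `^ q^-1 + 1).
  by rewrite ltr_wpDl// mulr_ge0 ?powR_ge0 ?mulr_ge0.
move=> tau u tau0 [mu ufin] t /andP[t0 tt].
pose D : set (measurableTypeR R) := `]0, t[%classic.
pose Dtau : set (measurableTypeR R) := `]0, tau[%classic.
have mD : measurable D by exact: measurable_itv.
have mDtau : measurable Dtau by exact: measurable_itv.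
have DD : D `<=` Dtau.
  move=> s; rewrite /D /Dtau /= !in_itv/= => /andP[-> st].
  exact: lt_le_trans tt.
have lD : leb D = t%:E by exact: lebesgue_measure_0itv.
have Dfin : (leb D < +oo)%E by rewrite lD ltry.
have muD : cmeasurable D u.
  by split; [exact: measurable_funS mu.1|exact: measurable_funS mu.2].
have mn : measurable_fun D (fun s => normc (u s)) by exact: measurable_normc.
have mntau : measurable_fun Dtau (fun s => normc (u s)) by exact: measurable_normc.
have fB s m : D s -> normc (diag_sg lambda (t - s) b m * u s) <=
    normc (b m) * normc (u s).
  by rewrite /D/= in_itv/= => /andP[_ sL]; apply: normc_orbit_le; exact: ltW.
set N := (\int[leb]_(s in Dtau) (normc (u s) `^ p)%:E)%E.
have N0 : (0 <= N)%E by apply: integral_ge0 => s _; rewrite lee_fin powR_ge0.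
have Nnorm : cLnorm leb Dtau p u = (N `^ p^-1)%E by exact: cLnormE.
have Nfin : (N < +oo)%E.
  move: ufin; rewrite [X in (X < _)%E]Nnorm => /lty_poweRy; apply.
  by rewrite invr_eq0 gt_eqF.
have ND : (\int[leb]_(s in D) (normc (u s) `^ p)%:E <= N)%E.
  apply: ge0_subset_integral => //.
    by apply/measurable_EFinP; exact: (measurableT_comp (measurable_powR _)).
  by move=> s _; rewrite lee_fin powR_ge0.
(* On an interval of finite length |u| <= 1 + |u|^p reduces integrability to the L^p bound. *)
have Ufin : (\int[leb]_(s in D) (normc (u s))%:E < +oo)%E.
  apply: (@le_lt_trans _ _ (\int[leb]_(s in D)
      (1%:E + (normc (u s) `^ p)%:E))%E).
    apply: le_integral_nonneg => s _; first by rewrite lee_fin normc_ge0.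
    rewrite -EFinD lee_fin; case: (leP (normc (u s)) 1) => h.
      by rewrite ler_wpDr// powR_ge0.
    apply: ler_wpDl => //; apply: le1r_powR; exact: ltW.
  rewrite ge0_integralD//.
  - rewrite integral_cst// mul1e lte_add_pinfty//.
    exact: le_lt_trans ND Nfin.
  - by move=> s _; rewrite lee_fin powR_ge0.
  - by apply/measurable_EFinP; exact: (measurableT_comp (measurable_powR _)).
pose f s n := diag_sg lambda (t - s) b n * u s.
exists (fun n => cintegral leb D (fun s => f s n)).
have bex : is_bochner_integral (Xm1_norm q lambda) D f
    (fun n => cintegral leb D (fun s => f s n)).
  apply: (bochner_exists q0 mD Dfin (B := fun n => normc (b n))
    (U := fun s => normc (u s))) => //.
  - by move=> n; exact: cmeasurable_orbit.
  - by move=> s; exact: normc_ge0.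
  - by move=> n; exact: normc_ge0.
  - exact: Xm1_summable.
pose v0 : R -> R := (fun s => normc (u s)) \_ D.
have v00 s : 0 <= v0 s.
  by rewrite /v0 patchE; case: ifP => // _; exact: normc_ge0.
have mv0 : measurable_fun [set: R] v0 by apply: (measurable_restrictT _ mD).1.
(* Reversing time turns the convolution with the semigroup into an integral against a kernel in s,
   to which the Hardy bound applies. *)
pose v s := v0 (t - s).
have v0' s : 0 <= v s by exact: v00.
have mv : measurable_fun [set: R] v.
  apply: (measurableT_comp mv0).
  by apply: measurable_funB; [exact: measurable_cst|exact: measurable_id].
have vint : (\int[leb]_s (v s `^ p)%:E <= N)%E.
  rewrite (@integral_reflect R t (fun s => (v0 s `^ p)%:E)); first last.
  - by move=> s; rewrite lee_fin powR_ge0.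
  - by apply/measurable_EFinP; exact: measurable_fun_powR.
  apply: le_trans ND; rewrite [leRHS]integral_mkcond.
  apply: le_integral_nonneg => s _; first by rewrite lee_fin powR_ge0.
  rewrite /v0 !patchE; case: ifP => // _.
  by rewrite powR0// gt_eqF.
have vfin : (\int[leb]_s (v s `^ p)%:E < +oo)%E by exact: le_lt_trans vint Nfin.
(* Since |b| = |b / lambda| / rho, the modulus of the orbit is |b / lambda| times the left-hand side
   of [expR_le_hkernel]; the extra 2 comes from [normc_cintegral_le]. *)
have coord n : ((normc (cintegral leb D (fun s => f s n)))%:E <=
    (2 * C * normc (b n / lambda n))%:E * hardy v (rho n))%E.
  apply: (le_trans (normc_cintegral_le mD (cmeasurable_orbit t n mD muD))).
  rewrite -mulrA EFinM -muleA lee_wpmul2l//.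
  have mh : measurable_fun [set: R] (fun s => hkernel (rho n) s * v s).
    apply: measurable_funM => //.
    by apply: measurable_hkernel; [exact: measurable_cst|exact: measurable_id].
  have h0 s : 0 <= hkernel (rho n) s * v s.
    exact: mulr_ge0 (hkernel_ge0 _ (ltW (rho_gt0 n))) (v0' s).
  have Cb : 0 <= C * normc (b n / lambda n) by rewrite mulr_ge0 ?normc_ge0.
  rewrite -ge0_integralZl//; first last.
  - by move=> s _; rewrite lee_fin.
  - by apply/measurable_EFinP.
  rewrite -(@integral_reflect R t); first last.
  - by move=> s; rewrite mule_ge0 ?lee_fin.
  - by apply: measurable_funeM; apply/measurable_EFinP.
  rewrite [leLHS]integral_mkcond; apply: le_integral_nonneg => s _.
    by apply: erestrict_ge0 => s' _; rewrite lee_fin normc_ge0.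
  rewrite patchE; case: ifPn => [sD|_]; last by rewrite mule_ge0 ?lee_fin.
  rewrite -EFinM lee_fin normc_orbit /v (_ : t - (t - s) = s); last by ring.
  rewrite /v0 patchE sD mulrA ler_wpM2r ?normc_ge0//.
  rewrite normcM normcV lambda_rho invrK.
  have -> : C * (normc (b n) * rho n) * hkernel (rho n) (t - s) =
     normc (b n) * (rho n * (C * hkernel (rho n) (t - s))) by ring.
  rewrite mulrC ler_wpM2l ?normc_ge0// -ler_pdivrMl//.
  rewrite CE; apply: expR_le_hkernel => //; first by rewrite c0.
  move: sD; rewrite inE /D /= in_itv/= => /andP[_ st].
  by rewrite subr_ge0 ltW.
have vle : (lq_norm q (fun n => cintegral leb D (fun s => f s n)) <=
    (2 * C * k `^ q^-1 + 1)%:E * cLnorm leb Dtau p u)%E.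
  rewrite Nnorm.
  apply: (@le_trans _ _ ((2 * C * k `^ q^-1)%:E * N `^ p^-1)%E); last first.
    by rewrite lee_wpmul2r ?poweR_ge0// lee_fin lerDl.
  have -> : ((2 * C * k `^ q^-1)%:E * N `^ p^-1 =
      (((2 * C) `^ q)%:E * (k%:E * N `^ (q / p))) `^ q^-1)%E.
    rewrite poweRM ?mule_ge0 ?lee_fin ?powR_ge0 ?poweR_ge0//.
    rewrite poweRM ?lee_fin ?poweR_ge0// !poweR_EFin -powRrM mulfV ?gt_eqF//.
    rewrite powRr1 ?mulr_ge0// -poweRrM (_ : q / p * q^-1 = p^-1) ?EFinM ?muleA//.
    by field; rewrite (gt_eqF p0) (gt_eqF q0).
  apply: lee_poweR.
  - by rewrite invr_ge0 ltW.
  - by apply: nneseries_ge0 => n _ _; rewrite lee_fin powR_ge0.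
  have qp0 : 0 <= q / p by rewrite divr_ge0 ?(ltW q0) ?(ltW p0).
  have vint0 : (0 <= \int[leb]_s (v s `^ p)%:E)%E.
    by apply: integral_ge0 => s _; rewrite lee_fin powR_ge0.
  apply: (@le_trans _ _ (((2 * C) `^ q)%:E *
      (k%:E * (\int[leb]_s (v s `^ p)%:E) `^ (q / p)))%E); last first.
    by rewrite !lee_wpmul2l ?lee_fin ?powR_ge0//; exact: lee_poweR.
  apply: le_trans (lee_wpmul2l _ (hk v mv v0' vfin)); last first.
    by rewrite lee_fin powR_ge0.
  rewrite -nneseriesZl; last by move=> n _; rewrite mule_ge0 ?lee_fin ?poweR_ge0.
  apply: lee_nneseries => n _; first by rewrite lee_fin powR_ge0.
  have hf := hardy_fin p1 (rho_gt0 n) mv v0' vfin.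
  have h0 : 0 <= fine (hardy v (rho n)) by rewrite fine_ge0// hardy_ge0// ltW.
  have := coord n; rewrite -(fineK hf) -EFinM lee_fin => cn.
  rewrite poweR_EFin -!EFinM lee_fin /= mulrA.
  rewrite -!powRM ?normc_ge0 ?mulr_ge0 ?normc_ge0//.
  by rewrite ge0_ler_powR ?nnegrE ?normc_ge0 ?mulr_ge0 ?normc_ge0 ?(ltW q0).
split => //; apply: (le_lt_trans vle).
by rewrite Nnorm lte_mul_pinfty ?lee_fin ?addr_ge0 ?mulr_ge0 ?powR_ge0// poweR_lty.
Qed.

End admissibility.

Theorem theorem3p2 (R : realType) (p q p' alpha vtheta : R)
    (lambda b : nat -> R[i]) :
  1 < p -> 1 < q -> p^-1 + p'^-1 = 1 ->
  0 < alpha -> alpha * q = p ->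
  0 < vtheta < pi / 2 ->
  (forall n, sector vtheta (lambda n)) ->
  set_inj (diag_dom q lambda) (diag_op lambda) ->
  let mu := carleson_measure q lambda b in
  (embedding_carleson alpha mu ->
     (forall theta : R, p'^-1 < theta -> Xneg q lambda theta b) /\
     admissible q lambda p b) /\
  (admissible q lambda p b ->
     (forall theta : R, p'^-1 < theta -> Xneg q lambda theta b) /\
     geometric_carleson alpha mu) /\
  (p <= q ->
     (embedding_carleson alpha mu <-> geometric_carleson alpha mu) /\
     (geometric_carleson alpha mu <-> admissible q lambda p b)).
Proof.
move=> p1 q1 pp' alpha0 alphaq hv sec _ mu.
have c0 := cos_sector hv; have c1 := cos_le1 vtheta.
have lambda0 n : lambda n != 0 by exact: (sec n).1.
have Re_lambda n : cos vtheta * normc (lambda n) <= complex.Re (lambda n).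
  exact: sector_Re hv (sec n).
have [_ _ _ p'1 _] := conj_exponent p1 pp'.
have emb_bound : embedding_carleson alpha mu -> carleson_bound p q lambda b.
  exact: (embedding_carleson_bound p1 q1 alpha0 alphaq c0 lambda0 Re_lambda).
have bound_growth : carleson_bound p q lambda b -> carleson_growth p q lambda b.
  exact: (carleson_bound_growth p1 q1 lambda0).
have growth_X : carleson_growth p q lambda b ->
    forall theta, p'^-1 < theta -> Xneg q lambda theta b.
  exact: (growth_Xneg p1 q1 pp' c0 lambda0 Re_lambda).
have bound_adm : carleson_bound p q lambda b -> admissible q lambda p b.
  move=> hb; apply: (carleson_bound_admissible p1 q1 c0 c1 lambda0 Re_lambda hb).
  (* Admissibility includes b in X_(-1), the case theta = 1, which is allowed because 1/p' < 1. *)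
  by apply: Xneg1_Xm1; apply: growth_X => //; exact: bound_growth.
have adm_growth : admissible q lambda p b -> carleson_growth p q lambda b.
  exact: (admissible_growth p1 q1 c0 lambda0 Re_lambda).
have growth_geo : carleson_growth p q lambda b -> geometric_carleson alpha mu.
  exact: (growth_geometric_carleson p1 q1 alpha0 alphaq c0 lambda0 Re_lambda).
have geo_growth : geometric_carleson alpha mu -> carleson_growth p q lambda b.
  exact: (geometric_carleson_growth p1 q1 alpha0 alphaq c0 lambda0 Re_lambda).
have growth_emb : p <= q -> carleson_growth p q lambda b ->
    embedding_carleson alpha mu.
  exact: (growth_embedding_carleson p1 q1 pp' alphaq c0 lambda0 Re_lambda).
split.
  move=> /emb_bound hb; split; last exact: bound_adm.
  exact/growth_X/bound_growth.
split.
  by move=> /adm_growth hg; split; [exact: growth_X|exact: growth_geo].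
move=> pq; split; split.
- by move=> /emb_bound/bound_growth/growth_geo.
- by move=> /geo_growth/(growth_emb pq).
- by move=> /geo_growth/(growth_emb pq)/emb_bound/bound_adm.
- by move=> /adm_growth/growth_geo.
Qed.
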